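(* Let $\varPhi$ be a complex-valued random measure on $\mathbb{R}^d$ (a random variable with values in the space $\mathcal{M}$ of locally finite complex-valued measures on $\mathbb{R}^d$) that is stationary and ergodic, and that is locally square integrable in the sense that \[ \mathbb{E}\Big[\big(|\varPhi_\Re|(A)\big)^2+\big(|\varPhi_\Im|(A)\big)^2\Big]<\infty \quad\text{for all bounded Borel } A\subset\mathbb{R}^d, \] where $\varPhi=\varPhi_\Re+\mathrm{i}\,\varPhi_\Im$ with $\varPhi_\Re,\varPhi_\Im$ signed measures and $|\cdot|$ denotes total variation. Let $\mu^{(2)}$ be the second moment measure of $\varPhi$, defined by $\mu^{(2)}(A\times A')=\mathbb{E}\big[\varPhi(A)\,\overline{\varPhi(A')}\big]$ for bounded Borel $A,A'\subset\mathbb{R}^d$, and let $\mu^{(2)}_{\mathrm{red}}$ be the reduced second moment measure, i.e. the unique locally finite complex measure on $\mathbb{R}^d$ with \[ \int_{\mathbb{R}^d\times\mathbb{R}^d} f(x,y)\,\mathrm{d}\mu^{(2)}(x,y)=\int_{\mathbb{R}^d}\int_{\mathbb{R}^d} f(u+v,u)\,\mathrm{d}\mu^{(2)}_{\mathrm{red}}(v)\,\mathrm{d}\lambda(u) \] for all $f\in C_{\mathsf c}(\mathbb{R}^d\times\mathbb{R}^d,\mathbb{C})$. Let $\varPhi_n:=\varPhi|_{B_n}$ be the restriction of $\varPhi$ to the open ball $B_n$ of radius $n$ centred at $0$. Then, almost surely, the limits \[ \gamma^{(\varPhi)}:=\lim_{n\to\infty}\frac{\varPhi_n*\widetilde{\varPhi_n}}{\lambda(B_n)}\quad\text{and}\quad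 \lim_{n\to\infty}\frac{\varPhi_n*\widetilde{\varPhi}}{\lambda(B_n)} \] exist in the vague topology and both equal $\mu^{(2)}_{\mathrm{red}}$. In particular the autocorrelation $\gamma^{(\varPhi)}$ is non-random.
   Context: $\lambda$ is Lebesgue measure on $\mathbb{R}^d$. For a complex measure $\omega$, $\widetilde{\omega}$ is defined by $\widetilde{\omega}(g)=\overline{\omega(\widetilde g)}$ for $g\in C_{\mathsf c}(\mathbb{R}^d)$, where $\widetilde g(x)=\overline{g(-x)}$. $\mathcal{M}$ carries the vague topology (convergence $\phi_n(f)\to\phi(f)$ for all $f\in C_{\mathsf c}(\mathbb{R}^d)$) and its Borel $\sigma$-algebra. Translations act on measures by $(T_x\phi)(A)=\phi(A-x)$ and on distributions $Q$ on $\mathcal{M}$ by $(T_xQ)(B)=Q(T_{-x}B)$. $\varPhi$ is stationary if its distribution $Q$ satisfies $T_xQ=Q$ for all $x\in\mathbb{R}^d$, and ergodic if every translation-invariant measurable set of measures has $Q$-probability $0$ or $1$. *)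

(* Defs.v *)
From HB Require Import structures.
From mathcomp Require Import all_boot all_order all_algebra.
From mathcomp Require Import all_classical all_reals all_analysis.
From mathcomp Require Import complex.
Set Implicit Arguments. Unset Strict Implicit. Unset Printing Implicit Defensive.
Import Order.TTheory GRing.Theory Num.Theory.
Import numFieldNormedType.Exports.
Local Open Scope classical_set_scope.
Local Open Scope ring_scope.

(* Complex numbers are R[i] (mathcomp-real-closed), R : realType.      *)

(* convergence of a complex sequence (componentwise = in modulus) *)
Definition cvgC (R : realType) (u : nat -> R[i]) (l : R[i]) : Prop :=
  ((fun n => complex.Re (u n)) @ \oo --> complex.Re l) /\
  ((fun n => complex.Im (u n)) @ \oo --> complex.Im l).

(* integral of a complex function against a positive measure *)
Definition Rint (R : realType) d (T : measurableType d)
  (mu : set T -> \bar R) (g : T -> R) : R :=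
  fine (\int[mu]_x (g x)%:E)%E.

Definition cint (R : realType) d (T : measurableType d)
  (mu : set T -> \bar R) (g : T -> R[i]) : R[i] :=
  Complex (Rint mu (fun x => complex.Re (g x)))
          (Rint mu (fun x => complex.Im (g x))).

(* R^d, its Borel sigma-algebra, boundedness, Euclidean balls          *)
Definition Rd (R : realType) (d : nat) := 'rV[R]_d.

(* R^d with its Borel sigma-algebra (generated by the open sets) *)
Definition BRd (R : realType) (d : nat) :=
  g_sigma_algebraType (@open ('rV[R]_d)).

(* squared Euclidean norm *)
Definition sqnorm (R : realType) (d : nat) (x : 'rV[R]_d) : R :=
  \sum_(i < d) x ord0 i ^+ 2.

(* open Euclidean ball of radius r centred at 0 *)
Definition eball0 (R : realType) (d : nat) (r : R) : set 'rV[R]_d :=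
  [set x | sqnorm x < r ^+ 2].
Arguments eball0 {R} d r.

Definition bdd (R : realType) (d : nat) (A : set 'rV[R]_d) : Prop :=
  exists r : R, A `<=` eball0 d r.

(* bounded sets of R^d x R^d *)
Definition bdd2 (R : realType) (d : nat) (A : set ('rV[R]_d * 'rV[R]_d)) :=
  exists r : R, A `<=` (eball0 d r) `*` (eball0 d r).

(* Lebesgue measure on the Borel sets of R^d: the measure giving every
   half-open box its volume (this determines it uniquely) *)
Definition is_lebesgue (R : realType) (d : nat)
  (lam : {measure set (BRd R d) -> \bar R}) : Prop :=
  forall a b : 'rV[R]_d, (forall i, a ord0 i <= b ord0 i) ->
    lam [set x : BRd R d | forall i, a ord0 i <= (x : 'rV[R]_d) ord0 i < b ord0 i]
    = (\prod_(i < d) (b ord0 i - a ord0 i))%:E.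

(* Locally finite complex measures                                     *)
(*   phi = (mu1 - mu2) + i (mu3 - mu4), mu_k locally finite positive    *)
(*   measures (every locally finite complex measure is of this form,   *)
(*   by the Jordan decomposition; all notions below only depend on phi) *)
Record cmeas (R : realType) dT (T : measurableType dT) (bd : set T -> Prop) :=
  CMeas {
    cm1 : {measure set T -> \bar R};
    cm2 : {measure set T -> \bar R};
    cm3 : {measure set T -> \bar R};
    cm4 : {measure set T -> \bar R};
    cm_locfin : forall A, measurable A -> bd A ->
      (cm1 A < +oo /\ cm2 A < +oo /\ cm3 A < +oo /\ cm4 A < +oo)%E }.

(* the space M of locally finite complex measures on R^d *)
Definition M (R : realType) (d : nat) := @cmeas R _ (BRd R d) (@bdd R d).
(* locally finite complex measures on R^d x R^d *)
Definition M2 (R : realType) (d : nat) :=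
  @cmeas R _ (BRd R d * BRd R d)%type (@bdd2 R d).

Section cmeas_ops.
Context (R : realType) dT (T : measurableType dT) (bd : set T -> Prop).
Implicit Types (phi : cmeas R bd).

(* real part Phi_Re and imaginary part Phi_Im (signed measures,
   evaluated on bounded sets) *)
Definition cm_re phi (A : set T) : R := fine (cm1 phi A) - fine (cm2 phi A).
Definition cm_im phi (A : set T) : R := fine (cm3 phi A) - fine (cm4 phi A).

(* phi(A) for bounded Borel A *)
Definition cm_set phi (A : set T) : R[i] := Complex (cm_re phi A) (cm_im phi A).

(* phi(g) = \int g dphi *)
Definition cm_int phi (g : T -> R[i]) : R[i] :=
  (cint (cm1 phi) g - cint (cm2 phi) g) + 'i * (cint (cm3 phi) g - cint (cm4 phi) g).

(* total variation |nu|(A) of a signed set function nu on A *)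
Definition totvar (nu : set T -> R) (A : set T) : \bar R :=
  ereal_sup [set r | exists (n : nat) (F : 'I_n -> set T),
     [/\ (forall i, measurable (F i)), trivIset setT F,
         \bigcup_i F i = A & r = (\sum_(i < n) `|nu (F i)|)%:E]].
End cmeas_ops.

(* Test functions C_c                                                   *)
Definition Cc (R : realType) (d : nat) (f : 'rV[R]_d -> R[i]) : Prop :=
  continuous (fun x => complex.Re (f x)) /\
  continuous (fun x => complex.Im (f x)) /\
  exists r : R, forall x, ~ eball0 d r x -> f x = 0.

Definition Cc2 (R : realType) (d : nat)
  (f : 'rV[R]_d * 'rV[R]_d -> R[i]) : Prop :=
  continuous (fun x => complex.Re (f x)) /\
  continuous (fun x => complex.Im (f x)) /\
  exists r : R, forall x, ~ (eball0 d r `*` eball0 d r) x -> f x = 0.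

(* Operations on (functionals of) measures on R^d                      *)
Section functionals.
Context (R : realType) (d : nat).
Local Notation F := (('rV[R]_d -> R[i]) -> R[i]).

(* restriction to the open ball B_n: phi|_{B_n}(g) = phi(1_{B_n} g) *)
Definition restrF (r : R) (phi : F) : F :=
  fun g => phi (fun x => \1_(eball0 d r) x * g x).

(* omega~(g) = conj (omega (g~)),  g~(x) = conj (g (-x)) *)
Definition tildeF (phi : F) : F :=
  fun g => (phi (fun y => (g (- y))^*))^*.

(* convolution (phi * psi)(f) = \int \int f(x+y) dpsi(y) dphi(x) *)
Definition convF (phi psi : F) : F :=
  fun f => phi (fun x => psi (fun y => f (x + y))).
End functionals.

(* Vague topology on M, its Borel sigma-algebra, translations          *)
Section vague.
Context (R : realType) (d : nat).

Definition vague_subbasic (U : set (M R d)) : Prop :=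
  exists f : 'rV[R]_d -> R[i], Cc f /\ exists V : set (R * R)%type, open V /\
    U = [set phi : M R d | V (complex.Re (cm_int phi f), complex.Im (cm_int phi f))].

(* open sets of the topology generated by the maps phi |-> phi(f) *)
Definition vague_open (U : set (M R d)) : Prop :=
  forall phi, U phi -> exists (n : nat) (S : 'I_n -> set (M R d)),
    [/\ forall k, vague_subbasic (S k), forall k, S k phi &
        \bigcap_k S k `<=` U].

Definition vague_borel : set (set (M R d)) := <<s vague_open >>.

(* psi = T_x phi, i.e. psi(A) = phi(A - x) for bounded Borel A *)
Definition is_translate (x : 'rV[R]_d) (phi psi : M R d) : Prop :=
  forall A : set (BRd R d), measurable A -> bdd A ->
    cm_set psi A = cm_set phi [set a - x | a in (A : set 'rV[R]_d)].

(* T_x B = { T_x phi | phi in B } *)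
Definition shift_set (x : 'rV[R]_d) (B : set (M R d)) : set (M R d) :=
  [set psi | exists2 phi, B phi & is_translate x phi psi].
End vague.

(* Random measures                                                      *)
Section random.
Context (R : realType) (d : nat) dO (O : measurableType dO)
        (P : probability O R).

Definition random_measure (Phi : O -> M R d) : Prop :=
  forall B, vague_borel B -> measurable (Phi @^-1` B).

(* distribution Q of Phi satisfies T_x Q = Q, i.e. Q(T_{-x} B) = Q(B) *)
Definition stationary (Phi : O -> M R d) : Prop :=
  forall (x : 'rV[R]_d) B, vague_borel B ->
    P (Phi @^-1` shift_set (- x) B) = P (Phi @^-1` B).

Definition ergodic (Phi : O -> M R d) : Prop :=
  forall B, vague_borel B -> (forall x : 'rV[R]_d, shift_set x B = B) ->
    P (Phi @^-1` B) = 0%E \/ P (Phi @^-1` B) = 1%E.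

Definition loc_sq_integrable (Phi : O -> M R d) : Prop :=
  forall A : set (BRd R d), measurable A -> bdd A ->
    (\int[P]_w (totvar (cm_re (Phi w)) A * totvar (cm_re (Phi w)) A
              + totvar (cm_im (Phi w)) A * totvar (cm_im (Phi w)) A) < +oo)%E.

(* mu2(A x A') = E[Phi(A) conj(Phi(A'))] *)
Definition is_second_moment (Phi : O -> M R d) (mu2 : M2 R d) : Prop :=
  forall A A' : set (BRd R d), measurable A -> bdd A -> measurable A' -> bdd A' ->
    cm_set mu2 (A `*` A') = cint P (fun w => cm_set (Phi w) A * (cm_set (Phi w) A')^*).

(* \int f dmu2 = \int \int f(u+v,u) dmu_red(v) dlambda(u), f in C_c *)
Definition is_reduced_second_moment (lam : {measure set (BRd R d) -> \bar R})
  (mu2 : M2 R d) (mured : M R d) : Prop :=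
  forall f : 'rV[R]_d * 'rV[R]_d -> R[i], Cc2 f ->
    cm_int mu2 f = cint lam (fun u : BRd R d =>
                     cm_int mured (fun v : BRd R d => f (u + v, u))).
End random.

Arguments random_measure {R d dO O} Phi.
Arguments stationary {R d dO O} P Phi.
Arguments ergodic {R d dO O} P Phi.
Arguments loc_sq_integrable {R d dO O} P Phi.
Arguments is_second_moment {R d dO O} P Phi mu2.
Arguments is_reduced_second_moment {R d} lam mu2 mured.

(* Main.v *)
(** The real and imaginary parts of the convolutions, tested against a real [g],
are integrals [J] of [g (x - y)] against pairs of real components of the random
measure, with [x] in the ball [B_n]. Up to contributions of unit cells meeting the
boundary of [B_n], such an integral is the sum, over the lattice points [k] of the
ball, of [Y o tau_k], where [Y] integrates [g (x - y)] with [y] restricted to one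
unit cell and [tau] is the action of the lattice by translations. Hence everything
reduces to an ergodic theorem for averages over the lattice points of balls.

Almost surely the boundary terms are negligible and the averages converge, by a
maximal inequality for lattice boxes (Vitali covering and transference). That the
limit is constant needs ergodicity under all translations of [R^d], since the
lattice action alone need not be ergodic: subsequential limits of the averages of
[Y] are invariant under real translations, because these only move boundary cells,
and the averages are [L^1]-Cauchy, being asymptotically minimal in the convex hull
of the orbit of [Y].

The constant is the expectation of [Y], which is computed from the second moment
measure by Riemann sums and then from the reduced one by its defining property.
Finally, a countable uniformly dense family of test functions and the maximal
inequality give convergence for all test functions simultaneously. *)
From HB Require Import structures.
From mathcomp Require Import all_boot all_order all_algebra finmap.
From mathcomp Require Import all_classical all_reals all_analysis.
From mathcomp Require Import measurable_realfun complex zify ring lra.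
Require Import Defs.
Set Implicit Arguments. Unset Strict Implicit. Unset Printing Implicit Defensive.
Import Order.TTheory GRing.Theory Num.Theory.
Import numFieldNormedType.Exports.
Local Open Scope classical_set_scope.
Local Open Scope ring_scope.


(** * Real-valued integrals *)

(** A measure in [M] is stored as four positive components that it does not determine, and the vague
    Borel sets see only integrals of continuous functions. Bounds that are to be integrated over the
    law therefore avoid the masses of the components and use [V], a supremum over test functions: it
    is vaguely lower semicontinuous and controlled by the total variations on a larger cube, so its
    square is integrable. Indicators of balls and cells are not test functions; they enter as
    bounded pointwise limits of continuous ones ([baire]). The double integrals are iterated
    integrals, and they are compared with the second moment measure through common Riemann sums over
    meshes instead of Fubini's theorem. Ergodicity is given only for strictly invariant Borel sets,
    so the limits of averages are encoded by sets [lowset] that are invariant at every point and not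
    just almost everywhere. The minimality argument for the averages runs in [L^2], whereas the
    averaged function is only in [L^1]; truncation bridges the two. *)

Section L1.
Context (R : realType) dT (T : measurableType dT).
Implicit Types (m : {measure set T -> \bar R}) (f g : T -> R).

Definition L1 m f := m.-integrable setT (EFin \o f).

Lemma L1_meas m f : L1 m f -> measurable_fun setT f.
Proof. by move=> /integrableP[/measurable_EFinP]. Qed.

Lemma RintE m f : Rint m f = Rintegral m setT f. Proof. by []. Qed.

Lemma eq_Rint m f g : f =1 g -> Rint m f = Rint m g.
Proof. by move=> fg; congr Rint; apply/funext. Qed.

Lemma L1D m f g : L1 m f -> L1 m g -> L1 m (fun x => f x + g x).
Proof. exact: integrableD. Qed.

Lemma L1B m f g : L1 m f -> L1 m g -> L1 m (fun x => f x - g x).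
Proof. exact: integrableB. Qed.

Lemma L1Z m f c : L1 m f -> L1 m (fun x => c * f x).
Proof. by move=> mf; have := @integrableZl _ _ _ m _ measurableT c _ mf. Qed.

Lemma L1_norm m f : L1 m f -> L1 m (fun x => `|f x|).
Proof. exact: integrable_norm. Qed.

Lemma L1_sum m (I : Type) (s : seq I) (F : I -> T -> R) :
  (forall i, L1 m (F i)) -> L1 m (fun x => \sum_(i <- s) F i x).
Proof.
move=> LF; rewrite /L1 (_ : _ \o _ = fun x => (\sum_(i <- s) (F i x)%:E)%E).
  by apply: integrable_sum => // i _; exact: LF.
by apply/funext => x /=; rewrite sumEFin.
Qed.

Lemma le_L1 m f g : measurable_fun setT f -> (forall x, `|f x| <= g x) -> L1 m g -> L1 m f.
Proof.
move=> mf fg; apply: le_integrable => //; first exact/measurable_EFinP.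
by move=> x _ /=; rewrite lee_fin (le_trans (fg x)) // ler_norm.
Qed.

Lemma RintD m f g : L1 m f -> L1 m g -> Rint m (fun x => f x + g x) = Rint m f + Rint m g.
Proof. by move=> mf mg; rewrite !RintE RintegralD. Qed.

Lemma RintB m f g : L1 m f -> L1 m g -> Rint m (fun x => f x - g x) = Rint m f - Rint m g.
Proof. by move=> mf mg; rewrite !RintE RintegralB. Qed.

Lemma RintZ m f c : L1 m f -> Rint m (fun x => c * f x) = c * Rint m f.
Proof. by move=> mf; rewrite !RintE RintegralZl. Qed.

Lemma Rint0 m : Rint m (fun=> 0) = 0.
Proof. by rewrite RintE Rintegral_cst // mul0r. Qed.

Lemma Rint_sum m (I : Type) (s : seq I) (F : I -> T -> R) : (forall i, L1 m (F i)) ->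
  Rint m (fun x => \sum_(i <- s) F i x) = \sum_(i <- s) Rint m (F i).
Proof.
move=> LF; elim: s => [|i s IH].
  by rewrite big_nil -[RHS](Rint0 m); apply: eq_Rint => x; rewrite big_nil.
rewrite big_cons -IH -RintD //; last exact: L1_sum.
by apply: eq_Rint => x; rewrite big_cons.
Qed.

Lemma le_Rint m f g : L1 m f -> L1 m g -> (forall x, f x <= g x) -> Rint m f <= Rint m g.
Proof. by move=> mf mg fg; rewrite !RintE le_Rintegral. Qed.

Lemma Rint_ge0 m f : (forall x, 0 <= f x) -> 0 <= Rint m f.
Proof. by move=> f0; rewrite RintE Rintegral_ge0. Qed.

Lemma normr_Rint m f : L1 m f -> `|Rint m f| <= Rint m (fun x => `|f x|).
Proof. by move=> mf; rewrite !RintE le_normr_Rintegral. Qed.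

Lemma EFin_Rint m f : L1 m f -> (Rint m f)%:E = (\int[m]_x (f x)%:E)%E.
Proof. by move=> mf; rewrite /Rint fineK //; exact: integrable_fin_num. Qed.

Lemma Rint_dct m (f_ : nat -> T -> R) f g :
  (forall n, measurable_fun setT (f_ n)) -> L1 m g ->
  (forall n x, `|f_ n x| <= g x) -> (forall x, f_ ^~ x @ \oo --> f x) ->
  Rint m (f_ n) @[n --> \oo] --> Rint m f.
Proof.
move=> mf mg fg ff.
have mf' : measurable_fun setT f by apply: measurable_fun_cvg => // x _; exact: ff.
have Lf n : L1 m (f_ n) by apply: le_L1 mg => //; exact: fg.
have Lf' : L1 m f.
  apply: le_L1 mg => // x; apply: (cvgr_to_le (cvg_norm (ff x))).
  by apply: nearW => n; exact: fg.
apply/fine_cvg; rewrite EFin_Rint //.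
apply: (@dominated_cvg _ _ _ m setT measurableT _ _ (EFin \o g)) => //.
- by move=> n; apply/measurable_EFinP; exact: mf.
- by move=> x _; apply/cvg_EFin; [exact: nearW|exact: ff].
- by move=> n x _; rewrite lee_fin; exact: fg.
Qed.

Lemma markov_Rint m f t : L1 m f -> 0 <= t ->
  (t%:E * m [set x | t <= `|f x|]%R <= (Rint m (fun x => `|f x|))%:E)%E.
Proof.
move=> mf; rewrite le_eqVlt => /orP[/eqP <-|t0].
  by rewrite mul0e lee_fin Rint_ge0.
rewrite EFin_Rint; last exact: L1_norm.
have := @le_integral_abse _ _ _ m setT measurableT (EFin \o f) t _ t0.
rewrite setTI; apply.
by apply/measurable_EFinP; exact: L1_meas mf.
Qed.

End L1.

Lemma Rint_cst (R : realType) dT (T : measurableType dT) (Q : probability T R) c :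
  Rint Q (fun=> c) = c.
Proof.
transitivity (c * fine (Q setT)); first exact: Rintegral_cst.
by rewrite probability_setT mulr1.
Qed.

Lemma L1_cst (R : realType) dT (T : measurableType dT) (Q : probability T R) (c : R) :
  L1 Q (fun=> c).
Proof. exact: finite_measure_integrable_cst. Qed.

Lemma L1_bdd (R : realType) dT (T : measurableType dT) (Q : probability T R) (f : T -> R) c :
  measurable_fun setT f -> (forall x, `|f x| <= c) -> L1 Q f.
Proof. by move=> mf fc; apply: le_L1 (L1_cst Q c). Qed.

(** * Lattice boxes and a covering lemma *)

Section lattice.
Local Open Scope fset_scope.
Local Open Scope ring_scope.
Variable d : nat.
Local Notation Zd := 'rV[int]_d.
Implicit Types (k j : Zd) (n m : nat).

Definition boxpt n (f : {ffun 'I_d -> 'I_(n.*2.+1)}) : Zd :=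
  \row_i ((f i)%:Z - n%:Z).

(** The cube of sup norm radius [n], given as the image of a finite function space so that its
    cardinality comes from counting functions. *)
Definition Box n : {fset Zd} := [fset boxpt f | f : {ffun 'I_d -> 'I_(n.*2.+1)}].

Lemma boxpt_inj n : injective (@boxpt n).
Proof.
move=> f g fg; apply/ffunP => i; apply: val_inj.
have := congr1 (fun k : Zd => k ord0 i) fg; rewrite !mxE => /addIr [] //.
Qed.

Lemma mem_Box n k : (k \in Box n) = [forall i, `|k ord0 i|%N <= n]%N.
Proof.
apply/imfsetP/forallP => [[f _ ->] i|kn].
  by rewrite mxE; have := ltn_ord (f i); move: (nat_of_ord (f i)) => a; lia.
have h i : (absz (k ord0 i + n%:Z)%R < n.*2.+1)%N by have := kn i; lia.
exists [ffun i => Ordinal (h i)] => //.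
by apply/rowP => i; rewrite mxE ffunE /=; have := kn i; move: (k ord0 i) => a; lia.
Qed.

Lemma BoxP n k : reflect (forall i, `|k ord0 i|%N <= n)%N (k \in Box n).
Proof. by rewrite mem_Box; apply: forallP. Qed.

Lemma card_Box n : #|` Box n| = (n.*2.+1 ^ d)%N.
Proof.
rewrite /Box card_imfset; last exact: boxpt_inj.
by rewrite -cardE card_ffun !card_ord.
Qed.

Lemma Box_opp n k : (- k \in Box n) = (k \in Box n).
Proof. by rewrite !mem_Box; apply: eq_forallb => i; rewrite mxE abszN. Qed.

Lemma Box_add n m k j : k \in Box n -> j \in Box m -> k + j \in Box (n + m).
Proof.
move=> /BoxP kn /BoxP jm; apply/BoxP => i; rewrite mxE.
by have := kn i; have := jm i; move: (k ord0 i) (j ord0 i) => a b; lia.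
Qed.

Lemma Box_sub n m k j : k \in Box n -> j \in Box m -> k - j \in Box (n + m).
Proof. by move=> kn jm; apply: Box_add => //; rewrite Box_opp. Qed.

Lemma Box_mono n m k : (n <= m)%N -> k \in Box n -> k \in Box m.
Proof. by move=> nm /BoxP kn; apply/BoxP => i; apply: leq_trans nm. Qed.

Lemma Box_ex k : exists n, k \in Box n.
Proof.
exists (\sum_i `|k ord0 i|)%N; apply/BoxP => i.
by rewrite (bigD1 i) //= leq_addr.
Qed.

End lattice.

Section fsum.
Local Open Scope fset_scope.
Local Open Scope ring_scope.
Variables (R : numDomainType) (I : choiceType).
Implicit Types (A B : {fset I}) (f : I -> R).

Lemma fsum_le_sub A B f : A `<=` B -> (forall i, 0 <= f i) ->
  \sum_(i <- A) f i <= \sum_(i <- B) f i.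
Proof.
move=> AB f0; rewrite [leRHS](big_fsetID _ (mem A)) /=.
have -> : [fset x in B | x \in mem A] = A.
  apply/fsetP => x; rewrite !inE /=; apply/andP/idP => [[]//|xA].
  by split => //; exact: (fsubsetP AB).
by rewrite lerDl sumr_ge0.
Qed.

Lemma fsum_disjU (W : nmodType) A B (f : I -> W) : [disjoint A & B] ->
  \sum_(i <- A `|` B) f i = \sum_(i <- A) f i + \sum_(i <- B) f i.
Proof.
move=> AB; rewrite (big_fsetID _ (mem A)) /=; congr (_ + _); apply: eq_fbigl => x.
  by rewrite !inE /=; case: (x \in A) => //=; rewrite andbF.
rewrite !inE /=; have [xA|xA] /= := boolP (x \in A); last by rewrite andbT.
by rewrite (negbTE (fdisjointP AB _ xA)).
Qed.

Lemma fsum_shift (V : zmodType) (W : nmodType) (A : {fset V}) (f : V -> W) j :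
  \sum_(i <- [fset i + j | i in A]) f i = \sum_(i <- A) f (i + j).
Proof. by rewrite big_imfset //= => x y _ _ /addIr. Qed.

Lemma fsum_const A (c : R) : \sum_(i <- A) c = c * #|` A|%:R.
Proof. by rewrite big_const_seq count_predT iter_addr_0 mulr_natr cardfE. Qed.

End fsum.

Section vitali.
Local Open Scope fset_scope.
Local Open Scope ring_scope.
Variables (d : nat) (R : realFieldType).
Local Notation Zd := 'rV[int]_d.

(* Greedy selection: keep the largest window, and discard every point whose window meets it. *)
Lemma vitali_count (g : Zd -> R) (t : R) (E U : {fset Zd}) (rho : Zd -> nat) :
  (forall k, 0 <= g k) -> 0 <= t ->
  (forall k, k \in E -> 0 < rho k)%N ->
  (forall k, k \in E -> t * (rho k ^ d)%:R <= \sum_(j <- Box d (rho k)) g (j + k)) ->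
  (forall k j, k \in E -> j \in Box d (rho k) -> j + k \in U) ->
  t * #|` E|%:R <= 5%:R ^+ d * \sum_(j <- U) g j.
Proof.
move=> g0 t0; have [n] := ubnP #|` E|; elim: n E U => // n IH E U En rho0 avg sub.
have [->|[k0 k0E]] := fset_0Vmem E.
  by rewrite cardfs0 mulr0 mulr_ge0 ?exprn_ge0 ?sumr_ge0.
have [k [kE kmax]] : exists k, k \in E /\ forall k', k' \in E -> (rho k' <= rho k)%N.
  pose x : E := [arg max_(x > [` k0E] | true) rho (fsval x)].
  exists (fsval x); split; first exact: fsvalP.
  move=> k' k'E; rewrite /x; case: arg_maxnP => //= i _ /(_ [` k'E]); exact.
set B := [fset j + k | j in Box d (rho k)].
pose near x := x - k \in Box d (rho k).*2.
set E' := [fset x in E | ~~ near x].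
have E'E : E' `<=` E by apply/fsubsetP => x; rewrite !inE => /andP[].
have kE' : k \notin E'.
  by rewrite !inE /near subrr kE /= negbK; apply/BoxP => i; rewrite mxE.
have cE' : (#|` E'| < #|` E|)%N.
  by apply: fproper_ltn_card; rewrite fproperE E'E /=; apply/fsubsetPn; exists k.
(* Windows of the remaining points miss [B]: since [rho k] is maximal, an intersection would put the
   point within [2 * rho k] of [k]. The induction can therefore use the sum over [U] without [B]. *)
have le' : t * #|` E'|%:R <= 5%:R ^+ d * \sum_(j <- U `\` B) g j.
  apply: IH => [|x /(fsubsetP E'E)|x /(fsubsetP E'E)|x j xE' jx].
- exact: leq_trans cE' En.
- exact: rho0.
- exact: avg.
- have xE := fsubsetP E'E _ xE'.
  rewrite !inE sub // andbT; apply/negP => /imfsetP [j' /= j'k jx'].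
  move: xE'; rewrite !inE xE /= => /negP; apply; rewrite /near.
  have -> : x - k = j' - j by apply/eqP; rewrite subr_eq addrAC eq_sym subr_eq -jx' addrC.
  by rewrite -addnn; apply: Box_sub => //; apply: Box_mono jx; exact: kmax.
have BU : B `<=` U by apply/fsubsetP => x /imfsetP [j /= jk ->]; exact: sub.
have -> : \sum_(j <- U) g j = \sum_(j <- U `\` B) g j + \sum_(j <- B) g j.
  rewrite (big_fsetID _ (mem B)) /= addrC; congr (_ + _); apply: eq_fbigl => x; rewrite !inE.
    by rewrite andbC.
  by apply/andP/idP => [[]//|xB]; split => //; exact: (fsubsetP BU).
rewrite mulrDr; apply: le_trans (lerD le' (lexx _)).
(* The discarded points lie in a cube of side [4 * rho k + 1], which is at most [5 * rho k] because
   [rho k] is positive; this is the 5 of the statement. *)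
have cE : (#|` E| <= #|` E'| + (5 * rho k) ^ d)%N.
  rewrite -(cardfsID [fset x in E | near x] E) addnC leq_add //.
    by apply/fsubset_leq_card/fsubsetP => x; rewrite !inE; case: (x \in E); rewrite ?andbT ?andbF.
  pose B2 := [fset j + k | j in Box d (rho k).*2].
  have : (#|` B2| = (4 * rho k).+1 ^ d)%N.
    rewrite card_imfset /=; last exact: addIr.
    by rewrite card_Box; congr (_ ^ _)%N; lia.
  move=> cB2; apply: leq_trans (_ : #|` B2| <= _)%N; last first.
    by rewrite cB2; have := rho0 _ kE; move: (rho k) => r r0; case: (d) => [|d'] //; rewrite leq_exp2r //; lia.
  apply/fsubset_leq_card/fsubsetP => x; rewrite !inE => /andP[_ /andP[_ nx]].
  by apply/imfsetP; exists (x - k); rewrite ?subrK.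
apply: le_trans (_ : t * #|` E'|%:R + t * ((5 * rho k) ^ d)%:R <= _).
  by rewrite -mulrDr ler_wpM2l // -natrD ler_nat.
rewrite lerD2l expnMn natrM natrX mulrCA ler_wpM2l ?exprn_ge0 //.
by rewrite fsum_shift; apply: avg.
Qed.

End vitali.

(** * Lattice points in balls and their boundaries *)

Section folner.
Local Open Scope fset_scope.
Local Open Scope ring_scope.
Variable d : nat.
Local Notation Zd := 'rV[int]_d.
Implicit Types (k j : Zd) (n m : nat).

Definition sqZ k : int := \sum_i k ord0 i ^+ 2.

Definition ballZ n : {fset Zd} := [fset k in Box d n | sqZ k < n%:Z ^+ 2].

Lemma mem_ballZ n k : (k \in ballZ n) = (sqZ k < n%:Z ^+ 2).
Proof.
rewrite !inE /=; apply/andP/idP => [[]//|kn]; split => //; apply/BoxP => i.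
have : k ord0 i ^+ 2 <= sqZ k.
  by rewrite /sqZ (bigD1 i) //= lerDl sumr_ge0 // => j _; exact: sqr_ge0.
by move: (k ord0 i) (sqZ k) kn => a b; nia.
Qed.

Lemma ballZ_Box n : ballZ n `<=` Box d n.
Proof. by apply/fsubsetP => x; rewrite !inE => /andP[]. Qed.

(* The lattice points of a ball on a line are consecutive; hence the translates of
   [ballZ n `\` (ballZ n + e)] along [e] are disjoint, which bounds its size. *)
Lemma ballZ_convex k e s : sqZ k < s -> forall t : nat, sqZ (k + e *+ t.+1) < s ->
  sqZ (k + e *+ t) < s.
Proof.
(* Convexity of [sqZ] along the line, [t] being a convex combination of [0] and [t + 1], cleared of
   denominators. *)
move=> ks t kt; suff : t.+1%:Z * sqZ (k + e *+ t) <= t%:Z * sqZ (k + e *+ t.+1) + sqZ k by nia.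
rewrite /sqZ !mulr_sumr -big_split /=; apply: ler_sum => i _.
have cE m : (k + e *+ m) ord0 i = k ord0 i + e ord0 i * m%:Z.
  rewrite mxE; congr (_ + _); elim: m => [|m IH]; first by rewrite mulr0n mulr0 mxE.
  by rewrite mulrS mxE IH; lia.
rewrite !cE; move: (k ord0 i) (e ord0 i) => a b.
rewrite -subr_ge0 (_ : _ - _ = b ^+ 2 * (t%:Z * t.+1%:Z)).
  by apply: mulr_ge0; [exact: sqr_ge0 | lia].
have -> : t.+1%:Z = t%:Z + 1 by lia.
by ring.
Qed.

(** The points at which lines of direction [e] enter the ball. *)
Definition front n e : {fset Zd} := [fset k in ballZ n | k - e \notin ballZ n].

Lemma mem_front n e k : (k \in front n e) = (k \in ballZ n) && (k - e \notin ballZ n).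
Proof.
apply/imfsetP/andP => [[x /= xB ->]|kB]; first by apply/andP.
by exists k => //; apply/andP.
Qed.

Lemma front_card n e c : e \in Box d c -> (n * #|` front n e| <= (n * c.+1).*2.+1 ^ d)%N.
Proof.
move=> ec.
have [->|e0] := eqVneq e 0.
  rewrite (_ : front n 0 = fset0) ?cardfs0 ?muln0 //.
  by apply/fsetP => x; rewrite mem_front subr0 andbN inE.
(* The [n] translates by [0, ..., n - 1] times [e] are disjoint and lie in [Box d n] enlarged by
   [n * c], whence the gain of a factor [n]. *)
pose h (p : 'I_n * front n e) : Zd := fsval p.2 + e *+ p.1.
have inj : injective h.
  have key (t : nat) k k' : k \in front n e -> k' \in front n e -> k' = k + e *+ t.+1 -> False.
    rewrite 2!mem_front => /andP[kF _] /andP[k'F /negP kn] kk; apply: kn; move: kF k'F.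
    rewrite 3!mem_ballZ => kF k'F; rewrite kk mulrSr addrA addrK; apply: ballZ_convex => //.
    by rewrite -kk.
  move=> [t [k kF]] [t' [k' k'F]]; rewrite /h /= => eqh.
  have [tt|tt|tt] := ltngtP t t'.
  - case: (key (t' - t).-1 _ _ k'F kF).
    have -> : (t' - t).-1.+1 = (t' - t)%N by lia.
    rewrite mulrnBr; last exact: ltnW.
    by rewrite addrA -eqh addrK.
  - case: (key (t - t').-1 _ _ kF k'F).
    have -> : (t - t').-1.+1 = (t - t')%N by lia.
    rewrite mulrnBr; last exact: ltnW.
    by rewrite addrA eqh addrK.
  - have tE : t = t' by exact: val_inj.
    move: eqh; rewrite tE => /addIr kk; congr (_, _).
    by apply/val_inj.
have <- : #|{: 'I_n * front n e}| = (n * #|` front n e|)%N by rewrite card_prod card_ord cardfE.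
rewrite -card_Box [in leqRHS]cardfE.
suff hb x : h x \in Box d (n * c.+1).
  by apply: (@leq_card _ _ (fun x => [` hb x])) => x y /(congr1 (@fsval _ _)) /inj.
case: x => [t [k kF]]; rewrite /h /= mulnS; apply: Box_add.
  by move: kF; rewrite mem_front => /andP[/(fsubsetP (ballZ_Box n))].
apply/BoxP => i; have := (BoxP _ _ ec) i; have := ltn_ord t.
have -> : (e *+ t) ord0 i = e ord0 i * t%:Z.
  move: (nat_of_ord t) => {}t; elim: t => [|m IH]; first by rewrite mulr0n mulr0 mxE.
  by rewrite mulrS mxE IH; move: (e ord0 i) => a; lia.
by move: (nat_of_ord t) (e ord0 i) => {}t a tn ac; rewrite abszM mulnC leq_mul //=; exact: ltnW.
Qed.

(** The discrete boundary layer of width [c], cut out of a box so as to be a finite set. *)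
Definition bdry c n : {fset Zd} :=
  [fset k in Box d (n + c) | [exists j : Box d c, k + fsval j \in ballZ n] &&
                             [exists j : Box d c, k + fsval j \notin ballZ n]].

Lemma bdryP c n k : reflect
  ((exists2 j, j \in Box d c & k + j \in ballZ n) /\
   (exists2 j, j \in Box d c & k + j \notin ballZ n)) (k \in bdry c n).
Proof.
rewrite (_ : (k \in bdry c n) = [&& k \in Box d (n + c), [exists j : Box d c, k + fsval j \in ballZ n] & [exists j : Box d c, k + fsval j \notin ballZ n]]); last first.
  apply/imfsetP/and3P => [[x /= /and3P xB ->]|kB] //.
  by exists k => //; apply/and3P.
apply: (iffP and3P) => [[_ /existsP[[j jc] /= jB] /existsP[[j' jc'] /= jB']]|].
  by split; [exists j | exists j'].
move=> [[j jc jB] [j' jc' jB']]; split; last 2 first.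
- by apply/existsP; exists [` jc].
- by apply/existsP; exists [` jc'].
rewrite -(addrK j k); apply: Box_sub jc.
exact: (fsubsetP (ballZ_Box n)).
Qed.

Lemma bdry_Box c n : bdry c n `<=` Box d (n + c).
Proof.
apply/fsubsetP => k /bdryP [[j jc jB] _]; rewrite -(addrK j k); apply: Box_sub jc.
exact: (fsubsetP (ballZ_Box n)).
Qed.

(** If [k + j] is in the ball and [k + j'] is not, then [k + j] belongs to the front in direction
    [j - j']. So the layer is covered by shifted fronts, one for each pair of offsets. As [j - j']
    has coordinates at most [2 * c], each front contributes at most [(4 * c + 3) ^ d] times
    [n ^ d]. *)
Lemma bdry_card c : exists C : nat, forall n, (n * #|` bdry c n| <= C * n ^ d)%N.
Proof.
exists (#|` (Box d c `*` Box d c)%fset| * (4 * c + 3) ^ d)%N => n.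
pose S : {fset Zd} := \bigcup_(p <- Box d c `*` Box d c) [fset x - p.1 | x in front n (p.1 - p.2)].
have sub : bdry c n `<=` S.
  apply/fsubsetP => k /bdryP [[j jc jB] [j' jc' jB']].
  apply/bigfcupP; exists (j, j') => /=; first by rewrite in_fsetM jc jc'.
  apply/imfsetP; exists (k + j); last by rewrite addrK.
  by rewrite mem_front jB opprB addrA addrAC addrK.
have cS : (#|` S| <= \sum_(p <- Box d c `*` Box d c) #|` front n (p.1 - p.2)|)%N.
  rewrite /S; elim/big_rec2 : _ => [|p m A _ Am]; first by rewrite cardfs0.
  rewrite cardfsU; apply: leq_trans (leq_subr _ _) _; apply: leq_add => //.
  by rewrite card_imfset //; exact: addIr.
apply: (leq_trans (n := n * \sum_(p <- Box d c `*` Box d c) #|` front n (p.1 - p.2)|)).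
  by rewrite leq_mul2l; apply/orP; right; apply: leq_trans cS; exact: fsubset_leq_card.
rewrite big_distrr /= .
have [->|n0] := posnP n.
  by rewrite big1 // => i _; rewrite mul0n.
apply: (leq_trans (n := \sum_(p <- Box d c `*` Box d c) ((4 * c + 3) ^ d * n ^ d))).
  rewrite big_seq [leqRHS]big_seq; apply: leq_sum => -[j j'] /=; rewrite in_fsetM => /andP[/= jc jc'].
  apply: leq_trans (front_card n (Box_sub jc jc')) _.
  by rewrite -expnMn; case: (d) => // d'; rewrite leq_exp2r //; nia.
by rewrite big_const_seq count_predT iter_addn_0 [leqLHS]mulnC mulnA.
Qed.

(** The cube of half-side [n %/ d.+1] fits into the Euclidean ball and has at least [(n / d.+1) ^ d]
    points. *)
Lemma ballZ_ge n : (0 < n)%N -> (n ^ d <= d.+1 ^ d * #|` ballZ n|)%N.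
Proof.
move=> n0; have [d0|d0] := posnP d.
  apply: (@leq_trans 1); first by rewrite [X in (_ ^ X)%N]d0.
  rewrite muln_gt0 expn_gt0 /= cardfs_gt0; apply/fset0Pn; exists 0.
  rewrite mem_ballZ /sqZ big1 => [|i _]; last by have := ltn_ord i; rewrite {2}d0.
  by nia.
have sub : Box d (n %/ d.+1) `<=` ballZ n.
  apply/fsubsetP => k /BoxP kn; rewrite mem_ballZ.
  apply: (@le_lt_trans _ _ (\sum_(i < d) (n %/ d.+1)%N%:Z ^+ 2)).
    by apply: ler_sum => i _; move: (kn i); move: (k ord0 i) (n %/ d.+1)%N => a b; nia.
  rewrite sumr_const card_ord.
  have : ((n %/ d.+1) * d.+1 <= n)%N by exact: leq_trunc_div.
  move: (n %/ d.+1)%N => m md.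
  rewrite -mulr_natr natz; move: d0 md => {kn k}; move: (d) => e e0 h.
  suff : (m * m * e < n * n)%N by nia.
  have [->|m0] := posnP m; first by rewrite !mul0n muln_gt0 n0.
  apply: (leq_trans (n := m * e.+1 * (m * e.+1))%N); last exact: leq_mul.
  by nia.
apply: leq_trans (_ : d.+1 ^ d * #|` Box d (n %/ d.+1)| <= _)%N; last first.
  by rewrite leq_mul2l fsubset_leq_card ?orbT.
rewrite card_Box -expnMn leq_exp2r //.
have := ltn_ceil n (ltn0Sn d); move: (n %/ d.+1)%N => m; nia.
Qed.

End folner.

(** * The maximal inequality for lattice actions *)

Section action.
Context (R : realType) dT (T : measurableType dT) (Q : probability T R) (d : nat).
Variable tau : 'rV[int]_d -> T -> T.
Hypothesis tauD : forall a b x, tau (a + b) x = tau a (tau b x).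
Hypothesis mtau : forall a, measurable_fun setT (tau a).
Hypothesis ptau : forall a B, measurable B -> Q (tau a @^-1` B) = Q B.
Implicit Types (f g : T -> R).

Lemma meas_tau f a : measurable_fun setT f -> measurable_fun setT (fun x => f (tau a x)).
Proof. by move=> mf; apply: measurableT_comp. Qed.

Lemma integral_tau (f : T -> \bar R) a : measurable_fun setT f -> (forall x, (0 <= f x)%E) ->
  (\int[Q]_x f (tau a x) = \int[Q]_x f x)%E.
Proof.
move=> mf f0; rewrite -[LHS]/(integral Q (tau a @^-1` setT) (f \o tau a)).
rewrite -(ge0_integral_pushforward (mtau a)) //.
by apply: eq_measure_integral => A mA _; exact: ptau.
Qed.

Lemma L1_tau f a : L1 Q f -> L1 Q (fun x => f (tau a x)).
Proof.
move=> Lf; apply/integrableP; split.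
  by apply/measurable_EFinP; apply: meas_tau; exact: L1_meas Lf.
rewrite (integral_tau (f := fun x => `|(f x)%:E|%E)) //; first by case/integrableP : Lf.
by apply: measurableT_comp => //; apply/measurable_EFinP; exact: L1_meas Lf.
Qed.

Lemma Rint_tau f a : L1 Q f -> Rint Q (fun x => f (tau a x)) = Rint Q f.
Proof.
move=> Lf; rewrite /Rint; congr fine.
have Lfa := L1_tau a Lf.
rewrite integralE [RHS]integralE; congr (_ - _)%E.
  have mp := measurable_funepos (proj2 (measurable_EFinP _ _) (L1_meas Lf)).
etransitivity; last exact: (@integral_tau _ a mp (funepos_ge0 _)).
  by apply: eq_integral => x _; rewrite !funeposE.
have mn := measurable_funeneg (proj2 (measurable_EFinP _ _) (L1_meas Lf)).
etransitivity; last exact: (@integral_tau _ a mn (funeneg_ge0 _)).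
by apply: eq_integral => x _; rewrite !funenegE.
Qed.

Lemma meas_fsum (A : {fset 'rV[int]_d}) f : measurable_fun setT f ->
  measurable_fun setT (fun x => \sum_(k <- A) f (tau k x)).
Proof. by move=> mf; apply: measurable_sum => k; exact: meas_tau. Qed.

Lemma Rint_fsum (A : {fset 'rV[int]_d}) f : L1 Q f ->
  Rint Q (fun x => \sum_(k <- A) f (tau k x)) = Rint Q f * #|` A|%:R.
Proof.
move=> Lf; rewrite Rint_sum; last by move=> k; exact: L1_tau.
by rewrite -(fsum_const A (Rint Q f)); apply: eq_bigr => k _; exact: Rint_tau.
Qed.

(** Window sums are compared with [n ^ d], as in [vitali_count], and not with the cardinality
    [n.*2.+1 ^ d]; the difference is a constant factor. *)
Definition bigset (g : T -> R) (t : R) (N : nat) : set T :=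
  [set x | exists n, [/\ (0 < n)%N, (n <= N)%N &
     t * (n ^ d)%:R <= \sum_(j <- Box d n) g (tau j x)]].

Lemma bigset_bigcup g t N : bigset g t N =
  \bigcup_(n in [set n | (0 < n <= N)%N])
     [set x | t * (n ^ d)%:R <= \sum_(j <- Box d n) g (tau j x)].
Proof.
apply/seteqP; split => x /=.
  by move=> [n [n0 nN h]]; exists n => //=; rewrite n0.
by move=> [n /= /andP[n0 nN] h]; exists n.
Qed.

Lemma meas_bigset g t N : measurable_fun setT g -> measurable (bigset g t N).
Proof.
move=> mg; rewrite bigset_bigcup; apply: bigcup_measurable => n _.
rewrite -[X in measurable X]setTI.
by apply: measurable_fun_le => //; exact: meas_fsum.
Qed.

(** Transference: for each [x] the covering lemma bounds the number of [k] in [Box d N] with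
    [tau k x] in the set by a sum of [g] over the part of the orbit indexed by [Box d N.*2].
    Integration removes [tau] on both sides. The ratio of the two boxes is at most [2 ^ d], which
    turns 5 into 10. *)
Lemma maximal_fin g t N : L1 Q g -> (forall x, 0 <= g x) -> 0 < t ->
  t * fine (Q (bigset g t N)) <= 10%:R ^+ d * Rint Q g.
Proof.
move=> Lg g0 t0.
have mS := meas_bigset t N (L1_meas Lg).
pose S := bigset g t N.
have QS : fine (Q S) = Rint Q (\1_S : T -> R).
  by rewrite /Rint integral_indic // setIT.
have LS : L1 Q (\1_S : T -> R).
  apply: (@L1_bdd _ _ _ _ _ 1) => [|x]; first exact: measurable_indic.
  by rewrite indicE; case: (_ \in _); rewrite /= ?normr1 ?normr0.
have pw x : t * \sum_(k <- Box d N) (\1_S (tau k x) : R) <=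
            5%:R ^+ d * \sum_(k <- Box d N.*2) g (tau k x).
  pose E : {fset 'rV[int]_d} := [fset k in Box d N | tau k x \in S]%fset.
  have -> : \sum_(k <- Box d N) (\1_S (tau k x) : R) = #|` E|%:R.
    rewrite (big_fsetID _ (fun k => tau k x \in S)) /= [X in _ + X]big1_fset ?addr0; last first.
      by move=> k; rewrite !inE /= => /andP[_ kS] _; rewrite indicE (negbTE kS).
    rewrite -[RHS]mul1r -fsum_const; apply: eq_fbigr => k; rewrite !inE /= => /andP[_ kS] _.
    by rewrite indicE kS.
  have ex k : exists n, k \in E -> [/\ (0 < n)%N, (n <= N)%N &
     t * (n ^ d)%:R <= \sum_(j <- Box d n) g (tau j (tau k x))].
    have [kE|kE] := boolP (k \in E); last by exists 0%N.
    by move: kE; rewrite !inE => /andP[_ /set_mem [n hn]]; exists n.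
  have /choice [rho rhoP] := ex.
  apply: (@vitali_count d R (fun k => g (tau k x)) t E _ rho) => //.
  - exact: ltW.
  - by move=> k /rhoP [].
  - by move=> k /rhoP [_ _]; under eq_bigr do rewrite -tauD.
  - move=> k j kE; have [_ rN _] := rhoP _ kE; move=> jB; rewrite -addnn; apply: Box_add.
      exact: Box_mono jB.
    by move: kE; rewrite !inE => /andP[].
have LSk k : L1 Q (fun x => \1_S (tau k x) : R) by exact: (@L1_tau (\1_S)).
have L1l : L1 Q (fun x => \sum_(k <- Box d N) (\1_S (tau k x) : R)) by exact: L1_sum.
have L1r : L1 Q (fun x => \sum_(k <- Box d N.*2) g (tau k x)).
  by apply: L1_sum => k; exact: L1_tau.
have H : t * (fine (Q S) * (N.*2.+1 ^ d)%:R) <= 5%:R ^+ d * (Rint Q g * (N.*2.*2.+1 ^ d)%:R).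
  have := le_Rint (L1Z t L1l) (L1Z _ L1r) pw.
  by rewrite !RintZ // (Rint_fsum _ LS) (Rint_fsum _ Lg) -QS !card_Box.
have c0 : 0 < ((N.*2.+1 ^ d)%:R : R) by rewrite ltr0n expn_gt0.
rewrite -(ler_pM2r c0) -mulrA; apply: le_trans H _.
rewrite -!mulrA mulrCA [leRHS]mulrCA ler_wpM2l ?Rint_ge0 //.
rewrite -!natrX -!natrM ler_nat -[(10 ^ d)%N]/((5 * 2) ^ d)%N expnMn -mulnA leq_mul2l.
by rewrite -expnMn; apply/orP; right; case: (d) => // d'; rewrite leq_exp2r //; lia.
Qed.

Definition maxset (g : T -> R) (t : R) : set T :=
  [set x | exists n, (0 < n)%N /\ t * (n ^ d)%:R <= \sum_(j <- Box d n) g (tau j x)].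

Lemma maxset_bigcup g t : maxset g t = \bigcup_N bigset g t N.
Proof.
apply/seteqP; split => x /=; first by move=> [n [n0 h]]; exists n => //; exists n.
by move=> [N _ [n [n0 nN h]]]; exists n.
Qed.

Lemma meas_maxset g t : measurable_fun setT g -> measurable (maxset g t).
Proof.
by move=> mg; rewrite maxset_bigcup; apply: bigcupT_measurable => N; exact: meas_bigset.
Qed.

Lemma maximal_ineq g t : L1 Q g -> (forall x, 0 <= g x) -> 0 < t ->
  (Q (maxset g t) <= (t^-1 * (10%:R ^+ d * Rint Q g))%:E)%E.
Proof.
move=> Lg g0 t0; rewrite maxset_bigcup.
have mb N := meas_bigset t N (L1_meas Lg).
have H : Q (bigset g t N) @[N --> \oo] --> Q (\bigcup_N bigset g t N).
  apply: nondecreasing_cvg_mu => //; first exact: bigcupT_measurable.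
  move=> N N' NN; apply/subsetPset => x [n [n0 nN h]].
  by exists n; split => //; exact: leq_trans NN.
apply: (cvge_to_le H); apply: nearW => N.
have := maximal_fin N Lg g0 t0.
rewrite -ler_pdivlMl // -lee_fin fineK //; exact: fin_num_measure.
Qed.

End action.

(** * From mean to almost sure convergence of ball averages *)

(** The form in which the maximal inequality gives almost sure statements: the bad points have to be
    caught in measurable sets of arbitrarily small probability, and a countable intersection of such
    sets is null. *)
Lemma ae_small (R : realType) dT (T : measurableType dT) (Q : probability T R) (P : T -> Prop) :
  (forall e : R, 0 < e -> exists B, [/\ measurable B, (Q B <= e%:E)%E & forall x, ~ P x -> B x]) ->
  {ae Q, forall x, P x}.
Proof.
move=> H.
have /choice [B hB] n : exists B, [/\ measurable B, (Q B <= (n.+1%:R^-1)%:E)%E & forall x, ~ P x -> B x].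
  by apply: H; rewrite invr_gt0 ltr0n.
exists (\bigcap_n B n); split.
- by apply: bigcapT_measurable => n; case: (hB n).
- apply/eqP; rewrite eq_le measure_ge0 andbT; apply/lee_addgt0Pr => e e0; rewrite add0e.
  have [n _ hn] := near_infty_natSinv_lt (PosNum e0).
  have {}hn := hn n (leqnn n).
  have [mB QB _] := hB n.
  apply: le_trans (le_trans _ QB) _; last by rewrite lee_fin ltW.
  apply: le_measure; rewrite ?inE //; last by move=> x; exact.
  by apply: bigcapT_measurable => k; case: (hB k).
- by move=> x nP n _; have [_ _] := hB n; exact.
Qed.

Section ergodic.
Context (R : realType) dT (T : measurableType dT) (Q : probability T R) (d : nat).
Variable tau : 'rV[int]_d -> T -> T.
Hypothesis tauD : forall a b x, tau (a + b) x = tau a (tau b x).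
Hypothesis mtau : forall a, measurable_fun setT (tau a).
Hypothesis ptau : forall a B, measurable B -> Q (tau a @^-1` B) = Q B.
Implicit Types (f g Y : T -> R).

Lemma tail_L1 Y : L1 Q Y -> forall e, 0 < e -> exists2 L : nat, L1 Q (fun x => Num.max (`|Y x| - L%:R) 0) &
  Rint Q (fun x => Num.max (`|Y x| - L%:R) 0) <= e.
Proof.
move=> LY e e0.
pose h (L : nat) x := Num.max (`|Y x| - L%:R) 0.
have mh L : measurable_fun setT (h L).
  apply: measurable_maxr => //; apply: measurable_funB => //.
  by apply: measurableT_comp => //; exact: L1_meas LY.
have hY L x : `|h L x| <= `|Y x|.
  rewrite /h; have := normr_ge0 (Y x); have : 0 <= L%:R :> R by [].
  move: (`|Y x|) (L%:R) => y l l0 y0; rewrite /Num.max; case: ifPn; first by rewrite normr0.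
  by rewrite -leNgt => yl; rewrite ger0_norm //; lra.
have : Rint Q (h L) @[L --> \oo] --> Rint Q (fun=> 0 : R).
  apply: (Rint_dct (g := fun x => `|Y x|)) => //; first exact: L1_norm.
  move=> x; apply: cvg_near_cst; near=> L.
  by apply/max_idPr; rewrite subr_le0; near: L; exact: nbhs_infty_ger.
rewrite Rint0 => /cvgr_le - /(_ e e0) [L _ hL]; exists L; last exact: (hL L (leqnn L)).
by apply: (le_L1 (mh L) (hY L)); exact: L1_norm.
Unshelve. all: by end_near. Qed.

(* Truncate at level [L]: the part below contributes at most [L * #|D n|], the part
   above is controlled by the maximal inequality. *)
Lemma small_sets Y (D : nat -> {fset 'rV[int]_d}) (K : nat) : L1 Q Y -> (0 < K)%N ->
  (forall n, (0 < n)%N -> D n `<=` Box d (n * K))%fset ->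
  (forall e : R, 0 < e -> \forall n \near \oo, #|` D n|%:R <= e * (n ^ d)%:R) ->
  {ae Q, forall x, forall e, 0 < e ->
     \forall n \near \oo, \sum_(k <- D n) `|Y (tau k x)| <= e * (n ^ d)%:R}.
Proof.
move=> LY K0 DB Do.
suff H : forall j : nat, {ae Q, forall x, \forall n \near \oo, \sum_(k <- D n) `|Y (tau k x)| <= j.+1%:R^-1 * (n ^ d)%:R}.
  have := ae_foralln H; apply: filterS => x Hx e e0.
  have [j _ hj] := near_infty_natSinv_lt (PosNum e0).
  apply: filterS (Hx j) => n /le_trans; apply.
  by rewrite ler_wpM2r //; exact/ltW/(hj _ (leqnn j)).
move=> j; set t : R := j.+1%:R^-1.
have t0 : 0 < t by rewrite invr_gt0.
(* One half of [t] is reserved for the truncated part, and [K ^ d] converts the normalization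
   [n ^ d] into that of the window [n * K] of the maximal set. *)
pose s := t / 2%:R / (K ^ d)%:R.
have Kd : 0 < (K ^ d)%:R :> R by rewrite ltr0n expn_gt0 K0.
have s0 : 0 < s by rewrite !divr_gt0.
apply: ae_small => e e0.
have es0 : 0 < e * s / 10%:R ^+ d by apply: divr_gt0; [exact: mulr_gt0 | exact: exprn_gt0].
have [L Lh Eh] := tail_L1 LY es0.
set h := fun x => _ in Lh Eh.
have h0 x : 0 <= h x by rewrite /h le_max lexx orbT.
exists (maxset tau h s); split.
- by apply: meas_maxset => //; exact: L1_meas Lh.
- apply: le_trans (maximal_ineq tauD mtau ptau Lh h0 s0) _; rewrite lee_fin.
  rewrite ler_pdivrMl // mulrC -ler_pdivlMr ?exprn_gt0 //.
  by apply: le_trans Eh _; rewrite (mulrC e).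
move=> x; apply: contra_notP => nB.
have LD : \forall n \near \oo, L%:R * #|` D n|%:R <= t / 2%:R * (n ^ d)%:R.
  have e1 : 0 < t / 2%:R / L.+1%:R by rewrite !divr_gt0.
  apply: filterS (Do _ e1) => n hn.
  apply: le_trans (_ : L.+1%:R * #|` D n|%:R <= _).
    by rewrite ler_wpM2r // ler_nat.
  by rewrite mulrC -ler_pdivlMr // mulrAC.
near=> n.
have n0 : (0 < n)%N by near: n; exists 1%N.
apply: le_trans (_ : \sum_(k <- D n) (h (tau k x) + L%:R) <= _).
  apply: ler_sum => k _; rewrite -lerBlDr /h le_max lexx //.
rewrite big_split /= fsum_const.
rewrite (_ : t * _ = t / 2%:R * (n ^ d)%:R + t / 2%:R * (n ^ d)%:R); last by lra.
apply: lerD; last by near: n.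
apply: (le_trans (fsum_le_sub (DB n n0) (fun k => h0 (tau k x)))).
rewrite leNgt; apply/negP => hlt; apply: nB; exists (n * K)%N; split; first by rewrite muln_gt0 n0.
apply: ltW; apply: le_lt_trans hlt.
by rewrite expnMn natrM [X in _ * X]mulrC mulrA /s divfK // gt_eqF.
Unshelve. all: by end_near. Qed.

Lemma bdry_small c (e : R) : 0 < e -> \forall n \near \oo, #|` bdry d c n|%:R <= e * (n ^ d)%:R.
Proof.
move=> e0; have [C hC] := bdry_card d c.
near=> n; have n0 : (0 < n)%N by near: n; exists 1%N.
rewrite -(ler_pM2l (_ : 0 < n%:R :> R)) ?ltr0n //.
apply: le_trans (_ : C%:R * (n ^ d)%:R <= _).
  by rewrite -!natrM ler_nat; exact: hC.
rewrite mulrA ler_wpM2r //.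
by rewrite -ler_pdivrMr //; near: n; exact: nbhs_infty_ger.
Unshelve. all: by end_near. Qed.

Lemma bdry_sub_Box c n : (0 < n)%N -> (bdry d c n `<=` Box d (n * c.+1))%fset.
Proof.
move=> n0; apply/fsubsetP => k /(fsubsetP (@bdry_Box d c n)); apply: Box_mono.
by rewrite mulnS leq_add2l leq_pmull.
Qed.

Lemma bdry_sums Y c : L1 Q Y -> {ae Q, forall x, forall e, 0 < e ->
     \forall n \near \oo, \sum_(k <- bdry d c n) `|Y (tau k x)| <= e * (n ^ d)%:R}.
Proof.
move=> LY; apply: (small_sets LY (ltn0Sn c)); first exact: bdry_sub_Box.
exact: bdry_small.
Qed.

Definition avg (n : nat) Y x : R := #|` ballZ d n|%:R^-1 * \sum_(k <- ballZ d n) Y (tau k x).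

Lemma card_ballZ_gt0 n : (0 < n)%N -> 0 < #|` ballZ d n|%:R :> R.
Proof.
move=> n0; have := @ballZ_ge d n n0; rewrite ltr0n; case: #|` _| => //.
by rewrite muln0 leqn0 expn_eq0 eqn0Ngt n0.
Qed.

Lemma card_ballZ_ge n : (0 < n)%N -> (n ^ d)%:R <= (d.+1 ^ d)%:R * #|` ballZ d n|%:R :> R.
Proof. by move=> n0; rewrite -natrM ler_nat ballZ_ge. Qed.

(** A point of the symmetric difference of the ball and its translate by [j] sees a point inside and
    a point outside at the offsets [0] and [- j]. *)
Lemma sum_shift_bdry (y : 'rV[int]_d -> R) m n j : j \in Box d m ->
  `|\sum_(k <- ballZ d n) y (j + k) - \sum_(k <- ballZ d n) y k| <= \sum_(k <- bdry d m n) `|y k|.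
Proof.
move=> jm.
under eq_bigr do rewrite addrC.
rewrite -fsum_shift.
set F := ballZ d n; set G := [fset (k + j)%R | k in F]%fset.
have z0 : 0 \in Box d m by apply/BoxP => i; rewrite mxE.
rewrite (big_fsetID _ (mem F) G) (big_fsetID _ (mem G) F) /=.
have -> : [fset x in G | x \in F]%fset = [fset x in F | x \in G]%fset.
  by apply/fsetP => x; rewrite !inE /= andbC.
rewrite opprD addrACA subrr add0r.
apply: le_trans (ler_normB _ _) _.
apply: le_trans (lerD (ler_norm_sum _ _ _) (ler_norm_sum _ _ _)) _.
set U := [fset x in G | x \notin F]%fset; set V := [fset x in F | x \notin G]%fset.
have UV : [disjoint U & V]%fset.
  by apply/fdisjointP => x; rewrite !inE /= => /andP[_ xF]; rewrite (negbTE xF).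
rewrite -fsum_disjU //.
apply: fsum_le_sub => //.
apply/fsubsetP => x; rewrite in_fsetU => /orP[] /imfsetP [/= k /andP[]].
  move=> /imfsetP [/= k' k'F ->] kF ->; apply/bdryP; split.
    by exists (- j); rewrite ?Box_opp ?addrK.
  by exists 0; rewrite ?addr0.
move=> kF kG ->; apply/bdryP; split; first by exists 0; rewrite ?addr0.
exists (- j); rewrite ?Box_opp //; apply: contra kG => kj.
by apply/imfsetP; exists (k - j) => //; rewrite subrK.
Qed.

(** Averaging over the small ball and then over the large one amounts to shifting the large ball by
    the points of the small one, which affects only its boundary layer. *)
Lemma avg_avg_bdry Y m n x : (0 < m)%N -> (0 < n)%N ->
  `|avg n (avg m Y) x - avg n Y x| <=
  #|` ballZ d n|%:R^-1 * \sum_(k <- bdry d m n) `|Y (tau k x)|.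
Proof.
move=> m0 n0; pose y k := Y (tau k x).
have cm := card_ballZ_gt0 m0; have cn := card_ballZ_gt0 n0.
have cm1 : 0 <= #|` ballZ d m|%:R^-1 :> R by rewrite invr_ge0 ltW.
have cn1 : 0 <= #|` ballZ d n|%:R^-1 :> R by rewrite invr_ge0 ltW.
rewrite /avg -mulrBr normrM (ger0_norm cn1) ler_wpM2l //.
rewrite -mulr_sumr exchange_big /=.
have -> : \sum_(k <- ballZ d n) Y (tau k x) =
  #|` ballZ d m|%:R^-1 * \sum_(j <- ballZ d m) \sum_(k <- ballZ d n) y k.
  by rewrite fsum_const mulrCA mulVf ?mulr1 // gt_eqF.
rewrite -mulrBr normrM (ger0_norm cm1) ler_pdivrMl // mulrC -fsum_const.
rewrite -sumrB; apply: le_trans (ler_norm_sum _ _ _) _.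
rewrite big_seq [leRHS]big_seq; apply: ler_sum => j jm.
rewrite (eq_bigr (fun k => y (j + k))); first exact: sum_shift_bdry (fsubsetP (@ballZ_Box d m) _ jm).
by move=> k _; rewrite /y tauD.
Qed.

Lemma L1_avg n Y : L1 Q Y -> L1 Q (avg n Y).
Proof. by move=> LY; apply: L1Z; apply: L1_sum => k; exact: (L1_tau mtau ptau). Qed.

(** Fix [m] with [avg m Y] close to [c] in mean. Then [avg n Y - c] is the average of [avg m Y - c],
    which the maximal inequality keeps small for all [n] at once outside a small set, minus a
    boundary error that vanishes as [n] grows. *)
Theorem pointwise_of_mean Y (c : R) : L1 Q Y ->
  (forall e, 0 < e -> exists2 m, (0 < m)%N & Rint Q (fun x => `|avg m Y x - c|) <= e) ->
  {ae Q, forall x, avg n Y x @[n --> \oo] --> c}.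
Proof.
move=> LY mean.
have H1 := ae_foralln (fun m => bdry_sums m LY).
suff H2 : forall j : nat, {ae Q, forall x, (forall m e, 0 < e ->
     \forall n \near \oo, \sum_(k <- bdry d m n) `|Y (tau k x)| <= e * (n ^ d)%:R) ->
     \forall n \near \oo, `|avg n Y x - c| <= j.+1%:R^-1}.
  have := ae_foralln H2; move: H1; apply: filterS2 => x Hx /(_ _ Hx) h.
  apply/cvgrPdistC_le => e e0.
  have [j _ hj] := near_infty_natSinv_lt (PosNum e0).
  by apply: filterS (h j) => n /le_trans; apply; exact/ltW/(hj _ (leqnn j)).
move=> j; set t : R := j.+1%:R^-1.
have t0 : 0 < t by rewrite invr_gt0.
have D0 : 0 < (d.+1 ^ d)%:R :> R by rewrite ltr0n expn_gt0.
(* The factor [d.+1 ^ d] is the price for replacing the cardinality of the ball by [n ^ d]. *)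
pose s := t / 2%:R / (d.+1 ^ d)%:R.
have s0 : 0 < s by rewrite !divr_gt0.
apply: ae_small => e e0.
have es0 : 0 < e * s / 10%:R ^+ d by apply: divr_gt0; [exact: mulr_gt0 | exact: exprn_gt0].
have [m m0 Em] := mean _ es0.
pose h x : R := `|avg m Y x - c|; rewrite -/h in Em.
have Lh : L1 Q h by apply: L1_norm; apply: L1B; [exact: L1_avg|exact: L1_cst].
have h0 x : 0 <= h x by exact: normr_ge0.
exists (maxset tau h s); split.
- by apply: meas_maxset => //; exact: L1_meas Lh.
- apply: le_trans (maximal_ineq tauD mtau ptau Lh h0 s0) _; rewrite lee_fin.
  rewrite ler_pdivrMl // mulrC -ler_pdivlMr ?exprn_gt0 //.
  by apply: le_trans Em _; rewrite (mulrC e).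
move=> x; apply: contra_notP => nB bd.
near=> n.
have n0 : (0 < n)%N by near: n; exists 1%N.
have cn := card_ballZ_gt0 n0; have nd := card_ballZ_ge n0.
have P1 : `|avg n (avg m Y) x - avg n Y x| <= t / 2%:R.
  apply: le_trans (avg_avg_bdry _ _ m0 n0) _; rewrite ler_pdivrMl //.
  apply: (@le_trans _ _ (s * (n ^ d)%:R)); first by near: n; exact: bd.
  apply: le_trans (ler_wpM2l (ltW s0) nd) _.
  by rewrite mulrA /s divfK ?gt_eqF // mulrC.
have P2 : `|avg n (avg m Y) x - c| <= t / 2%:R.
  have -> : avg n (avg m Y) x - c = #|` ballZ d n|%:R^-1 * \sum_(k <- ballZ d n) (avg m Y (tau k x) - c).
    by rewrite sumrB fsum_const mulrBr; congr (_ - _); rewrite mulrCA mulVf ?mulr1 // gt_eqF.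
  rewrite normrM [X in X * _]ger0_norm ?invr_ge0 // ler_pdivrMl //.
  apply: le_trans (ler_norm_sum _ _ _) _.
  apply: (le_trans (fsum_le_sub (@ballZ_Box d n) (fun k => h0 (tau k x)))).
  apply: (@le_trans _ _ (s * (n ^ d)%:R)).
    rewrite leNgt; apply/negP => hlt; apply: nB; exists n; split => //; exact: ltW.
  apply: le_trans (ler_wpM2l (ltW s0) nd) _.
  by rewrite mulrA /s divfK ?gt_eqF // mulrC.
have -> : avg n Y x - c = (avg n (avg m Y) x - c) - (avg n (avg m Y) x - avg n Y x) by lra.
by apply: le_trans (ler_normB _ _) _; lra.
Unshelve. all: by end_near. Qed.

End ergodic.

(** * Fatou's lemma and almost sure convergence along subsequences *)

Section L1_convergence.
Context (R : realType) dT (T : measurableType dT) (Q : probability T R).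
Implicit Types (f : nat -> T -> R).

Lemma fatou_Rint f (g : T -> R) (C : R) : (forall n, L1 Q (f n)) -> (forall n x, 0 <= f n x) ->
  measurable_fun setT g -> (forall x, 0 <= g x) ->
  {ae Q, forall x, f n x @[n --> \oo] --> g x} ->
  (\forall n \near \oo, Rint Q (f n) <= C) -> Rint Q g <= C.
Proof.
move=> Lf f0 mg g0 fg fC.
have [N [mN QN Nsub]] := fg.
have mfn n : measurable_fun setT (EFin \o f n) by apply/measurable_EFinP; exact: L1_meas (Lf n).
(* All functions are set to zero on the null set, so that convergence holds everywhere. *)
pose h n x : \bar R := (f n x * \1_(~` N) x)%:E.
pose k x : \bar R := (g x * \1_(~` N) x)%:E.
have mh n : measurable_fun setT (h n).
  apply/measurable_EFinP/measurable_funM; first exact: L1_meas (Lf n).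
  exact/measurable_indic/measurableC.
have mk : measurable_fun setT k.
  by apply/measurable_EFinP/measurable_funM => //; exact/measurable_indic/measurableC.
have i0 x : 0 <= \1_(~` N) x :> R by rewrite indicE.
have iN x : N x -> \1_(~` N) x = 0 :> R by move=> xN; rewrite indicE memNset.
have iNC x : ~ N x -> \1_(~` N) x = 1 :> R by move=> xN; rewrite indicE mem_set.
have h0 n x : (0 <= h n x)%E by rewrite lee_fin mulr_ge0.
have k0 x : (0 <= k x)%E by rewrite lee_fin mulr_ge0.
have hk x : h n x @[n --> \oo] --> k x.
  apply/cvg_EFin; first by apply: nearW.
  rewrite /h /k; have [xN|xN] := pselect (N x).
    by rewrite (iN _ xN) mulr0; apply: cvg_near_cst; apply: nearW => n; rewrite /= mulr0.
  have fgx : f n x @[n --> \oo] --> g x by apply: contrapT => nf; apply: xN; exact: Nsub.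
  exact: cvgMl.
have Ig : (\int[Q]_x (g x)%:E = \int[Q]_x k x)%E.
  apply: ge0_ae_eq_integral => //; first exact/measurable_EFinP.
  - by move=> x _; rewrite lee_fin.
  - exists N; split => // x /= nx; apply: contrapT => xN; apply: nx => _.
    by rewrite /k (iNC _ xN) mulr1.
have hf n : (\int[Q]_x h n x <= (Rint Q (f n))%:E)%E.
  rewrite EFin_Rint //; apply: ge0_le_integral => //; first exact: mfn.
  + move=> x _; by rewrite lee_fin ler_piMr //; have [xN|xN] := pselect (N x); rewrite ?(iN _ xN) ?(iNC _ xN).
have : (\int[Q]_x (g x)%:E <= C%:E)%E.
  rewrite Ig.
  have -> : (\int[Q]_x k x = \int[Q]_x limn_einf (h^~ x))%E.
    by apply: eq_integral => x _; rewrite (cvg_limn_einf_sup (hk x)).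
  apply: le_trans (fatou Q measurableT mh (fun n x _ => h0 n x)) _.
  rewrite limn_einf_lim; apply: lime_le; first exact: is_cvg_einfs.
  near=> n; apply: le_trans (ereal_inf_lbound _) _; last first.
    apply: le_trans (hf n) _; rewrite lee_fin; near: n; exact: fC.
  by exists n => /=.
have : (0 <= \int[Q]_x (g x)%:E)%E by apply: integral_ge0 => x _; rewrite lee_fin.
by rewrite /Rint; case: (integral _ _ _) => [r||] //=; rewrite ?lee_fin.
Unshelve. all: by end_near. Qed.

(* A sequence whose increments have summable L1 norms converges almost surely. *)
Lemma fast_cvg f (C : R) : (forall n, L1 Q (f n)) -> 0 < C ->
  (forall n, \sum_(i < n) Rint Q (fun x => `|f i.+1 x - f i x|) <= C) ->
  {ae Q, forall x, cvg (f n x @[n --> \oo])}.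
Proof.
move=> Lf C0 fC.
pose S n x := \sum_(i < n) `|f i.+1 x - f i x|.
have Ld i : L1 Q (fun x => `|f i.+1 x - f i x|) by apply: L1_norm; exact: L1B.
have LS n : L1 Q (S n) by apply: L1_sum => i; exact: Ld.
have S0 n x : 0 <= S n x by apply: sumr_ge0.
have ndS x : {homo (S^~ x) : n m / (n <= m)%N >-> n <= m}.
  by apply/nondecreasing_seqP => n; rewrite /S big_ord_recr /= lerDl.
(* By Markov's inequality the partial sums of the increments exceed [C / e] with probability at most
   [e]. *)
apply: ae_small => e e0; pose t := C / e; have t0 : 0 < t by exact: divr_gt0.
pose B n := [set x | t <= `|S n x|].
have mB n : measurable (B n).
  rewrite -[X in measurable X]setTI; apply: measurable_fun_le => //.
  by apply: measurableT_comp => //; exact: L1_meas (LS n).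
exists (\bigcup_n B n); split.
- exact: bigcupT_measurable.
- have H : (Q \o B) n @[n --> \oo] --> Q (\bigcup_n B n).
    apply: nondecreasing_cvg_mu => //; first exact: bigcupT_measurable.
    by move=> n m nm; apply/subsetPset => x /= /le_trans; apply; rewrite !ger0_norm //; exact: ndS.
  apply: (cvge_to_le H); apply: nearW => n /=.
  have := markov_Rint (LS n) (ltW t0).
  rewrite -lee_pdivlMl // => /le_trans; apply; rewrite lee_fin.
  rewrite ler_pdivrMl // /t divfK ?gt_eqF //.
  have -> : Rint Q (fun x => `|S n x|) = Rint Q (S n) by apply: eq_Rint => x; rewrite ger0_norm.
  by rewrite Rint_sum.
move=> x; apply: contra_notP => nB.
have cS : cvgn (S^~ x).
  apply: nondecreasing_is_cvgn; first exact: ndS.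
  exists t => _ [n _ <-]; rewrite leNgt; apply/negP => tS; apply: nB; exists n => //.
  by rewrite /B /= ger0_norm // ltW.
have -> : f^~ x = (fun n => f 0%N x + series (telescope (f^~ x)) n).
  by apply/funext => n; rewrite -eq_sum_telescope.
apply: is_cvgD; first exact: is_cvg_cst.
apply: normed_cvg.
rewrite (_ : [normed series (telescope (f^~ x))] = S^~ x) //.
by apply/funext => n; rewrite /S /= /series /= big_mkord.
Qed.

Lemma fast_subseq f : (forall n, L1 Q (f n)) ->
  (forall e, 0 < e -> exists N, forall n m, (N <= n)%N -> (N <= m)%N ->
     Rint Q (fun x => `|f n x - f m x|) <= e) ->
  exists2 phi : nat -> nat, (forall j, (j < phi j)%N) &
    {ae Q, forall x, cvg (f (phi j) x @[j --> \oo])}.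
Proof.
move=> Lf cau.
have /choice [N hN] j : exists N, forall n m, (N <= n)%N -> (N <= m)%N ->
     Rint Q (fun x => `|f n x - f m x|) <= 2%:R^-1 ^+ j by apply: cau; rewrite exprn_gt0 ?invr_gt0.
(* Summing all earlier [N i] makes [phi] monotone and at least [N] at once; the summand [j.+1] gives
   [j < phi j], so that statements about large [n] pass to the subsequence. *)
pose phi j := (j.+1 + \sum_(i < j.+1) N i)%N.
have phiN j : (N j <= phi j)%N by rewrite /phi big_ord_recr /= addnA leq_addl.
have phiS j : (phi j <= phi j.+1)%N.
  by rewrite /phi [in leqRHS]big_ord_recr /= leq_add // leq_addr.
exists phi; first by move=> j; rewrite /phi ltnS leq_addr.
apply: (@fast_cvg (fun j => f (phi j)) 2%:R) => // n.
apply: le_trans (_ : \sum_(i < n) 2%:R^-1 ^+ i <= _).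
  by apply: ler_sum => i _; apply: hN => //; exact: leq_trans (phiS i).
have -> : \sum_(i < n) 2%:R^-1 ^+ i = 2%:R - 2%:R * 2%:R^-1 ^+ n :> R.
  elim: n => [|n IH]; first by rewrite big_ord0 expr0 mulr1 subrr.
  by rewrite big_ord_recr /= IH exprS; lra.
by rewrite gerBl mulr_ge0 // exprn_ge0.
Qed.

End L1_convergence.

(** * The mean ergodic theorem for ball averages *)

Section mean.
Context (R : realType) dT (T : measurableType dT) (Q : probability T R) (d : nat).
Variable tau : 'rV[int]_d -> T -> T.
Hypothesis tauD : forall a b x, tau (a + b) x = tau a (tau b x).
Hypothesis mtau : forall a, measurable_fun setT (tau a).
Hypothesis ptau : forall a B, measurable B -> Q (tau a @^-1` B) = Q B.
Implicit Types (f g Y : T -> R).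
Local Notation avg := (avg tau).

Lemma meas_avg n f : measurable_fun setT f -> measurable_fun setT (avg n f).
Proof.
by move=> mf; apply: measurable_funM => //; apply: measurable_sum => k; exact: (meas_tau mtau).
Qed.

Lemma Rint_avg n f : (0 < n)%N -> L1 Q f -> Rint Q (avg n f) = Rint Q f.
Proof.
move=> n0 Lf; rewrite RintZ; last by apply: L1_sum => k; exact: (L1_tau mtau ptau).
rewrite (Rint_fsum mtau ptau) // mulrCA mulVf ?mulr1 // gt_eqF //.
exact: card_ballZ_gt0.
Qed.

Lemma le_avg n f g x : (forall y, f y <= g y) -> avg n f x <= avg n g x.
Proof. by move=> fg; rewrite ler_wpM2l ?invr_ge0 //; exact: ler_sum. Qed.

Lemma norm_avg n f x : `|avg n f x| <= avg n (fun y => `|f y|) x.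
Proof.
by rewrite normrM ger0_norm ?invr_ge0 // ler_wpM2l ?invr_ge0 //; exact: ler_norm_sum.
Qed.

Lemma avg_cst n (c : R) x : (0 < n)%N -> avg n (fun=> c) x = c.
Proof.
move=> n0; rewrite /avg fsum_const mulrCA mulVf ?mulr1 // gt_eqF //.
exact: card_ballZ_gt0.
Qed.

Lemma avgD n f g x : avg n (fun y => f y + g y) x = avg n f x + avg n g x.
Proof. by rewrite /avg big_split /= mulrDr. Qed.

Lemma avgB n f g x : avg n (fun y => f y - g y) x = avg n f x - avg n g x.
Proof. by rewrite /avg sumrB /= mulrBr. Qed.

Lemma avgZ n f (c : R) x : avg n (fun y => c * f y) x = c * avg n f x.
Proof. by rewrite /avg -mulr_sumr mulrCA. Qed.

Lemma bdd_avg n f c x : (0 < n)%N -> (forall y, `|f y| <= c) -> `|avg n f x| <= c.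
Proof.
move=> n0 fc; apply: le_trans (norm_avg _ _ _) _.
by apply: le_trans (le_avg n x fc) _; rewrite avg_cst.
Qed.

Lemma Rint_norm_avg n f : (0 < n)%N -> L1 Q f ->
  Rint Q (fun x => `|avg n f x|) <= Rint Q (fun x => `|f x|).
Proof.
move=> n0 Lf; rewrite -[leRHS](Rint_avg n0 (L1_norm Lf)).
apply: le_Rint; [apply: L1_norm; exact: L1_avg | exact: L1_avg (L1_norm Lf) | ].
by move=> x; exact: norm_avg.
Qed.

(** The difference of the two sides is the variance of [f] along the ball of the orbit. *)
Lemma avg_sqr n f x : (0 < n)%N -> avg n f x ^+ 2 <= avg n (fun y => f y ^+ 2) x.
Proof.
move=> n0; set a := avg n f x.
have : 0 <= avg n (fun y => (f y - a) ^+ 2) x.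
  by rewrite mulr_ge0 ?invr_ge0 // sumr_ge0 // => k _; exact: sqr_ge0.
have -> : avg n (fun y => (f y - a) ^+ 2) x =
  avg n (fun y => f y ^+ 2) x - 2%:R * a * avg n f x + a ^+ 2.
  rewrite -(avg_cst (a ^+ 2) x n0) -avgZ -avgB -avgD; congr (_ * _).
  by apply: eq_bigr => k _; ring.
by rewrite -/a; nra.
Qed.

Lemma meas_sqr f : measurable_fun setT f -> measurable_fun setT (fun x => f x ^+ 2).
Proof. by move=> mf; exact: measurable_funX. Qed.

Lemma bdd_sqr f c : (forall x, `|f x| <= c) -> forall x, `|f x ^+ 2| <= c ^+ 2.
Proof. by move=> fc x; rewrite normrX lerXn2r ?nnegrE ?(le_trans _ (fc x)). Qed.

Lemma L1_sqr f c : measurable_fun setT f -> (forall x, `|f x| <= c) -> L1 Q (fun x => f x ^+ 2).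
Proof. by move=> mf fc; apply: L1_bdd (bdd_sqr fc); exact: meas_sqr. Qed.

Lemma avg_L2 n f c : (0 < n)%N -> measurable_fun setT f -> (forall x, `|f x| <= c) ->
  Rint Q (fun x => avg n f x ^+ 2) <= Rint Q (fun x => f x ^+ 2).
Proof.
move=> n0 mf fc; rewrite -[leRHS](Rint_avg n0 (L1_sqr mf fc)).
apply: le_Rint => [||x]; last exact: avg_sqr.
  by apply: (@L1_sqr _ c); [exact: meas_avg | move=> x; exact: bdd_avg].
exact: L1_avg (L1_sqr mf fc).
Qed.

Section bounded.
Variables (Y : T -> R) (K : R).
Hypotheses (mY : measurable_fun setT Y) (YK : forall x, `|Y x| <= K).

Let a n := Rint Q (fun x => avg n Y x ^+ 2).

Let K0 : 0 <= K.
Proof.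
have [[x _]|T0] := pselect (exists x : T, True); first exact: le_trans (YK x).
have := @probability_setT _ _ _ Q; rewrite (_ : setT = set0) ?measure0; last first.
  by apply/seteqP; split => // x _; exfalso; apply: T0; exists x.
by move=> /eqP; rewrite eqe eq_sym oner_eq0.
Qed.

Let avgK n x : (0 < n)%N -> `|avg n Y x| <= K.
Proof. by move=> n0; exact: bdd_avg. Qed.

(** For bounded [Y] the boundary error is at most a constant times the proportion of boundary
    points, whatever [x] is. This is the reason for treating bounded functions first. *)
Lemma avg_avg_unif m e : (0 < m)%N -> 0 < e ->
  \forall k \near \oo, forall x, `|avg k (avg m Y) x - avg k Y x| <= e.
Proof.
move=> m0 e0.
have D0 : 0 < (d.+1 ^ d)%:R :> R by rewrite ltr0n expn_gt0.
have K1 : 0 < K + 1 by apply: ltr_wpDl.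
have e1 : 0 < e / (K + 1) / (d.+1 ^ d)%:R by rewrite !divr_gt0.
near=> k.
have k0 : (0 < k)%N by near: k; exists 1%N.
have bk : #|` bdry d m k|%:R <= e / (K + 1) / (d.+1 ^ d)%:R * (k ^ d)%:R by near: k; exact: bdry_small.
move=> x; apply: le_trans (avg_avg_bdry _ _ _ m0 k0) _ => //.
rewrite ler_pdivrMl; last exact: card_ballZ_gt0.
apply: (@le_trans _ _ ((K + 1) * #|` bdry d m k|%:R)).
  rewrite -fsum_const; apply: ler_sum => i _; apply: le_trans (YK _) _; by rewrite lerDl.
rewrite mulrC -ler_pdivlMr //.
apply: (@le_trans _ _ (e / (K + 1) / (d.+1 ^ d)%:R * (k ^ d)%:R)).
  exact: bk.
apply: le_trans (ler_wpM2l (ltW e1) (card_ballZ_ge _ _ k0)) _.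
by rewrite mulrA divfK ?gt_eqF // mulrAC [_ * e]mulrC.
Unshelve. all: by end_near. Qed.

(* Averages of [Y] are asymptotically the smallest elements of the convex hull of its orbit. *)
Lemma convex_lower g e : measurable_fun setT g -> (forall x, `|g x| <= K) -> 0 < e ->
  (\forall k \near \oo, forall x, `|avg k g x - avg k Y x| <= e) ->
  \forall k \near \oo, a k <= Rint Q (fun x => g x ^+ 2) + 2%:R * K * e.
Proof.
move=> mg gK e0 H; near=> k.
have k0 : (0 < k)%N by near: k; exists 1%N.
have gk : forall x, `|avg k g x - avg k Y x| <= e by near: k.
have LY2 : L1 Q (fun x => avg k Y x ^+ 2).
  by apply: (@L1_sqr _ K) => [|x]; [exact: meas_avg|exact: avgK].
have Lg2 : L1 Q (fun x => avg k g x ^+ 2).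
  by apply: (@L1_sqr _ K) => [|x]; [exact: meas_avg|exact: bdd_avg].
apply: le_trans (lerD (avg_L2 k0 mg gK) (lexx _)).
rewrite -[X in _ + X](Rint_cst Q) -RintD //; last exact: L1_cst.
apply: le_Rint => //; first by apply: L1D => //; exact: L1_cst.
(* The squares differ by the product of a difference of size at most [e] and a sum of size at most
   [2 * K]. *)
move=> x; have := gk x; have := avgK x k0; have := bdd_avg x k0 gK.
rewrite !ler_norml => /andP[h1 h2] /andP[h3 h4] /andP[h5 h6].
by nra.
Unshelve. all: by end_near. Qed.

(** The argument for minimizing sequences in a convex set of a Hilbert space. Up to small errors
    [a n] approaches [inf A], and the midpoint [g] of two averages cannot lie below it, because the
    averages of [g] are again close to those of [Y]. The parallelogram identity then forces the two
    averages together. *)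
Lemma mean_bdd e : 0 < e -> exists N, forall n m, (N <= n)%N -> (N <= m)%N ->
  Rint Q (fun x => `|avg n Y x - avg m Y x|) <= e.
Proof.
move=> e0.
pose A := [set a n | n in [set n | (0 < n)%N]].
have hA : has_inf A.
  split; first by exists (a 1%N); exists 1%N.
  by exists 0 => _ [n _ <-]; apply: Rint_ge0 => x; exact: sqr_ge0.
have hlow n : (0 < n)%N -> inf A <= a n.
  by move=> n0; apply: ge_inf; [exact: hA.2 | exists n].
pose K1 := K + 1; have K10 : 0 < K1 by apply: ltr_wpDl.
(* Two terms below [inf A + 2 * c] and a midpoint above [inf A - c] give a squared distance of at
   most [12 * c]; with this [c], [12 * c / e + e / 4] stays below [e]. *)
pose c := e ^+ 2 / 32%:R; have c0 : 0 < c by rewrite divr_gt0 ?exprn_gt0.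
pose e1 := c / (2%:R * K1); have e10 : 0 < e1 by rewrite divr_gt0 // mulr_gt0.
have Ke1 : 2%:R * K * e1 <= c.
  rewrite /e1 mulrA ler_pdivrMr ?mulr_gt0 // mulrC ler_wpM2l ?(ltW c0) //.
  by rewrite ler_wpM2l // lerDl.
have [_ [n0 /= n00 <-] an0] := inf_adherent c0 hA.
have [N _ hN] := convex_lower (meas_avg n0 mY) (fun x => avgK x n00) e10 (avg_avg_unif n00 e10).
have up n : (N <= n)%N -> a n <= inf A + 2%:R * c.
  by move=> Nn; have := hN n Nn; rewrite -/(a n0); lra.
exists N.+1 => n m Nn Nm.
have np : (0 < n)%N by exact: leq_trans Nn.
have mp : (0 < m)%N by exact: leq_trans Nm.
pose g x := 2%:R^-1 * (avg n Y x + avg m Y x).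
have mg : measurable_fun setT g.
  by apply: measurable_funM => //; apply: measurable_funD; exact: meas_avg.
have gK x : `|g x| <= K.
  by have := avgK x np; have := avgK x mp; rewrite /g !ler_norml => /andP[? ?] /andP[? ?]; lra.
have low : inf A <= Rint Q (fun x => g x ^+ 2) + c.
  have H : \forall k \near \oo, forall x, `|avg k g x - avg k Y x| <= e1.
    near=> k.
    have H1 : forall x, `|avg k (avg n Y) x - avg k Y x| <= e1 by near: k; exact: avg_avg_unif.
    have H2 : forall x, `|avg k (avg m Y) x - avg k Y x| <= e1 by near: k; exact: avg_avg_unif.
    move=> x; rewrite avgZ avgD; move: (H1 x) (H2 x).
    by rewrite !ler_norml => /andP[? ?] /andP[? ?]; lra.
  have [M _ hM] := convex_lower mg gK e10 H.
  by have := hM M.+1 (leqnSn M); have := hlow M.+1 isT; lra.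
have Ln : L1 Q (fun x => avg n Y x ^+ 2).
  by apply: (@L1_sqr _ K) => [|x]; [exact: meas_avg|exact: avgK].
have Lm : L1 Q (fun x => avg m Y x ^+ 2).
  by apply: (@L1_sqr _ K) => [|x]; [exact: meas_avg|exact: avgK].
have Lg : L1 Q (fun x => g x ^+ 2) by exact: (L1_sqr mg gK).
pose h x := avg n Y x - avg m Y x.
have h2 : Rint Q (fun x => h x ^+ 2) <= 12%:R * c.
  have -> : Rint Q (fun x => h x ^+ 2) = 2%:R * a n + 2%:R * a m - 4%:R * Rint Q (fun x => g x ^+ 2).
    rewrite -!RintZ // -RintD; try exact: L1Z.
    rewrite -RintB; [|by apply: L1D; exact: L1Z|exact: L1Z].
    by apply: eq_Rint => x; rewrite /h /g; field.
  by have := up n (ltnW Nn); have := up m (ltnW Nm); lra.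
have mh : measurable_fun setT h by apply: measurable_funB; exact: meas_avg.
have hK x : `|h x| <= K + K by apply: le_trans (ler_normB _ _) _; apply: lerD; exact: avgK.
have Lh : L1 Q h by exact: L1_bdd hK.
have Lh2 : L1 Q (fun x => h x ^+ 2) by exact: (L1_sqr mh hK).
(* Passage from [L^2] to [L^1] by the completed square [|h| <= h^2 / e + e / 4], in place of the
   Cauchy-Schwarz inequality. *)
apply: (@le_trans _ _ (Rint Q (fun x => e^-1 * h x ^+ 2 + e / 4%:R))).
  apply: le_Rint; [exact: L1_norm | by apply: L1D; [exact: L1Z|exact: L1_cst] | move=> x].
  rewrite -subr_ge0 (_ : _ - _ = e^-1 * (`|h x| - e / 2%:R) ^+ 2); last first.
    by rewrite -[h x ^+ 2]real_normK ?num_real //; field; rewrite gt_eqF.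
  by rewrite mulr_ge0 ?sqr_ge0 // invr_ge0 ltW.
rewrite RintD; [|exact: L1Z|exact: L1_cst].
rewrite RintZ // Rint_cst.
have : e^-1 * Rint Q (fun x => h x ^+ 2) <= 12%:R / 32%:R * e.
  by rewrite ler_pdivrMl //; apply: le_trans h2 _; rewrite /c; lra.
by lra.
Unshelve. all: by end_near. Qed.

End bounded.

(** Averages contract the [L^1] norm, so [Y] may be replaced by its truncation [Z] at level [L], at
    the cost of a third of [e] for each of the two averages. *)
Lemma mean_cauchy Y e : L1 Q Y -> 0 < e -> exists N, forall n m, (N <= n)%N -> (N <= m)%N ->
  Rint Q (fun x => `|avg n Y x - avg m Y x|) <= e.
Proof.
move=> LY e0.
have e3 : 0 < e / 3%:R by rewrite divr_gt0.
have [L Lh Eh] := tail_L1 LY e3.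
pose Z x := Num.max (- L%:R) (Num.min (Y x) L%:R).
have ZL x : `|Z x| <= L%:R.
  have L0 : - L%:R <= L%:R :> R by have : 0 <= L%:R :> R by []; move=> ?; lra.
  by rewrite /Z ler_norml le_max lexx /= ge_max L0 ge_min lexx orbT.
have mZ : measurable_fun setT Z.
  apply: measurable_maxr => //; apply: measurable_minr => //; exact: L1_meas LY.
have YZ x : `|Y x - Z x| = Num.max (`|Y x| - L%:R) 0.
  rewrite /Z; have : 0 <= L%:R :> R by [].
  move: (L%:R) (Y x) => l y l0.
  have [h1|h1] := leP l y.
    rewrite max_r; last by lra.
    by rewrite !ger0_norm ?max_l //; lra.
  have [h2|h2] := leP (- l) y.
    rewrite subrr normr0 max_r // subr_le0 ler_norml h2 ltW //.
  by rewrite opprK !ler0_norm ?max_l //; lra.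
have LZ : L1 Q Z by exact: L1_bdd ZL.
have LYZ : L1 Q (fun x => Y x - Z x) by exact: L1B.
have EYZ : Rint Q (fun x => `|Y x - Z x|) <= e / 3%:R by rewrite (eq_Rint Q YZ).
have [N hN] := mean_bdd mZ ZL e3.
exists N.+1 => n m Nn Nm.
have np : (0 < n)%N by exact: leq_trans Nn.
have mp : (0 < m)%N by exact: leq_trans Nm.
have H k (k0 : (0 < k)%N) : Rint Q (fun x => `|avg k Y x - avg k Z x|) <= e / 3%:R.
  apply: le_trans EYZ; rewrite (eq_Rint Q (g := fun x => `|avg k (fun y => Y y - Z y) x|)).
    exact: Rint_norm_avg.
  by move=> x; rewrite avgB.
have La k : L1 Q (avg k Y) by exact: L1_avg.
have Lz k : L1 Q (avg k Z) by exact: L1_avg.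
have L1n k : L1 Q (fun x => `|avg k Y x - avg k Z x|) by apply: L1_norm; exact: L1B.
have L2n : L1 Q (fun x => `|avg n Z x - avg m Z x|) by apply: L1_norm; exact: L1B.
apply: (@le_trans _ _ (Rint Q (fun x => `|avg n Y x - avg n Z x| + `|avg m Y x - avg m Z x| + `|avg n Z x - avg m Z x|))).
  apply: le_Rint; [by apply: L1_norm; exact: L1B | by do 2 apply: L1D => // | move=> x].
  rewrite (_ : avg n Y x - avg m Y x = (avg n Y x - avg n Z x) - (avg m Y x - avg m Z x) + (avg n Z x - avg m Z x)); last by lra.
  by apply: le_trans (ler_normD _ _) _; rewrite lerD2r; exact: ler_normB.
rewrite !RintD //; last by apply: L1D.
by have := H n np; have := H m mp; have := hN n m (ltnW Nn) (ltnW Nm); lra.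
Qed.

(* The hypothesis says that almost sure limits of averages along subsequences are constant. *)
Theorem mean_const Y : L1 Q Y ->
  (forall phi : nat -> nat, (forall j, j < phi j)%N ->
     {ae Q, forall x, cvgn (fun j => avg (phi j) Y x)} ->
     exists c : R, {ae Q, forall x, avg (phi j) Y x @[j --> \oo] --> c}) ->
  forall e, 0 < e -> exists2 m, (0 < m)%N & Rint Q (fun x => `|avg m Y x - Rint Q Y|) <= e.
Proof.
move=> LY Hc.
have La k : L1 Q (avg k Y) by exact: L1_avg.
have [phi phij cphi] := fast_subseq La (fun e e0 => mean_cauchy LY e0).
have [c cc] := Hc _ phij cphi.
have main e : 0 < e -> exists2 m, (0 < m)%N & Rint Q (fun x => `|avg m Y x - c|) <= e.
  move=> e0; have [N hN] := mean_cauchy LY e0.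
  exists N.+1 => //.
  (* Fatou along [phi]: the distance of [avg N.+1 Y] to the limit [c] inherits the Cauchy bound. *)
  apply: (@fatou_Rint _ _ _ Q (fun j x => `|avg N.+1 Y x - avg (phi j) Y x|)).
  - by move=> j; apply: L1_norm; exact: L1B.
  - by [].
  - by apply: measurableT_comp => //; apply: measurable_funB => //; exact: L1_meas (La _).
  - by [].
  - move: cc; apply: filterS => x cx; apply: cvg_norm; apply: cvgB => //; exact: cvg_cst.
  - exists N => // j /= Nj; apply: hN => //; exact: leq_trans (ltnW (phij j)).
(* Averages preserve the integral, which identifies the constant. *)
have -> : Rint Q Y = c.
  apply/eqP; rewrite -subr_eq0 -normr_le0; apply/ler_addgt0Pr => e e0; rewrite add0r.
  have [m m0] := main e e0; apply: le_trans.
  rewrite -(Rint_avg m0 LY) -[X in _ - X](Rint_cst Q) -RintB //; last exact: L1_cst.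
  by apply: normr_Rint; apply: L1B => //; exact: L1_cst.
exact: main.
Qed.

End mean.

(** * Limits of bounded continuous functions *)

Section functions.
Context (R : realType) (d : nat).
Implicit Types (g h : 'rV[R]_d -> R) (x y : 'rV[R]_d) (r K : R).

Definition box r : set 'rV[R]_d := [set x | forall i, `|x ord0 i| <= r].

Definition bmeas g := measurable_fun [set: BRd R d] (g : BRd R d -> R).

(** Bounded pointwise limits of sequences of continuous functions. The class is closed under
    products and contains the indicators of balls and half-open cells; for members of bounded
    support, integrals inherit measurability in the measure and the bound by [V]. *)
Definition baire g := exists h : nat -> 'rV[R]_d -> R,
  [/\ forall j, continuous (h j), exists K, forall j x, `|h j x| <= K &
      forall x, h j x @[j --> \oo] --> g x].

Definition supp_in r g := forall x, g x != 0 -> box r x.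

Lemma box_mono r s : r <= s -> box r `<=` box s.
Proof. by move=> rs x xr i; apply: le_trans (xr i) rs. Qed.

Lemma supp_in_mono r s g : r <= s -> supp_in r g -> supp_in s g.
Proof. by move=> rs gr x /gr; exact: box_mono. Qed.

Lemma supp_out r g x : supp_in r g -> ~ box r x -> g x = 0.
Proof. by move=> gr xr; apply/eqP; apply: contraT => /gr. Qed.

Lemma coord_cont i : continuous (fun x : 'rV[R]_d => x ord0 i).
Proof. exact: coord_continuous. Qed.

Lemma contC (K : R) : continuous (fun _ : 'rV[R]_d => K).
Proof. exact: cst_continuous. Qed.

Lemma contM g h : continuous g -> continuous h -> continuous (fun x => g x * h x).
Proof. by move=> cg ch x; apply: (@continuousM R _ g h); [exact: cg|exact: ch]. Qed.

Lemma contD g h : continuous g -> continuous h -> continuous (fun x => g x + h x).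
Proof. by move=> cg ch x; apply: (@continuousD R R _ g h); [exact: cg|exact: ch]. Qed.

Lemma contB g h : continuous g -> continuous h -> continuous (fun x => g x - h x).
Proof. by move=> cg ch x; apply: (@continuousB R R _ g h); [exact: cg|exact: ch]. Qed.

Lemma ball_rVE x e y : ball x e y <-> 0 < e /\ forall i, `|x ord0 i - y ord0 i| < e.
Proof.
split=> [[e0 H]|[e0 H]]; split => //; first by move=> i; exact: H.
by move=> i j; rewrite ord1; exact: H.
Qed.

Lemma continuousP_ball g : continuous g <->
  forall x e, 0 < e -> exists2 t, 0 < t &
    forall y, (forall i, `|x ord0 i - y ord0 i| < t) -> `|g x - g y| < e.
Proof.
split=> [cg x e e0|H x].
  have /cvgrPdist_lt /(_ e e0) /nbhs_ballP [t /= t0 ht] := cg x.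
  by exists t => // y xy; apply: (ht y); apply/ball_rVE.
apply: (proj2 (@cvgrPdist_lt _ _ _ (nbhs x) (nbhs_filter x) g (g x))) => e e0; have [t t0 ht] := H x e e0.
by apply/nbhs_ballP; exists t => // y /ball_rVE [_ xy]; exact: ht.
Qed.

Lemma open_BRd (A : set 'rV[R]_d) : open A -> measurable (A : set (BRd R d)).
Proof. by move=> oA; apply: sub_sigma_algebra. Qed.

Lemma cont_bmeas g : continuous g -> bmeas g.
Proof.
move=> /continuousP cg; apply: (measurability _ (RGenOpens.measurableE R)).
move=> _ [_ [a [b ->] <-]]; rewrite setTI; apply: open_BRd; apply: cg.
exact: interval_open.
Qed.

Lemma baire_bmeas g : baire g -> bmeas g.
Proof.
move=> [h [ch _ hg]]; apply: (@measurable_fun_cvg _ (BRd R d) R setT h g).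
  by move=> j; exact: cont_bmeas.
by move=> x _; exact: hg.
Qed.

Lemma baire_bdd g : baire g -> exists K, forall x, `|g x| <= K.
Proof.
move=> [h [_ [K hK] hg]]; exists K => x; apply: (cvgr_to_le (cvg_norm (hg x))).
by apply: nearW => j; exact: hK.
Qed.

Lemma baire_cont g K : continuous g -> (forall x, `|g x| <= K) -> baire g.
Proof.
move=> cg gK; exists (fun=> g); split => //; first by exists K.
by move=> x; exact: cvg_cst.
Qed.

Lemma baire_cst K : baire (fun=> K).
Proof. by apply: (@baire_cont _ `|K|) => //; exact: contC. Qed.

Lemma baireM g h : baire g -> baire h -> baire (fun x => g x * h x).
Proof.
move=> [g_ [cg [K gK] gg]] [h_ [ch [L hL] hh]].
exists (fun j x => g_ j x * h_ j x); split.
- by move=> j; exact: contM.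
- by exists (K * L) => j x; rewrite normrM ler_pM.
- by move=> x; exact: cvgM.
Qed.

Lemma baireD g h : baire g -> baire h -> baire (fun x => g x + h x).
Proof.
move=> [g_ [cg [K gK] gg]] [h_ [ch [L hL] hh]].
exists (fun j x => g_ j x + h_ j x); split.
- by move=> j; exact: contD.
- by exists (K + L) => j x; apply: le_trans (ler_normD _ _) _; exact: lerD.
- by move=> x; exact: cvgD.
Qed.

Lemma baireZ c g : baire g -> baire (fun x => c * g x).
Proof. by apply: baireM; exact: baire_cst. Qed.

Lemma baireN g : baire g -> baire (fun x => - g x).
Proof. by move=> /(baireZ (-1)); congr baire; apply/funext => x; rewrite mulN1r. Qed.

Lemma baireB g h : baire g -> baire h -> baire (fun x => g x - h x).
Proof. by move=> bg /baireN; exact: baireD. Qed.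

Lemma baire_sum (I : Type) (s : seq I) (F : I -> 'rV[R]_d -> R) :
  (forall i, baire (F i)) -> baire (fun x => \sum_(i <- s) F i x).
Proof.
move=> bF; elim: s => [|i s IH].
  by under eq_fun do rewrite big_nil; exact: baire_cst.
by under eq_fun do rewrite big_cons; exact: baireD.
Qed.

Lemma baire_prod (I : Type) (s : seq I) (F : I -> 'rV[R]_d -> R) :
  (forall i, baire (F i)) -> baire (fun x => \prod_(i <- s) F i x).
Proof.
move=> bF; elim: s => [|i s IH].
  by under eq_fun do rewrite big_nil; exact: baire_cst.
by under eq_fun do rewrite big_cons; exact: baireM.
Qed.

Definition clamp (t : R) := Num.max 0 (Num.min t 1).

Lemma clamp_ge0 t : 0 <= clamp t. Proof. by rewrite le_max lexx. Qed.

Lemma clamp_le1 t : clamp t <= 1.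
Proof. by rewrite ge_max ler01 ge_min lexx orbT. Qed.

Lemma norm_clamp t : `|clamp t| <= 1.
Proof. by rewrite ger0_norm ?clamp_ge0 // clamp_le1. Qed.

Lemma clamp0 t : t <= 0 -> clamp t = 0.
Proof. by move=> t0; apply/max_idPl; rewrite ge_min t0. Qed.

Lemma clamp1 t : 1 <= t -> clamp t = 1.
Proof. by move=> t1; rewrite /clamp (min_r t1) max_r. Qed.

Lemma cont_max g h : continuous g -> continuous h -> continuous (fun x => Num.max (g x) (h x)).
Proof. by move=> cg ch x; apply: continuous_max; [exact: cg|exact: ch]. Qed.

Lemma cont_min g h : continuous g -> continuous h -> continuous (fun x => Num.min (g x) (h x)).
Proof. by move=> cg ch x; apply: continuous_min; [exact: cg|exact: ch]. Qed.

Lemma cont_clamp g : continuous g -> continuous (fun x => clamp (g x)).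
Proof.
move=> cg; apply: cont_max; first exact: contC.
by apply: cont_min => //; exact: contC.
Qed.

(** Ramps of slope [j] that equal 1 where [c <= g] and vanish where [g <= c - 1 / j]. *)
Lemma baire_ge g (c : R) : continuous g -> baire (fun x => (c <= g x)%R%:R).
Proof.
move=> cg; exists (fun j x => clamp (j%:R * (g x - c) + 1)); split.
- move=> j; apply: cont_clamp; apply: contD; last exact: contC.
  by apply: contM; [exact: contC|apply: contB => //; exact: contC].
- by exists 1 => j x; exact: norm_clamp.
- move=> x; have [gc|gc] /= := leP c (g x).
    apply: cvg_near_cst; apply: nearW => j; apply: clamp1.
    by rewrite lerDr mulr_ge0 // subr_ge0.
  apply: cvg_near_cst; near=> j; apply: clamp0.
  rewrite -lerBrDr sub0r -ler_ndivrMr ?subr_lt0 //.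
  by near: j; exact: nbhs_infty_ger.
Unshelve. all: by end_near. Qed.

Lemma baire_lt g (c : R) : continuous g -> baire (fun x => (g x < c)%R%:R).
Proof.
move=> /(baire_ge c) /(baireB (baire_cst 1)); congr baire; apply/funext => x.
by rewrite ltNge; case: (c <= g x) => /=; rewrite ?subrr ?subr0.
Qed.

Lemma compact_box r : compact (box r).
Proof.
have := @rV_compact R d (fun=> `[(- r), r]%classic) (fun _ => @segment_compact R _ _).
congr compact; apply/seteqP; split => x h i.
  by rewrite ler_norml; have := h i; rewrite /= in_itv.
by rewrite /= in_itv /= -ler_norml; exact: h.
Qed.

Lemma unif_cont r g : continuous g -> supp_in r g ->
  forall e, 0 < e -> exists2 t, 0 < t &
    forall x y, (forall i, `|x ord0 i - y ord0 i| <= t) -> `|g x - g y| <= e.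
Proof.
move=> cg gr e e0; have /continuousP_ball cg' := cg.
have e2 : 0 < e / 2%:R by rewrite divr_gt0.
have nc := (compact_near_coveringP (box (r + 1))).1 (@compact_box (r + 1)).
have := nc R (0%R^'+) (fun t x => forall y, (forall i, `|x ord0 i - y ord0 i| <= t) -> `|g x - g y| <= e) _.
case=> [x _|t0 /= t00 H].
  have [t t0 ht] := cg' x _ e2.
  have t20 : 0 < t / 2%:R by rewrite divr_gt0.
  exists (ball x (t / 2%:R), [set s | s < t / 2%:R]); first split => /=.
  - exact: nbhsx_ballx.
  - by near=> s; near: s; exact: nbhs_right_lt.
  move=> [x' s] /= [/ball_rVE [_ xx'] st] y xy.
  have h1 : `|g x - g x'| < e / 2%:R by apply: ht => i; apply: lt_trans (xx' i) _; lra.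
  have h2 : `|g x - g y| < e / 2%:R.
    apply: ht => i; have := xx' i; have := xy i.
    rewrite (_ : x ord0 i - y ord0 i = (x ord0 i - x' ord0 i) + (x' ord0 i - y ord0 i)); last by lra.
    by move=> h3 h4; apply: le_lt_trans (ler_normD _ _) _; lra.
  rewrite (_ : g x' - g y = (g x - g y) - (g x - g x')); last by lra.
  by apply: le_trans (ler_normB _ _) _; lra.
(* The bound 1 ensures that if [x] lies outside the cube of half-side [r + 1], then [y] lies outside
   the support as well. *)
pose t := Num.min 1 (t0 / 2%:R).
have t_gt0 : 0 < t by rewrite lt_min ltr01 divr_gt0.
exists t => // x y xy.
have ht : t < t0 by rewrite gt_min; apply/orP; right; lra.
have [xr|xr] := pselect (box (r + 1) x).
  apply: (H t _ t_gt0 x xr y xy).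
  by rewrite /= sub0r normrN ger0_norm ?ltW.
rewrite (supp_out gr (x := x)) ?(supp_out gr (x := y)) ?subrr ?normr0 ?ltW //.
  move=> yr; apply: xr => i; have := ler_normD (x ord0 i - y ord0 i) (y ord0 i).
  have t1 : t <= 1 by rewrite ge_min lexx.
  by rewrite subrK; have := xy i; have := yr i; lra.
by move=> xr'; apply: xr; apply: box_mono xr'; lra.
Unshelve. all: by end_near. Qed.

Lemma cont_supp_bdd r g : continuous g -> supp_in r g -> exists2 K, 0 <= K & forall x, `|g x| <= K.
Proof.
move=> cg gr.
have /compact_bounded [K [_ hK]] : compact (g @` box r).
  apply: continuous_compact; last exact: compact_box.
  exact: continuous_subspaceT.
exists (`|K| + 1); first by rewrite addr_ge0.
move=> x; have [xr|xr] := pselect (box r x).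
  by apply: (hK (`|K| + 1)); [have := ler_norm K; lra | exists x].
by rewrite (supp_out gr xr) normr0 addr_ge0.
Qed.

Lemma baire_Cc r g : continuous g -> supp_in r g -> baire g.
Proof. by move=> cg gr; have [K _ gK] := cont_supp_bdd cg gr; exact: baire_cont gK. Qed.

Lemma cutoff (r : nat) : exists chi : 'rV[R]_d -> R, [/\ continuous chi, supp_in r.+1%:R chi,
  forall x, 0 <= chi x <= 1 & forall x, box r%:R x -> chi x = 1].
Proof.
exists (fun x => \prod_(i < d) clamp (r.+1%:R - `|x ord0 i|)); split.
- elim: (index_enum 'I_d) => [|i t IH].
    by under eq_fun do rewrite big_nil; exact: contC.
  under eq_fun do rewrite big_cons.
  apply: contM => //; apply: cont_clamp; apply: contB; first exact: contC.
  move=> x; apply: (@continuous_comp _ _ _ (fun x : 'rV[R]_d => x ord0 i) (fun t : R => `|t|)).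
    exact: coord_cont.
  exact: norm_continuous.
- move=> x nz i; rewrite leNgt; apply/negP => xi; move/eqP: nz; apply.
  by rewrite (bigD1 i) //= clamp0 ?mul0r // subr_le0 ltW.
- move=> x; rewrite prodr_ge0 /=; last by move=> i _; exact: clamp_ge0.
  by apply: prodr_ile1 => i _; rewrite clamp_ge0 clamp_le1.
- by move=> x xr; rewrite big1 // => i _; rewrite clamp1 // -natr1 addrAC lerDr subr_ge0.
Qed.

(** The approximants are multiplied by a cutoff, at the price of a support larger by 1. This is one
    source of the shifts of the radius in the later bounds by [V]. *)
Lemma baire_supp (r : nat) g : baire g -> supp_in r%:R g ->
  exists h : nat -> 'rV[R]_d -> R, [/\ forall j, continuous (h j),
    forall j, supp_in r.+1%:R (h j), exists K, forall j x, `|h j x| <= K &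
    forall x, h j x @[j --> \oo] --> g x].
Proof.
move=> [h [ch [K hK] hg]] gr; have [chi [cchi chiS chi01 chiI]] := cutoff r.
exists (fun j x => chi x * h j x); split.
- by move=> j; exact: contM.
- by move=> j x; rewrite mulf_eq0 negb_or => /andP[/chiS].
- exists K => j x; rewrite normrM -[X in _ <= X]mul1r ler_pM //.
  by have /andP[? ?] := chi01 x; rewrite ger0_norm.
- move=> x; rewrite (_ : g x = chi x * g x); first by apply: cvgM; [exact: cvg_cst|exact: hg].
  have [xr|xr] := pselect (box r%:R x); first by rewrite chiI // mul1r.
  by rewrite (supp_out gr xr) mulr0.
Qed.

Lemma meas_box r : measurable (box r : set (BRd R d)).
Proof.
have -> : box r = \bigcap_(i in [set: 'I_d]) [set x : BRd R d | (x : 'rV[R]_d) ord0 i \in `[(- r), r]].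
  apply/seteqP; split => x h i.
    by move=> _; rewrite /= in_itv /= -ler_norml; exact: h.
  by rewrite ler_norml; have := h i I; rewrite /= in_itv.
apply: fin_bigcap_measurable => // i _.
have := @cont_bmeas _ (@coord_cont i) measurableT `[(- r), r]%classic.
by rewrite setTI; apply; exact: measurable_itv.
Qed.

Lemma sq_coord x i : x ord0 i ^+ 2 <= sqnorm x.
Proof. by rewrite /sqnorm (bigD1 i) //= lerDl sumr_ge0 // => j _; exact: sqr_ge0. Qed.

Lemma eball_box r : eball0 d r `<=` box `|r|.
Proof.
move=> x; rewrite /eball0 /= => xr i.
have := le_lt_trans (sq_coord x i) xr.
by rewrite -[_ ^+ 2]real_normK ?num_real // -[r ^+ 2]real_normK ?num_real // ltr_pXn2r ?nnegrE // => /ltW.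
Qed.

Lemma box_eball r : box r `<=` eball0 d (d%:R * `|r| + 1).
Proof.
move=> x xr; rewrite /eball0 /=.
apply: (@le_lt_trans _ _ (\sum_(i < d) `|r| ^+ 2)).
  apply: ler_sum => i _; rewrite -[x ord0 i ^+ 2]real_normK ?num_real // lerXn2r ?nnegrE //.
  by apply: le_trans (xr i) (ler_norm _).
rewrite sumr_const card_ord -[X in X < _]mulr_natr.
have d2 : d%:R <= d%:R ^+ 2 :> R by rewrite -natrX ler_nat; nia.
have d0 : 0 <= d%:R :> R by [].
have r0 := normr_ge0 r; move: (d%:R) (`|r|) d2 d0 r0 => a b a2 a0 b0.
have h : b ^+ 2 * a <= b ^+ 2 * a ^+ 2 by rewrite ler_wpM2l ?sqr_ge0.
have ab : 0 <= a * b by exact: mulr_ge0.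
suff -> : (a * b + 1) ^+ 2 = b ^+ 2 * a ^+ 2 + 2%:R * (a * b) + 1 by lra.
by ring.
Qed.

End functions.

(** * Real components of a complex measure and translations *)

Section signed_integral.
Context (R : realType) (d : nat).
Implicit Types (g h : 'rV[R]_d -> R) (x y u : 'rV[R]_d) (r K : R) (phi : M R d) (s : bool).
Implicit Types (m : {measure set (BRd R d) -> \bar R}).

Definition mpos phi s := if s then cm3 phi else cm1 phi.
Definition mneg phi s := if s then cm4 phi else cm2 phi.

(* [s = false]: real part; [s = true]: imaginary part *)
Definition sint phi s g : R := Rint (mpos phi s) g - Rint (mneg phi s) g.

Definition sset phi s (A : set (BRd R d)) : R :=
  fine (mpos phi s A) - fine (mneg phi s A).

(** A class on which all four component integrals are finite, so that [sint], a difference of [fine]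
    values, is linear. *)
Definition nice g := [/\ bmeas g, exists K, forall x, `|g x| <= K & exists r, supp_in r g].

Lemma bdd_box r : @bdd R d (box r).
Proof. by exists (d%:R * `|r| + 1); exact: box_eball. Qed.

Lemma mpos_lfin phi s r : (mpos phi s (box r) < +oo)%E.
Proof.
have [? [? [? ?]]] := @cm_locfin _ _ _ _ phi _ (@meas_box R d r) (bdd_box r).
by case: s.
Qed.

Lemma mneg_lfin phi s r : (mneg phi s (box r) < +oo)%E.
Proof.
have [? [? [? ?]]] := @cm_locfin _ _ _ _ phi _ (@meas_box R d r) (bdd_box r).
by case: s.
Qed.

Lemma L1_indic_box m r : (m (box r) < +oo)%E -> L1 m (\1_(box r)).
Proof.
move=> mr; apply/integrableP; split.
  by apply/measurable_EFinP; apply: measurable_indic; exact: meas_box.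
rewrite (eq_integral (fun x : BRd R d => (\1_(box r) x)%:E)); last by move=> t _; rewrite gee0_abs // lee_fin.
by rewrite integral_indic ?setIT //; exact: meas_box.
Qed.

Lemma L1_lf m r g K : (m (box r) < +oo)%E -> bmeas g -> (forall x, `|g x| <= K) ->
  supp_in r g -> L1 m g.
Proof.
move=> mr mg gK gr; apply: (le_L1 mg _ (L1Z K (L1_indic_box mr))) => x.
have [xr|xr] := pselect (box r x); first by rewrite indicE mem_set // mulr1.
by rewrite (supp_out gr xr) normr0 indicE memNset // mulr0.
Qed.

Lemma nice_L1p phi s g : nice g -> L1 (mpos phi s) g.
Proof. by move=> [mg [K gK] [r gr]]; exact: L1_lf (mpos_lfin _ _ _) mg gK gr. Qed.

Lemma nice_L1n phi s g : nice g -> L1 (mneg phi s) g.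
Proof. by move=> [mg [K gK] [r gr]]; exact: L1_lf (mneg_lfin _ _ _) mg gK gr. Qed.

Lemma niceD g h : nice g -> nice h -> nice (fun x => g x + h x).
Proof.
move=> [mg [K gK] [r gr]] [mh [L hL] [r' hr]]; split.
- exact: measurable_funD.
- by exists (K + L) => x; apply: le_trans (ler_normD _ _) _; exact: lerD.
- exists (Num.max r r') => x; have [g0|/gr + _] := eqVneq (g x) 0.
    by rewrite g0 add0r => /hr; apply: box_mono; rewrite le_max lexx orbT.
  by apply: box_mono; rewrite le_max lexx.
Qed.

Lemma niceM g h K : bmeas g -> (forall x, `|g x| <= K) -> nice h -> nice (fun x => g x * h x).
Proof.
move=> mg gK [mh [L hL] [r' hr]]; split.
- exact: measurable_funM.
- by exists (K * L) => x; rewrite normrM ler_pM.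
- by exists r' => x; rewrite mulf_eq0 negb_or => /andP[_ /hr].
Qed.

Lemma niceZ c g : nice g -> nice (fun x => c * g x).
Proof. by move=> ng; apply: (@niceM (fun=> c) g `|c|) => //; exact: measurable_cst. Qed.

Lemma niceN g : nice g -> nice (fun x => - g x).
Proof. by move=> /(niceZ (-1)); congr nice; apply/funext => x; rewrite mulN1r. Qed.

Lemma nice0 : nice (fun=> 0).
Proof.
split; [exact: measurable_cst | by exists 0 => x; rewrite normr0 | ].
by exists 0 => x; rewrite eqxx.
Qed.

Lemma nice_sum (I : Type) (t : seq I) (F : I -> 'rV[R]_d -> R) : (forall i, nice (F i)) ->
  nice (fun x => \sum_(i <- t) F i x).
Proof.
move=> nF; elim: t => [|i t IH]; first by under eq_fun do rewrite big_nil; exact: nice0.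
by under eq_fun do rewrite big_cons; exact: niceD.
Qed.

Lemma nice_baire r g : baire g -> supp_in r g -> nice g.
Proof. by move=> bg gr; split; [exact: baire_bmeas|exact: baire_bdd|exists r]. Qed.

Lemma nice_Cc r g : continuous g -> supp_in r g -> nice g.
Proof. by move=> cg gr; apply: nice_baire (gr); exact: baire_Cc gr. Qed.

Lemma eq_sint phi s g h : g =1 h -> sint phi s g = sint phi s h.
Proof. by move=> /funext ->. Qed.

Lemma sintD phi s g h : nice g -> nice h ->
  sint phi s (fun x => g x + h x) = sint phi s g + sint phi s h.
Proof.
move=> ng nh; rewrite /sint !RintD; try exact: nice_L1p; try exact: nice_L1n.
by rewrite opprD addrACA.
Qed.

Lemma sintZ phi s c g : nice g -> sint phi s (fun x => c * g x) = c * sint phi s g.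
Proof.
move=> ng; rewrite /sint !RintZ; try exact: nice_L1p; try exact: nice_L1n.
by rewrite mulrBr.
Qed.

Lemma sintN phi s g : nice g -> sint phi s (fun x => - g x) = - sint phi s g.
Proof.
by move=> ng; rewrite -mulN1r -sintZ //; apply: eq_sint => x; rewrite mulN1r.
Qed.

Lemma sintB phi s g h : nice g -> nice h ->
  sint phi s (fun x => g x - h x) = sint phi s g - sint phi s h.
Proof. by move=> ng nh; rewrite sintD ?sintN //; exact: niceN. Qed.

Lemma sint0 phi s : sint phi s (fun=> 0) = 0.
Proof. by rewrite /sint !Rint0 subrr. Qed.

Lemma sint_sum phi s (I : Type) (t : seq I) (F : I -> 'rV[R]_d -> R) : (forall i, nice (F i)) ->
  sint phi s (fun x => \sum_(i <- t) F i x) = \sum_(i <- t) sint phi s (F i).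
Proof.
move=> nF; elim: t => [|i t IH].
  by rewrite big_nil -[RHS](sint0 phi s); apply: eq_sint => x; rewrite big_nil.
rewrite big_cons -IH -sintD //; last exact: nice_sum.
by apply: eq_sint => x; rewrite big_cons.
Qed.

Lemma sint_dct phi s (g_ : nat -> 'rV[R]_d -> R) g K r : (forall n, bmeas (g_ n)) ->
  (forall n x, `|g_ n x| <= K) -> (forall n, supp_in r (g_ n)) ->
  (forall x, g_ n x @[n --> \oo] --> g x) ->
  sint phi s (g_ n) @[n --> \oo] --> sint phi s g.
Proof.
move=> mg gK gr gg.
have dom n x : `|g_ n x| <= K * \1_(box r) x.
  have [xr|xr] := pselect (box r x); first by rewrite indicE mem_set // mulr1.
  by rewrite (supp_out (gr n) xr) normr0 indicE memNset // mulr0.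
have cv m : (m (box r) < +oo)%E -> Rint m (g_ n) @[n --> \oo] --> Rint m g.
  by move=> mr; exact: (Rint_dct mg (L1Z K (L1_indic_box mr)) dom gg).
by apply: cvgB; apply: cv; [exact: mpos_lfin|exact: mneg_lfin].
Qed.

(** This quantity depends on the chosen components. It serves for a fixed [phi] only, to have finite
    bounds and continuity; bounds that are integrated over the law use [V]. *)
Definition mass phi r : R := fine (cm1 phi (box r)) + fine (cm2 phi (box r)) +
  fine (cm3 phi (box r)) + fine (cm4 phi (box r)).

Lemma mass_ge0 phi r : 0 <= mass phi r.
Proof. by rewrite !addr_ge0 // fine_ge0. Qed.

Lemma sint_bound phi s g K r : bmeas g -> (forall x, `|g x| <= K) -> supp_in r g ->
  0 <= K -> `|sint phi s g| <= K * mass phi r.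
Proof.
move=> mg gK gr K0.
have dom x : `|g x| <= K * \1_(box r) x.
  have [xr|xr] := pselect (box r x); first by rewrite indicE mem_set // mulr1.
  by rewrite (supp_out gr xr) normr0 indicE memNset // mulr0.
have bd m : (m (box r) < +oo)%E -> `|Rint m g| <= K * fine (m (box r)).
  move=> mr; have Lg := L1_lf mr mg gK gr.
  apply: le_trans (normr_Rint Lg) _.
  apply: le_trans (le_Rint (L1_norm Lg) (L1Z K (L1_indic_box mr)) dom) _.
  rewrite RintZ; last exact: L1_indic_box.
  by rewrite /Rint integral_indic ?setIT //; exact: meas_box.
have h1 := bd _ (mpos_lfin phi s r); have h2 := bd _ (mneg_lfin phi s r).
apply: le_trans (ler_normB _ _) _; apply: le_trans (lerD h1 h2) _.
rewrite -mulrDr ler_wpM2l // /mass.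
have := fine_ge0 (measure_ge0 (cm1 phi) (box r)); have := fine_ge0 (measure_ge0 (cm2 phi) (box r)).
have := fine_ge0 (measure_ge0 (cm3 phi) (box r)); have := fine_ge0 (measure_ge0 (cm4 phi) (box r)).
by case: s {h1 h2} => /=; lra.
Qed.

End signed_integral.

(** * Translations of measures *)

Section translation.
Context (R : realType) (d : nat).
Implicit Types (g h : 'rV[R]_d -> R) (x y u v : 'rV[R]_d) (phi psi : M R d) (s : bool).
Implicit Types (m : {measure set (BRd R d) -> \bar R}).

Definition tr u : BRd R d -> BRd R d := fun x => (x : 'rV[R]_d) + u.

Lemma tr_cont u : continuous (fun x : 'rV[R]_d => x + u).
Proof. by move=> x; apply: (@continuousD R _ _ id (fun=> u)); [exact: cvg_id|exact: cst_continuous]. Qed.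

Lemma meas_tr u : measurable_fun setT (tr u).
Proof.
apply: (measurability _ (erefl : @measurable _ (BRd R d) = <<s @open 'rV[R]_d >>)).
move=> _ [B oB <-]; rewrite setTI; apply: open_BRd.
by move/continuousP: (@tr_cont u) => /(_ B oB).
Qed.

Definition trm m u : {measure set (BRd R d) -> \bar R} :=
  measure_function_pushforward__canonical__measure_function_Measure m (meas_tr u).

Lemma trmE m u (A : set (BRd R d)) : trm m u A = m (tr u @^-1` A). Proof. by []. Qed.

Lemma bdd_tr u (A : set (BRd R d)) : @bdd R d A -> @bdd R d (tr u @^-1` A).
Proof.
move=> [r Ar]; pose c := `|r| + \sum_i `|u ord0 i|.
suff : tr u @^-1` A `<=` box c by move=> h; exists (d%:R * `|c| + 1); exact: subset_trans h (@box_eball R d c).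
move=> x /Ar /eball_box /= xu i.
have := xu i; rewrite /tr mxE => h.
have : `|u ord0 i| <= \sum_i `|u ord0 i| by rewrite (bigD1 i) //= lerDl sumr_ge0.
have := ler_normB (x ord0 i + u ord0 i) (u ord0 i); rewrite addrK /c; lra.
Qed.

Lemma trM_subproof u phi (A : set (BRd R d)) : measurable A -> @bdd R d A ->
  (trm (cm1 phi) u A < +oo /\ trm (cm2 phi) u A < +oo /\ trm (cm3 phi) u A < +oo /\ trm (cm4 phi) u A < +oo)%E.
Proof.
move=> mA bA; rewrite !trmE; apply: cm_locfin; last exact: bdd_tr.
by rewrite -[X in measurable X]setTI; exact: meas_tr.
Qed.

(** A representative of the translate, obtained by pushing each component forward. It makes
    translation an action on [M] itself, whereas [is_translate] is only a relation because a measure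
    does not determine its components. *)
Definition trM u phi : M R d := CMeas (@trM_subproof u phi).

Lemma trm_add m u v : trm (trm m v) u = trm m (u + v).
Proof.
apply: eq_measure; apply/funext => A; rewrite !trmE.
by congr (m _); apply/funext => x; rewrite /preimage /= /tr -addrA (addrC v).
Qed.

Lemma M_ext (p q : M R d) : cm1 p = cm1 q -> cm2 p = cm2 q -> cm3 p = cm3 q ->
  cm4 p = cm4 q -> p = q.
Proof.
case: p q => [a b c e H] [a' b' c' e' H'] /= E1 E2 E3 E4; subst a' b' c' e'.
congr CMeas; exact: Prop_irrelevance.
Qed.

Lemma trM_add u v phi : trM (u + v) phi = trM u (trM v phi).
Proof. by apply: M_ext; rewrite /= trm_add. Qed.

Lemma bmeas_tr u g : bmeas g -> bmeas (fun x => g (x + u)).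
Proof. by move=> mg; apply: (measurableT_comp mg (meas_tr u)). Qed.

Lemma nice_tr u g : nice g -> nice (fun x => g (x + u)).
Proof.
move=> [mg [K gK] [r gr]]; split; [exact: bmeas_tr | by exists K | ].
exists (r + \sum_i `|u ord0 i|) => x /gr xu i.
have := xu i; rewrite mxE => h.
have : `|u ord0 i| <= \sum_i `|u ord0 i| by rewrite (bigD1 i) //= lerDl sumr_ge0.
have := ler_normB (x ord0 i + u ord0 i) (u ord0 i); rewrite addrK; lra.
Qed.

Lemma sint_trM u phi s g : nice g -> sint (trM u phi) s g = sint phi s (fun x => g (x + u)).
Proof.
move=> ng; have ng' := nice_tr u ng.
have key m : L1 m (fun x => g (x + u)) -> bmeas g -> Rint (trm m u) g = Rint m (fun x => g (x + u)).
  move=> Lg mg; rewrite /Rint; congr fine.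
  by have := integral_pushforward (meas_tr u) (proj2 (measurable_EFinP _ _) mg) Lg measurableT.
have mg : bmeas g by case: ng.
rewrite /sint; congr (_ - _).
  by have := @nice_L1p _ _ phi s _ ng'; case: s => /= L; exact: key.
by have := @nice_L1n _ _ phi s _ ng'; case: s => /= L; exact: key.
Qed.

Lemma is_translate_trM u phi : is_translate u phi (trM u phi).
Proof.
move=> A mA bA.
have AE : tr u @^-1` A = [set a - u | a in (A : set 'rV[R]_d)].
  apply/seteqP; split => x /=; first by move=> xA; exists (tr u x) => //; rewrite /tr addrK.
  by move=> [a aA <-]; rewrite /tr subrK.
by rewrite /cm_set /cm_re /cm_im /= !trmE AE.
Qed.

End translation.

(** * Discretization on a mesh *)

Section mesh.
Context (R : realType) (d : nat).
Local Notation Zd := 'rV[int]_d.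
Implicit Types (g h : 'rV[R]_d -> R) (x y u : 'rV[R]_d) (k : Zd) (N : nat).
Implicit Types (phi : M R d) (s : bool).

Definition idx N x : Zd := \row_i Num.floor (N%:R * x ord0 i).
Definition corner N k : 'rV[R]_d := \row_i ((k ord0 i)%:~R / N%:R).
Definition cellf N k x : R := (idx N x == k)%:R.

(** The product form shows that [cellf] is a limit of continuous functions. *)
Lemma cellfE N k x : cellf N k x =
  \prod_(i < d) (((k ord0 i)%:~R <= N%:R * x ord0 i)%R%:R * (N%:R * x ord0 i < (k ord0 i + 1)%:~R)%R%:R).
Proof.
rewrite /cellf; have [<-|/eqP kx] := eqVneq (idx N x) k.
  by rewrite big1 // => i _; rewrite !mxE floor_le_tmp floorD1_gt mulr1.
suff [i ki] : exists i, idx N x ord0 i != k ord0 i.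
  rewrite (bigD1 i) //= [X in X * _](_ : _ = 0) ?mul0r //.
  move: ki; rewrite mxE; case: (leP (_%:~R)) => h1; case: ltP => h2; rewrite ?mulr0 ?mul0r // => /eqP [].
  by apply: floor_def; rewrite h1 h2.
apply: contrapT => nk; apply: kx; apply/rowP => i; apply/eqP/negPn/negP => ki.
by apply: nk; exists i.
Qed.

Lemma lin_cont (c : R) i : continuous (fun x : 'rV[R]_d => c * x ord0 i).
Proof. by apply: contM; [exact: contC|exact: coord_cont]. Qed.

Lemma baire_cellf N k : baire (cellf N k).
Proof.
pose F (i : 'I_d) x : R := ((k ord0 i)%:~R <= N%:R * x ord0 i)%R%:R * (N%:R * x ord0 i < (k ord0 i + 1)%:~R)%R%:R.
rewrite (_ : cellf N k = fun x => \prod_(i <- index_enum 'I_d) F i x); last first.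
  by apply/funext => x; exact: cellfE.
apply: (@baire_prod _ _ _ _ F) => i; apply: baireM; first by apply: baire_ge; exact: lin_cont.
by apply: baire_lt; exact: lin_cont.
Qed.

Lemma cellf_le1 N k x : `|cellf N k x| <= 1.
Proof. by rewrite /cellf; case: eqP; rewrite ?normr1 ?normr0. Qed.

Lemma idx_bounds N x i : (0 < N)%N ->
  (idx N x ord0 i)%:~R / N%:R <= x ord0 i < (idx N x ord0 i)%:~R / N%:R + N%:R^-1.
Proof.
move=> N0; have N0' : 0 < N%:R :> R by rewrite ltr0n.
rewrite mxE ler_pdivrMr // mulrC floor_le_tmp /= -[X in _ + X]mul1r -mulrDl ltr_pdivlMr // mulrC.
by have := floorD1_gt (N%:R * x ord0 i); rewrite intrD.
Qed.

Lemma corner_dist N x i : (0 < N)%N -> `|x ord0 i - corner N (idx N x) ord0 i| <= N%:R^-1.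
Proof.
move=> N0; have /andP[h1 h2] := idx_bounds x i N0.
by rewrite [corner _ _ _ _]mxE ger0_norm ?subr_ge0 // lerBlDl ltW.
Qed.

Lemma supp_cellf N k n : (0 < N)%N -> k \in Box d (N * n) -> supp_in (n%:R + 1) (cellf N k).
Proof.
move=> N0 /BoxP kn x; rewrite /cellf pnatr_eq0 eqb0 negbK => /eqP xk i.
have := corner_dist x i N0; rewrite xk; set c := corner _ _ _ _ => h.
have N0' : 0 < N%:R :> R by rewrite ltr0n.
have N1 : N%:R^-1 <= 1 :> R by rewrite invf_le1 // ler1n.
have cn : `|c| <= n%:R.
  rewrite /c mxE normrM normfV (ger0_norm (ltW N0')) ler_pdivrMr // -intr_norm.
  by rewrite -natrM mulnC -[X in _ <= X]/(((N * n)%N%:Z)%:~R) ler_int -abszE lez_nat.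
have := ler_normD (x ord0 i - c) c; rewrite subrK; lra.
Qed.

Lemma nice_cellf N k : (0 < N)%N -> nice (cellf N k).
Proof.
move=> N0; have [n kn] := Box_ex k; apply: (@nice_baire _ _ (n%:R + 1)); first exact: baire_cellf.
by apply: supp_cellf => //; apply: Box_mono kn; rewrite leq_pmull.
Qed.

Lemma step_sum (u : Zd -> R) N L x : (forall k, k \notin Box d L -> u k = 0) ->
  u (idx N x) = \sum_(k <- Box d L) u k * cellf N k x.
Proof.
move=> u0; have [kL|kL] := boolP (idx N x \in Box d L); last first.
  rewrite (u0 _ kL) big_seq big1 // => k kB; rewrite /cellf; case: eqP => [E|_]; last by rewrite mulr0.
  by move: kL; rewrite E kB.
rewrite (big_fsetD1 _ kL) /= /cellf eqxx mulr1 big_seq big1 ?addr0 // => k.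
by rewrite !inE => /andP[/negbTE kx _]; rewrite eq_sym kx mulr0.
Qed.

Lemma corner_supp r g N k : (0 < N)%N -> supp_in r%:R g -> k \notin Box d (N * r) -> g (corner N k) = 0.
Proof.
move=> N0 gr; apply: contraNeq => /gr h; apply/BoxP => i.
have N0' : 0 < N%:R :> R by rewrite ltr0n.
have := h i; rewrite mxE normrM normfV (ger0_norm (ltW N0')) ler_pdivrMr // -intr_norm.
by rewrite -natrM mulnC -[X in _ <= X]/(((N * r)%N%:Z)%:~R) ler_int -abszE lez_nat.
Qed.

Lemma sint_step phi s (u : Zd -> R) N L : (0 < N)%N -> (forall k, k \notin Box d L -> u k = 0) ->
  sint phi s (fun x => u (idx N x)) = \sum_(k <- Box d L) u k * sint phi s (cellf N k).
Proof.
move=> N0 u0; rewrite (eq_sint _ _ (fun x => step_sum N x u0)) sint_sum; last first.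
  by move=> k; apply: niceZ; exact: nice_cellf.
by apply: eq_bigr => k _; rewrite sintZ //; exact: nice_cellf.
Qed.

Lemma nice_step (u : Zd -> R) N L : (0 < N)%N -> (forall k, k \notin Box d L -> u k = 0) ->
  nice (fun x => u (idx N x)).
Proof.
move=> N0 u0; rewrite (_ : (fun x => _) = (fun x => \sum_(k <- Box d L) u k * cellf N k x)).
  by apply: nice_sum => k; apply: niceZ; exact: nice_cellf.
by apply/funext => x; exact: step_sum.
Qed.

Lemma supp_step r g N : (0 < N)%N -> supp_in r g -> supp_in (r + 1) (fun x => g (corner N (idx N x))).
Proof.
move=> N0 gr x /gr h i.
have N0' : 0 < N%:R :> R by rewrite ltr0n.
have N1 : N%:R^-1 <= 1 :> R by rewrite invf_le1 // ler1n.
have := corner_dist x i N0; have := h i; set c := corner _ _ _ _ => h1 h2.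
have := ler_normD (x ord0 i - c) c; rewrite subrK; lra.
Qed.

Lemma corner_cvg g x : continuous g -> g (corner n.+1 (idx n.+1 x)) @[n --> \oo] --> g x.
Proof.
move=> /continuousP_ball cg; apply/cvgrPdist_lt => e e0; have [t t0 ht] := cg x e e0.
have [n _ hn] := near_infty_natSinv_lt (PosNum t0).
exists n => // m /= nm; apply: ht => i; apply: le_lt_trans (corner_dist x i (ltn0Sn m)) _.
exact: hn.
Qed.

(** Dominated convergence for the step functions that take the value of [g] at the lower corner of
    each cell. Only the values of [phi] on cells enter the sums, so the lemma passes from set
    functions to integrals. *)
Lemma riemann phi s g (r : nat) K : supp_in r%:R g -> (forall x, `|g x| <= K) ->
  (forall x, g (corner n.+1 (idx n.+1 x)) @[n --> \oo] --> g x) ->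
  \sum_(k <- Box d (n.+1 * r)) g (corner n.+1 k) * sint phi s (cellf n.+1 k) @[n --> \oo] --> sint phi s g.
Proof.
move=> gr gK gc.
rewrite (_ : (fun n => _) = (fun n => sint phi s (fun x => g (corner n.+1 (idx n.+1 x))))); last first.
  apply/funext => n; rewrite (@sint_step phi s (fun k => g (corner n.+1 k)) _ (n.+1 * r)) // => k.
  exact: corner_supp.
apply: (@sint_dct _ _ _ _ _ _ K (r%:R + 1)) => //.
- move=> n; have [] // := @nice_step (fun k => g (corner n.+1 k)) n.+1 (n.+1 * r) (ltn0Sn n).
  by move=> k; exact: corner_supp.
- by move=> n; exact: supp_step.
Qed.

Definition cell N k : set (BRd R d) := [set x | idx N x = k].

Lemma cellf_indic N k : cellf N k = \1_(cell N k).
Proof.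
apply/funext => x; rewrite indicE /cellf; congr ((_ : bool)%:R).
by apply/eqP/idP => [h|/set_mem//]; apply/mem_set.
Qed.

Lemma meas_cell N k : measurable (cell N k).
Proof.
have := baire_bmeas (baire_cellf N k) measurableT (measurable_set1 (1 : R)).
rewrite setTI; congr measurable; apply/seteqP; split => x; rewrite /preimage /cell /cellf /=.
  by case: eqP => // _ /esym/eqP; rewrite oner_eq0.
by move=> ->; rewrite eqxx.
Qed.

Lemma bdd_cell N k : (0 < N)%N -> @bdd R d (cell N k).
Proof.
move=> N0; have [n kn] := Box_ex k.
have [r hr] := @bdd_box R d (n%:R + 1); exists r; apply: subset_trans hr => x xk.
have kn' : k \in Box d (N * n) by apply: Box_mono kn; rewrite leq_pmull.
by apply: (supp_cellf N0 kn'); rewrite /cellf xk eqxx oner_eq0.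
Qed.

Lemma sint_cell phi s N k : sint phi s (cellf N k) = sset phi s (cell N k).
Proof.
have h (m : {measure set (BRd R d) -> \bar R}) : Rint m (cellf N k) = fine (m (cell N k)).
  by rewrite cellf_indic /Rint integral_indic ?setIT //; exact: meas_cell.
by rewrite /sint /sset !h.
Qed.

Definition rCc g := continuous g /\ exists r : nat, supp_in r%:R g.

Lemma rCcP g r : continuous g -> supp_in r g -> rCc g.
Proof.
move=> cg gr; split => //; exists (Num.truncn `|r|).+1; apply: supp_in_mono gr.
by apply: le_trans (ler_norm r) _; exact/ltW/truncnS_gt.
Qed.

Lemma rCc_nice g : rCc g -> nice g.
Proof. by move=> [cg [r gr]]; exact: nice_Cc gr. Qed.

(** The Riemann sums of the two measures coincide, even if their components differ. *)
Lemma sset_sint phi psi : (forall s (A : set (BRd R d)), measurable A -> @bdd R d A -> sset phi s A = sset psi s A) ->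
  forall s g, rCc g -> sint phi s g = sint psi s g.
Proof.
move=> H s g [cg [r gr]]; have [K _ gK] := cont_supp_bdd cg gr.
have h1 := @riemann phi s g r K gr gK (fun x => @corner_cvg g x cg).
have h2 := @riemann psi s g r K gr gK (fun x => @corner_cvg g x cg).
have E n : \sum_(k <- Box d (n.+1 * r)) g (corner n.+1 k) * sint phi s (cellf n.+1 k) =
    \sum_(k <- Box d (n.+1 * r)) g (corner n.+1 k) * sint psi s (cellf n.+1 k).
  apply: eq_bigr => k _; rewrite !sint_cell H //; first exact: meas_cell.
  exact: bdd_cell.
by move/funext: E h1 => -> h1; exact: cvg_unique h1 h2.
Qed.

End mesh.

(** * The measurable space of measures *)

Section complex_integral.
Context (R : realType) (d : nat).
Implicit Types (phi : M R d) (F : 'rV[R]_d -> R[i]) (g : 'rV[R]_d -> R).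

Lemma cm_intE phi F : cm_int phi F =
  Complex (sint phi false (fun x => complex.Re (F x)) - sint phi true (fun x => complex.Im (F x)))
          (sint phi false (fun x => complex.Im (F x)) + sint phi true (fun x => complex.Re (F x))).
Proof.
rewrite /cm_int /cint /sint /= -complexiE; simpc.
by congr Complex; ring.
Qed.

Lemma Cc_Re F : Cc F -> rCc (fun x => complex.Re (F x)).
Proof.
move=> [cR [cI [r Fr]]]; apply: (@rCcP _ _ _ `|r|) => // x; apply: contraNP => xr; apply/eqP.
by rewrite Fr // => /eball_box.
Qed.

Lemma Cc_Im F : Cc F -> rCc (fun x => complex.Im (F x)).
Proof.
move=> [cR [cI [r Fr]]]; apply: (@rCcP _ _ _ `|r|) => // x; apply: contraNP => xr; apply/eqP.
by rewrite Fr // => /eball_box.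
Qed.

Lemma rCc_Cc g : rCc g -> Cc (fun x => Complex (g x) 0).
Proof.
move=> [cg [r gr]]; split => //; split; first exact: contC.
exists (d%:R * `|r%:R| + 1) => x xr; rewrite (supp_out gr) //.
by move=> h; apply: xr; exact: box_eball.
Qed.

End complex_integral.

(** * The vague Borel structure and the lattice action *)

Section M_measurable.
Context (R : realType) (d : nat).

HB.instance Definition _ := gen_eqMixin (M R d).
HB.instance Definition _ := gen_choiceMixin (M R d).

Definition M_zero : M R d.
Proof.
by apply: (@CMeas _ _ (BRd R d) (@bdd R d) mzero mzero mzero mzero) => A _ _; rewrite /mzero !ltry.
Defined.

HB.instance Definition _ := isPointed.Build (M R d) M_zero.

Definition VM := g_sigma_algebraType (@vague_open R d).

Implicit Types (phi psi : M R d) (s : bool) (g : 'rV[R]_d -> R) (u : 'rV[R]_d).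

Lemma open_VM (U : set (M R d)) : vague_open U -> measurable (U : set VM).
Proof. by move=> oU; apply: sub_sigma_algebra. Qed.

Lemma vague_open_sint s g (U : set R) : rCc g -> open U -> vague_open [set phi | U (sint phi s g)].
Proof.
move=> cg oU phi Up; exists 1%N, (fun=> [set phi | U (sint phi s g)]); split => //; last first.
  by move=> psi /(_ ord0 I).
move=> _; exists (fun x => Complex (g x) 0); split; first exact: rCc_Cc.
have E1 psi : complex.Re (cm_int psi (fun x => Complex (g x) 0)) = sint psi false g.
  by rewrite cm_intE /= !sint0 subr0.
have E2 psi : complex.Im (cm_int psi (fun x => Complex (g x) 0)) = sint psi true g.
  by rewrite cm_intE /= !sint0 add0r.
exists [set p : R * R | U (if s then p.2 else p.1)]; split.
  have : continuous (fun p : R * R => if s then p.2 else p.1).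
    by case: s {Up} => p; [exact: cvg_snd|exact: cvg_fst].
  by move/continuousP => /(_ U oU).
by apply/seteqP; split => psi; rewrite /mkset E1 E2; case: s {Up}.
Qed.

Lemma vague_open_bigcup (I : Type) (D : set I) (F : I -> set (M R d)) :
  (forall i, D i -> vague_open (F i)) -> vague_open (\bigcup_(i in D) F i).
Proof.
move=> oF phi [i Di /(oF i Di) [n [S [S1 S2 S3]]]]; exists n, S; split => //.
by move=> psi /S3 h; exists i.
Qed.

Lemma meas_sint s g : rCc g -> measurable_fun setT (fun phi : VM => sint phi s g).
Proof.
move=> cg; apply: (measurability _ (RGenOpens.measurableE R)).
move=> _ [_ [a [b ->] <-]]; rewrite setTI; apply: open_VM.
by apply: vague_open_sint => //; exact: interval_open.
Qed.

Definition Vset (r : nat) phi : set R := [set y | exists s g,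
  [/\ continuous g, supp_in r%:R g, (forall x, `|g x| <= 1) & y = `|sint phi s g|]].

(* local variation of [phi] on the cube of half-side [r] *)
Definition V (r : nat) phi : R := sup (Vset r phi).

Lemma has_sup_V r phi : has_sup (Vset r phi).
Proof.
split.
  exists `|sint phi false (fun=> 0)|; exists false, (fun=> 0); split => //.
  - exact: contC.
  - by move=> x; rewrite eqxx.
  - by move=> x; rewrite normr0.
exists (mass phi r%:R) => _ [s [g [cg gr g1 ->]]].
rewrite -[mass _ _]mul1r; apply: sint_bound => //; exact: cont_bmeas.
Qed.

Lemma V_ub r phi s g : continuous g -> supp_in r%:R g -> (forall x, `|g x| <= 1) ->
  `|sint phi s g| <= V r phi.
Proof. by move=> cg gr g1; apply: (ub_le_sup (has_sup_V r phi).2); exists s, g. Qed.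

Lemma V_ge0 r phi : 0 <= V r phi.
Proof.
apply: le_trans (@V_ub r phi false (fun=> 0) _ _ _) => //; first exact: contC.
  by move=> x; rewrite eqxx.
by move=> x; rewrite normr0.
Qed.

Lemma V_le r phi c : (forall s g, continuous g -> supp_in r%:R g -> (forall x, `|g x| <= 1) ->
  `|sint phi s g| <= c) -> V r phi <= c.
Proof.
move=> H; apply: ge_sup; first exact: (has_sup_V r phi).1.
by move=> _ [s [g [cg gr g1 ->]]]; exact: H.
Qed.

Lemma V_mono r r' phi : (r <= r')%N -> V r phi <= V r' phi.
Proof.
move=> rr; apply: V_le => s g cg gr g1; apply: V_ub => //.
by apply: supp_in_mono gr; rewrite ler_nat.
Qed.

(** Lower semicontinuity: the set where [V] exceeds [a] is a union, over test functions, of vaguely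
    open sets. *)
Lemma meas_V r : measurable_fun setT (V r : VM -> R).
Proof.
apply: (measurability _ (RGenOInfty.measurableE R)).
move=> _ [_ [a ->] <-]; rewrite setTI; apply: open_VM.
pose D := [set p : bool * ('rV[R]_d -> R) | [/\ continuous p.2, supp_in r%:R p.2 & forall x, `|p.2 x| <= 1]].
rewrite (_ : _ @^-1` _ = \bigcup_(p in D) [set phi | [set t : R | a < `|t|] (sint phi p.1 p.2)]).
  apply: vague_open_bigcup => -[s g] [/= cg gr g1].
  apply: (@vague_open_sint s g [set t | a < `|t|]); first by split => //; exists r.
  rewrite (_ : [set t : R | a < `|t|] = (fun t : R => `|t|) @^-1` `]a, +oo[%classic); last first.
    by apply/seteqP; split => t; rewrite /preimage /= in_itv /= andbT.
  have /continuousP := @norm_continuous R R; apply; exact: rray_open.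
apply/seteqP; split => phi; rewrite /preimage /= in_itv /= andbT.
  move=> /(sup_gt (has_sup_V r phi).1) [_ [s [g [cg gr g1 ->]]] ag].
  by exists (s, g).
by move=> [[s g] [/= cg gr g1]] ag; apply: lt_le_trans ag _; exact: V_ub.
Qed.

(* truncate the approximating functions at the bound [K] of [g] *)
Lemma V_baire r phi s g K : baire g -> supp_in r%:R g -> (forall x, `|g x| <= K) -> 0 <= K ->
  `|sint phi s g| <= K * V r.+1 phi.
Proof.
move=> bg gr gK; have ng := nice_baire bg gr.
have [h [ch hS _ hg]] := baire_supp bg gr; rewrite le_eqVlt => /orP[/eqP K0|K0].
  rewrite (@eq_sint _ _ _ _ _ (fun=> 0)) ?sint0 ?normr0 -?K0 ?mul0r //.
  by move=> x; apply/eqP; rewrite -normr_le0 (le_trans (gK x)) // -K0.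
pose w (t : R) := Num.max (-1) (Num.min t 1).
have w1 t : `|w t| <= 1.
  by rewrite ler_norml le_max lexx /= ge_max ge_min lexx orbT andbT (le_trans (lerN10 R) ler01).
have w_id t : `|t| <= 1 -> w t = t.
  by rewrite ler_norml => /andP[h1 h2]; rewrite /w min_l // max_r.
have cw : continuous w.
  have cmin : continuous (fun t : R => Num.min t 1).
    move=> t; apply: (@continuous_min R _ id (fun=> 1) t); first exact: cvg_id.
    exact: cst_continuous.
  have cm1 : continuous (fun _ : R => - 1 : R) by exact: cst_continuous.
  by move=> t; have := @continuous_max R _ _ _ t (cm1 t) (cmin t).
pose f j x := w (K^-1 * h j x).
have fS j : supp_in r.+1%:R (f j).
  move=> x fx; apply: (hS j); apply: contra_neq fx => h0.
  by rewrite /f h0 mulr0 w_id // normr0.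
have cf j : continuous (f j).
  apply: cont_max; first exact: contC.
  apply: cont_min; last exact: contC.
  by apply: contM; [exact: contC|exact: ch].
have lim : sint phi s (f j) @[j --> \oo] --> sint phi s (fun x => K^-1 * g x).
  apply: (@sint_dct _ _ _ _ f _ 1 r.+1%:R) => //; first by move=> j; exact: cont_bmeas.
    by move=> j x; exact: w1.
  move=> x; rewrite -(w_id (K^-1 * g x)); last first.
    by rewrite normrM ger0_norm ?invr_ge0 ?(ltW K0) // ler_pdivrMl // mulr1.
  have lx : K^-1 * h j x @[j --> \oo] --> K^-1 * g x by apply: cvgM; [exact: cvg_cst|exact: hg].
  exact: (cvg_comp _ _ lx (cw _)).
have : `|sint phi s (fun x => K^-1 * g x)| <= V r.+1 phi.
  apply: (cvgr_to_le (cvg_norm lim)); apply: nearW => j.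
  by apply: V_ub; [exact: cf|exact: fS|move=> x; exact: w1].
by rewrite sintZ // normrM ger0_norm ?invr_ge0 ?(ltW K0) // ler_pdivrMl.
Qed.

Lemma meas_sint_baire (r : nat) s g : baire g -> supp_in r%:R g ->
  measurable_fun setT (fun phi : VM => sint phi s g).
Proof.
move=> bg gr; have [h [ch hS [K hK] hg]] := baire_supp bg gr.
apply: (@measurable_fun_cvg _ VM R setT (fun j phi => sint phi s (h j))).
  by move=> j; apply: meas_sint; split => //; exists r.+1.
move=> phi _; apply: (@sint_dct _ _ _ _ h _ K r.+1%:R) => //.
by move=> j; exact: cont_bmeas.
Qed.

Lemma cm_int_sint phi psi : (forall s g, rCc g -> sint phi s g = sint psi s g) ->
  forall F, Cc F -> cm_int phi F = cm_int psi F.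
Proof. by move=> H F cF; rewrite !cm_intE !H //; first [exact: Cc_Im | exact: Cc_Re]. Qed.

(** Sets that do not separate the two measures form a sigma-algebra containing the vaguely open
    sets. Hence Borel sets ignore the choice of components. *)
Lemma vague_saturated (B : set VM) phi psi : measurable B ->
  (forall s g, rCc g -> sint phi s g = sint psi s g) -> B phi -> B psi.
Proof.
move=> mB H; have {}H := cm_int_sint H.
pose S : set (set VM) := [set B | B phi <-> B psi].
have /(_ B mB) [] // : @measurable _ VM `<=` S.
apply: smallest_sub.
  split; first by [].
    by move=> A [h1 h2]; split=> -[_ nA]; split=> // ?; apply: nA; [exact: h2|exact: h1].
  by move=> F hF; split=> -[n _ Fn]; exists n => //; apply/(hF n).
have open1 (p q : M R d) : (forall F : 'rV[R]_d -> R[i], Cc F -> cm_int p F = cm_int q F) -> forall U, vague_open U -> U p -> U q.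
  move=> pq U oU /oU [n [T [T1 T2 T3]]]; apply: T3 => k _.
  have [f [cf [W [_ TE]]]] := T1 k.
  by have := T2 k; rewrite TE /mkset (pq f cf).
by move=> U oU; split; apply: open1 => // F cF; rewrite H.
Qed.

Lemma cont_tr u g : continuous g -> continuous (fun x : 'rV[R]_d => g (x + u)).
Proof.
move=> cg x; have := @continuous_comp _ _ _ (fun x : 'rV[R]_d => x + u) g x (@tr_cont R d u x).
by apply; exact: cg.
Qed.

Lemma rCc_tr u g : rCc g -> rCc (fun x => g (x + u)).
Proof.
move=> cg; have [_ _ [r gr]] := nice_tr u (rCc_nice cg); apply: (rCcP _ gr).
exact: cont_tr cg.1.
Qed.

Lemma meas_trM u : measurable_fun setT (trM u : VM -> VM).
Proof.
apply: (measurability _ (erefl : @measurable _ VM = <<s @vague_open R d >>)).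
move=> _ [U oU <-]; rewrite setTI; apply: open_VM => phi /oU [n [S [S1 S2 S3]]].
exists n, (fun k => trM u @^-1` S k); split => //.
  move=> k; have [f [cf [W [oW SE]]]] := S1 k.
  have cfu : Cc (fun x => f (x + u)).
    have cR := Cc_Re cf; have cI := Cc_Im cf.
    split; first exact: (rCc_tr u cR).1.
    split; first exact: (rCc_tr u cI).1.
    have [r fr] := cf.2.2.
    have [r' hr'] := @bdd_tr R d u (eball0 d r) (ex_intro _ r (fun _ h => h)).
    by exists r' => x xr; apply: fr => h; apply: xr; exact: hr'.
  exists (fun x => f (x + u)); split => //; exists W; split => //.
  have E psi : cm_int (trM u psi) f = cm_int psi (fun x => f (x + u)).
    have nR := rCc_nice (Cc_Re cf); have nI := rCc_nice (Cc_Im cf).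
    by rewrite !cm_intE !(sint_trM u psi _ nR) !(sint_trM u psi _ nI).
  by apply/seteqP; split => psi; rewrite /preimage /mkset SE /mkset E.
by move=> psi h; apply: S3 => k kI; exact: h.
Qed.

Lemma trM0 phi : trM 0 phi = phi.
Proof.
apply: M_ext; apply: eq_measure; apply/funext => A; rewrite /= trmE;
by congr (_ _); apply/funext => x; rewrite /preimage /= /tr addr0.
Qed.

Lemma is_translate_sint u phi psi : is_translate u phi psi ->
  forall s g, rCc g -> sint psi s g = sint (trM u phi) s g.
Proof.
move=> H; apply: sset_sint => s A mA bA.
have := H A mA bA; rewrite -(is_translate_trM u phi mA bA) => -[h1 h2].
by case: s.
Qed.

(** [shift_set] is an image under a relation; saturation turns it into a preimage under the
    measurable map [trM u], the form in which stationarity and ergodicity are used. *)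
Lemma shift_setE u (B : set VM) : measurable B -> shift_set (- u) B = trM u @^-1` B.
Proof.
move=> mB; apply/seteqP; split => psi /=.
  move=> [phi Bphi tphi]; apply: (vague_saturated mB _ Bphi) => s g cg.
  rewrite sint_trM; last exact: rCc_nice.
  rewrite (is_translate_sint tphi); last exact: rCc_tr.
  rewrite sint_trM; last by apply/rCc_nice/rCc_tr.
  by apply: eq_sint => x; rewrite subrK.
move=> Bpsi; exists (trM u psi) => //.
have := @is_translate_trM R d (- u) (trM u psi).
by rewrite -trM_add addNr trM0.
Qed.

Definition toR (k : 'rV[int]_d) : 'rV[R]_d := \row_i (k ord0 i)%:~R.

(** Translation by [- k], which brings the neighbourhood of [k] to the origin. *)
Definition tau (k : 'rV[int]_d) (phi : VM) : VM := trM (- toR k) phi.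

Lemma toRD a b : toR (a + b) = toR a + toR b.
Proof. by apply/rowP => i; rewrite !mxE intrD. Qed.

Lemma tauD a b phi : tau (a + b) phi = tau a (tau b phi).
Proof. by rewrite /tau -trM_add toRD opprD. Qed.

Lemma mtau a : measurable_fun setT (tau a).
Proof. exact: meas_trM. Qed.

Lemma sint_tau k phi s g : nice g -> sint (tau k phi) s g = sint phi s (fun x => g (x - toR k)).
Proof. by move=> ng; rewrite /tau sint_trM. Qed.

Lemma V_trM r u phi (n : nat) : (forall i, `|u ord0 i| <= n%:R) -> V r (trM u phi) <= V (r + n) phi.
Proof.
move=> un; apply: V_le => s g cg gr g1.
rewrite sint_trM; last exact: nice_Cc gr.
apply: V_ub => [|x /gr h i|//]; first exact: cont_tr.
have := h i; rewrite mxE natrD => h1.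
have := ler_normB (x ord0 i + u ord0 i) (u ord0 i); rewrite addrK; have := un i; lra.
Qed.

Lemma tau_trM k u phi : tau k (trM u phi) = trM u (tau k phi).
Proof. by rewrite /tau -!trM_add addrC. Qed.

(** * The distribution of the random measure *)

Section law.
Context (dO : measure_display) (O : measurableType dO) (P : probability O R) (Phi : O -> M R d).
Hypothesis HPhi : random_measure Phi.

Lemma meas_Phi : measurable_fun setT (Phi : O -> VM).
Proof. by move=> _ B mB; rewrite setTI; exact: HPhi. Qed.

Let law0 := pushforward P (Phi : O -> VM).
HB.instance Definition _ := Measure.copy law0 (measure_function_pushforward__canonical__measure_function_Measure P meas_Phi).
Lemma law_setT : law0 setT = 1%E.
Proof. by rewrite /law0 /pushforward preimage_setT probability_setT. Qed.
HB.instance Definition _ := Measure_isProbability.Build _ _ _ law0 law_setT.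
Definition law : probability VM R := law0.

Lemma lawE (B : set VM) : law B = P (Phi @^-1` B). Proof. by []. Qed.

Lemma law_trM u (B : set VM) : stationary P Phi -> measurable B -> law (trM u @^-1` B) = law B.
Proof. by move=> st mB; rewrite !lawE -shift_setE // st. Qed.

Lemma law_ergodic (B : set VM) : ergodic P Phi -> measurable B ->
  (forall u phi, B (trM u phi) <-> B phi) -> law B = 0%E \/ law B = 1%E.
Proof.
move=> erg mB inv; apply: erg => // u.
rewrite -[u]opprK shift_setE //; apply/seteqP; split => phi /=; by rewrite /preimage /= inv.
Qed.

Lemma ae_law (p : VM -> Prop) : {ae law, forall phi, p phi} -> {ae P, forall w, p (Phi w)}.
Proof.
move=> [N [mN N0 sub]]; exists (Phi @^-1` N); split => //; first exact: HPhi.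
by move=> w /= nw; apply: sub.
Qed.

End law.

End M_measurable.

(** * Double integrals of kernels over unit cells *)

Section kernels.
Context (R : realType) (d : nat).
Local Notation Zd := 'rV[int]_d.
Implicit Types (a b g : 'rV[R]_d -> R) (x y u : 'rV[R]_d) (k : Zd) (n r : nat) (K : R).
Implicit Types (phi : M R d) (s t : bool).

(** An iterated integral: [s] selects the real or imaginary part for the outer variable [x], and [t]
    for the inner variable [y]. *)
Definition J phi s t a b g : R :=
  sint phi s (fun x => a x * sint phi t (fun y => b y * g (x - y))).

Lemma baire_tr u g : baire g -> baire (fun x => g (x + u)).
Proof.
move=> [h [ch [K hK] hg]]; exists (fun j x => h j (x + u)); split.
- by move=> j; exact: cont_tr.
- by exists K.
- by move=> x; exact: hg.
Qed.

Lemma cont_refl g x : continuous g -> continuous (fun y : 'rV[R]_d => g (x - y)).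
Proof.
move=> /continuousP_ball cg; apply/continuousP_ball => y e e0.
have [t t0 ht] := cg (x - y) e e0; exists t => // y' yy'; apply: ht => i.
by rewrite !mxE (_ : _ - _ = - (y ord0 i - y' ord0 i)) ?normrN //; lra.
Qed.

Lemma V_cell phi s F K k r : baire F -> (forall x, F x != 0 -> box r%:R (x - toR R k)) ->
  (forall x, `|F x| <= K) -> 0 <= K -> `|sint phi s F| <= K * V r.+1 (tau k phi).
Proof.
move=> bF sF FK K0.
have bG : baire (fun x => F (x + toR R k)) by exact: baire_tr.
have sG : supp_in r%:R (fun x => F (x + toR R k)) by move=> x /sF; rewrite addrK.
rewrite (@eq_sint _ _ _ _ _ (fun x => F (x - toR R k + toR R k))); last by move=> x; rewrite subrK.
rewrite -(@sint_tau _ _ k phi s (fun x => F (x + toR R k))); last exact: nice_baire sG.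
by apply: V_baire.
Qed.

Lemma cellf_neq0 N k y : cellf N k y != 0 :> R -> idx N y = k.
Proof. by rewrite /cellf pnatr_eq0 eqb0 negbK => /eqP. Qed.

Lemma box_cell k y : idx 1 y = k -> box 1 (y - toR R k).
Proof.
move=> <- i; have := corner_dist y i (ltn0Sn 0).
by rewrite !mxE !divr1 invr1.
Qed.

Variables (g : 'rV[R]_d -> R) (r : nat) (K : R).
Hypotheses (cg : continuous g) (gr : supp_in r%:R g) (gK : forall x, `|g x| <= K) (K0 : 0 <= K).

Let bg x : baire (fun y => g (x - y)).
Proof. by apply: baire_cont (fun y => gK _); exact: cont_refl. Qed.

Lemma inner_nice b L x : baire b -> supp_in L b -> nice (fun y => b y * g (x - y)).
Proof.
move=> bb bL; apply: (@nice_baire _ _ L); first exact: baireM.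
by move=> y; rewrite mulf_eq0 negb_or => /andP[/bL].
Qed.

Lemma inner_nice' b x : baire b -> nice (fun y => b y * g (x - y)).
Proof.
move=> bb; apply: (@nice_baire _ _ (\sum_i `|x ord0 i| + r%:R)); first exact: baireM.
move=> y; rewrite mulf_eq0 negb_or => /andP[_ /gr h] i.
have := h i; rewrite !mxE => h1.
have : `|x ord0 i| <= \sum_i `|x ord0 i| by rewrite (bigD1 i) //= lerDl sumr_ge0.
have := ler_normB (x ord0 i) (x ord0 i - y ord0 i).
by rewrite opprB addrCA subrr addr0; lra.
Qed.

(** [g] is uniformly continuous and [phi] has finite mass on the support of [b]. Continuity in [x]
    is what allows the outer integral to be bounded by [V]. *)
Lemma inner_cont phi t b L : baire b -> (forall x, `|b x| <= 1) -> supp_in L b ->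
  continuous (fun x => sint phi t (fun y => b y * g (x - y))).
Proof.
move=> bb b1 bL; apply/continuousP_ball => x e e0.
have m0 := mass_ge0 phi L.
pose e' := e / (mass phi L + 1).
have e'0 : 0 < e' by rewrite divr_gt0 // ltr_wpDl.
have [q q0 hq] := unif_cont cg gr e'0.
exists q => // x' xx'.
rewrite -sintB; try exact: inner_nice bL.
apply: (@le_lt_trans _ _ (e' * mass phi L)).
  apply: sint_bound; last exact: ltW.
  - by apply: measurable_funB; apply: baire_bmeas; exact: baireM.
  - move=> y; rewrite -mulrBr normrM -[X in _ <= X]mul1r ler_pM //; apply: hq => i.
    rewrite !mxE (_ : _ - _ = x ord0 i - x' ord0 i); last by lra.
    exact/ltW/xx'.
  - move=> y; rewrite -mulrBr mulf_eq0 negb_or => /andP[/bL //].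
rewrite /e' mulrAC ltr_pdivrMr ?ltr_wpDl // ltr_pM2l //; lra.
Qed.

Lemma piece_inner_bound phi t b k x : baire b -> (forall x, `|b x| <= 1) ->
  `|sint phi t (fun y => b y * cellf 1 k y * g (x - y))| <= K * V 2 (tau k phi).
Proof.
move=> bb b1; apply: V_cell => //.
- by apply: baireM => //; apply: baireM => //; exact: baire_cellf.
- move=> y; rewrite !mulf_eq0 !negb_or => /andP[/andP[_ ck] _].
  by apply: box_cell; exact: cellf_neq0 ck.
- move=> y; rewrite normrM -[X in _ <= X]mul1r ler_pM // normrM mulr_ile1 //.
  exact: cellf_le1.
Qed.

Lemma supp_cell1 k : exists L, supp_in L (@cellf R d 1 k).
Proof.
have [n kn] := Box_ex k; exists (n%:R + 1); apply: supp_cellf => //.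
by rewrite mul1n.
Qed.

Lemma piece_baire b k : baire b -> baire (fun y => b y * cellf 1 k y).
Proof. by move=> bb; apply: baireM => //; exact: baire_cellf. Qed.

Lemma piece_b1 b k x : (forall x, `|b x| <= 1) -> `|b x * cellf 1 k x| <= 1.
Proof. by move=> b1; rewrite normrM mulr_ile1 //; exact: cellf_le1. Qed.

Lemma piece_supp b k : exists L, supp_in L (fun y => b y * cellf 1 k y).
Proof.
have [L hL] := supp_cell1 k; exists L => y; rewrite mulf_eq0 negb_or => /andP[_ /hL] //.
Qed.

Lemma piece_inner_supp phi t b k x :
  sint phi t (fun y => b y * cellf 1 k y * g (x - y)) != 0 -> box (r%:R + 1) (x - toR R k).
Proof.
apply: contraNP => nb; rewrite (@eq_sint _ _ _ _ _ (fun=> 0)) ?sint0 // => y.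
apply/eqP; rewrite !mulf_eq0; apply/negPn/negP; rewrite !negb_or => /andP[/andP[_ ck] /gr h].
apply: nb => i; have := h i.
have /box_cell /(_ i) : idx 1 y = k by exact: cellf_neq0 ck.
rewrite !mxE => h1 h2; have := ler_normD (x ord0 i - y ord0 i) (y ord0 i - (k ord0 i)%:~R).
by rewrite addrA subrK; lra.
Qed.

Lemma outer_baire phi t a b k : baire a -> baire b -> (forall x, `|b x| <= 1) ->
  baire (fun x => a x * sint phi t (fun y => b y * cellf 1 k y * g (x - y))).
Proof.
move=> ba bb b1; apply: baireM => //; have [L bL] := piece_supp b k.
apply: (@baire_cont _ _ _ (K * V 2 (tau k phi))); last by move=> x; exact: piece_inner_bound.
have := @inner_cont phi t _ L (piece_baire k bb) (fun x => piece_b1 k x b1) bL.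
by [].
Qed.

Lemma outer_nice phi t a b k : baire a -> baire b -> (forall x, `|b x| <= 1) ->
  nice (fun x => a x * sint phi t (fun y => b y * cellf 1 k y * g (x - y))).
Proof.
move=> ba bb b1; apply: (@nice_baire _ _ (r%:R + 1 + \sum_i `|toR R k ord0 i|)).
  exact: outer_baire.
move=> x; rewrite mulf_eq0 negb_or => /andP[_ /piece_inner_supp h] i.
have := h i; rewrite [(x - _) ord0 i]mxE [(- toR R k) ord0 i]mxE => h1.
have : `|toR R k ord0 i| <= \sum_i `|toR R k ord0 i| by rewrite (bigD1 i) //= lerDl sumr_ge0.
have := ler_normD (x ord0 i - toR R k ord0 i) (toR R k ord0 i); rewrite subrK; lra.
Qed.

(** With [y] in the cell at [k], the variable [x] stays within [r + 1] of [k]; approximation by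
    continuous functions adds another 1. Inner and outer integral each contribute one factor [V]. *)
Lemma piece_bound phi s t a b k : baire a -> (forall x, `|a x| <= 1) ->
  baire b -> (forall x, `|b x| <= 1) ->
  `|J phi s t a (fun y => b y * cellf 1 k y) g| <= K * V r.+2 (tau k phi) ^+ 2.
Proof.
move=> ba a1 bb b1; have V0 n := V_ge0 n (tau k phi).
apply: (@le_trans _ _ (K * V 2 (tau k phi) * V r.+2 (tau k phi))).
  apply: V_cell; last exact: mulr_ge0.
  - exact: outer_baire.
  - by move=> x; rewrite mulf_eq0 negb_or => /andP[_ /piece_inner_supp]; rewrite natr1.
  - by move=> x; rewrite normrM -[X in _ <= X]mul1r ler_pM //; exact: piece_inner_bound.
by rewrite -mulrA ler_wpM2l // expr2 ler_wpM2r //; exact: V_mono.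
Qed.

Lemma idx_Box n y : box n%:R y -> idx 1 y \in Box d n.+1.
Proof.
move=> yn; apply/BoxP => i; have := yn i; have /andP[] := idx_bounds y i (ltn0Sn 0).
rewrite !divr1 invr1; move: (idx 1 y ord0 i) => c h1 h2; rewrite ler_norml => /andP[h3 h4].
have c1 : (c < n%:Z + 1)%R by rewrite -(@ltr_int R) intrD; have : n%:~R = n%:R :> R by []; lra.
have c2 : (- n%:Z - 1 < c)%R.
  by rewrite -(@ltr_int R) intrB intrN; have : n%:~R = n%:R :> R by []; lra.
lia.
Qed.

Lemma outer_sum phi t a b n x : baire b -> (forall x, `|b x| <= 1) ->
  (forall x y, a x * (b y * g (x - y)) != 0 -> box n%:R y) ->
  a x * sint phi t (fun y => b y * g (x - y)) =
  \sum_(k <- Box d n.+1) a x * sint phi t (fun y => b y * cellf 1 k y * g (x - y)).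
Proof.
move=> bb b1 Hn; rewrite -mulr_sumr.
have [->|ax] := eqVneq (a x) 0; first by rewrite !mul0r.
congr (_ * _); rewrite -sint_sum; last first.
  by move=> k; have [L bL] := piece_supp b k; apply: inner_nice bL; exact: piece_baire.
apply: eq_sint => y.
have [by0|yn] := eqVneq (b y * g (x - y)) 0.
  by rewrite by0 big1 // => k _; rewrite mulrAC by0 mul0r.
have yB : idx 1 y \in Box d n.+1 by apply/idx_Box/(Hn x); rewrite mulf_neq0.
rewrite (big_fsetD1 _ yB) /= big_seq big1 ?addr0 => [|k].
  by rewrite /cellf eqxx mulr1.
by rewrite !inE => /andP[ky _]; rewrite /cellf eq_sym (negbTE ky) mulr0 mul0r.
Qed.

Lemma outer_nice_box phi t a b n : baire a -> baire b -> (forall x, `|b x| <= 1) ->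
  (forall x y, a x * (b y * g (x - y)) != 0 -> box n%:R y) ->
  nice (fun x => a x * sint phi t (fun y => b y * g (x - y))).
Proof.
move=> ba bb b1 Hn; rewrite (_ : (fun x => _) = fun x =>
  \sum_(k <- Box d n.+1) a x * sint phi t (fun y => b y * cellf 1 k y * g (x - y))).
  by apply: nice_sum => k; exact: outer_nice.
by apply/funext => x; exact: outer_sum.
Qed.

Lemma J_sum phi s t a b n : baire a -> baire b -> (forall x, `|b x| <= 1) ->
  (forall x y, a x * (b y * g (x - y)) != 0 -> box n%:R y) ->
  J phi s t a b g = \sum_(k <- Box d n.+1) J phi s t a (fun y => b y * cellf 1 k y) g.
Proof.
move=> ba bb b1 Hn; rewrite /J -sint_sum; last by move=> k; exact: outer_nice.
by apply: eq_sint => x; exact: outer_sum.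
Qed.

(** After decomposition by the cell of [y], only the cells of [D] survive in the difference, where
    each integral contributes at most [K] times the squared variation. Both boundary estimates, for
    balls and for translations, come from this. *)
Lemma J_compare phi s t a1 b1 a2 b2 n (D : {fset Zd}) :
  baire a1 -> (forall x, `|a1 x| <= 1) -> baire b1 -> (forall x, `|b1 x| <= 1) ->
  baire a2 -> (forall x, `|a2 x| <= 1) -> baire b2 -> (forall x, `|b2 x| <= 1) ->
  (forall x y, a1 x * (b1 y * g (x - y)) != 0 -> box n%:R y) ->
  (forall x y, a2 x * (b2 y * g (x - y)) != 0 -> box n%:R y) ->
  (forall x y, idx 1 y \notin D -> a1 x * (b1 y * g (x - y)) = a2 x * (b2 y * g (x - y))) ->
  `|J phi s t a1 b1 g - J phi s t a2 b2 g| <=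
    2%:R * K * \sum_(k <- D) V r.+2 (tau k phi) ^+ 2.
Proof.
move=> ba1 a11 bb1 b11 ba2 a21 bb2 b21 H1 H2 H.
rewrite (@J_sum phi s t a1 b1 n) // (@J_sum phi s t a2 b2 n) //.
rewrite -sumrB (big_fsetID _ (mem D)) /= [X in _ + X](_ : _ = 0) ?addr0; last first.
  rewrite big_seq big1 // => k; rewrite !inE /= => /andP[_ kD]; apply/eqP; rewrite subr_eq0; apply/eqP.
  apply: eq_sint => x.
  have [L1 bL1] := piece_supp b1 k; have [L2 bL2] := piece_supp b2 k.
  have nn1 := inner_nice x (piece_baire k bb1) bL1.
  have nn2 := inner_nice x (piece_baire k bb2) bL2.
  rewrite -(sintZ _ _ _ nn1) -(sintZ _ _ _ nn2).
  apply: eq_sint => y; rewrite /cellf; case: eqP => [yk|_]; last by rewrite !mulr0 !mul0r !mulr0.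
  by rewrite !mulr1; apply: H; rewrite yk.
apply: le_trans (ler_norm_sum _ _ _) _.
have V2 k : 0 <= V r.+2 (tau k phi) ^+ 2 by exact: sqr_ge0.
rewrite mulr_sumr.
apply: (@le_trans _ _ (\sum_(k <- [fset x in Box d n.+1 | x \in D]%fset) 2%:R * K * V r.+2 (tau k phi) ^+ 2)).
  apply: ler_sum => k _; apply: le_trans (ler_normB _ _) _.
  rewrite -mulrA [2%:R * _]mulr_natl mulr2n; apply: lerD; exact: piece_bound.
apply: fsum_le_sub => [|k]; last by apply: mulr_ge0 => //; exact: mulr_ge0.
by apply/fsubsetP => k; rewrite !inE => /andP[].
Qed.

(** Translation acts on [x] and [y] together and leaves [x - y] unchanged, so only the cell
    moves. *)
Lemma J_trM phi s t u k : J (trM u phi) s t (fun=> 1) (cellf 1 k) g =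
  J phi s t (fun=> 1) (fun y => cellf 1 k (y + u)) g.
Proof.
have b1 : baire (fun _ : 'rV[R]_d => 1 : R) by exact: baire_cst.
have n1 : forall x : 'rV[R]_d, `|1 : R| <= 1 by move=> x; rewrite normr1.
have E c : (fun y => 1 * cellf 1 c y) = @cellf R d 1 c by apply/funext => y; rewrite mul1r.
have on := @outer_nice (trM u phi) t (fun=> 1) (fun=> 1) k b1 b1 n1.
rewrite /J sint_trM; last first.
  by move: on; congr nice; apply/funext => x; congr (_ * sint _ _ _); apply/funext => y; rewrite mul1r.
apply: eq_sint => x; congr (_ * _).
have [L hL] := supp_cell1 k.
rewrite sint_trM; last by apply: inner_nice hL; exact: baire_cellf.
by apply: eq_sint => y; congr (_ * g _); rewrite opprD addrACA subrr addr0.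
Qed.

Lemma idx_shift k y : @idx R d 1 (y - toR R k) = idx 1 y - k.
Proof.
apply/rowP => i; rewrite !mxE !mul1r floorDrz ?rpredN ?intr_int //.
by rewrite -intrN intrKfloor.
Qed.

Definition Y s t phi : R := J phi s t (fun=> 1) (cellf 1 0) g.

Lemma Y_tau s t phi k : Y s t (tau k phi) = J phi s t (fun=> 1) (cellf 1 k) g.
Proof.
have E : (fun y => cellf 1 0 (y - toR R k)) = @cellf R d 1 k.
  by apply/funext => y; rewrite /cellf idx_shift subr_eq0.
by rewrite -E; exact: (J_trM phi s t (- toR R k) 0).
Qed.

Lemma Y_bound s t phi : `|Y s t phi| <= K * V r.+2 phi ^+ 2.
Proof.
have t0 : tau 0 phi = phi.
  by rewrite /tau (_ : toR R 0 = 0) ?oppr0 ?trM0 //; apply/rowP => i; rewrite !mxE.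
have b1 : baire (fun _ : 'rV[R]_d => 1 : R) by exact: baire_cst.
have n1 : forall x : 'rV[R]_d, `|1 : R| <= 1 by move=> x; rewrite normr1.
have := @piece_bound phi s t (fun=> 1) (fun=> 1) 0 b1 n1 b1 n1.
by rewrite t0 /Y (_ : (fun y => 1 * _) = cellf 1 0) //; apply/funext => y; rewrite mul1r.
Qed.

Definition inF (F : {fset Zd}) y : R := (idx 1 y \in F)%:R.

Lemma inF_sum F y : inF F y = \sum_(k <- F) cellf 1 k y.
Proof.
rewrite /inF; have [yF|yF] := boolP (_ \in _).
  rewrite (big_fsetD1 _ yF) /= /cellf eqxx big_seq big1 ?addr0 // => k.
  by rewrite !inE => /andP[ky _]; rewrite eq_sym (negbTE ky).
rewrite big_seq big1 // => k kF; rewrite /cellf; case: eqP => // yk.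
by move: yF; rewrite yk kF.
Qed.

Lemma baire_inF F : baire (inF F).
Proof.
rewrite (_ : inF F = fun y => \sum_(k <- F) cellf 1 k y); last by apply/funext => y; exact: inF_sum.
by apply: baire_sum => k; exact: baire_cellf.
Qed.

Lemma inF_le1 F y : `|inF F y| <= 1.
Proof. by rewrite /inF; case: (_ \in _); rewrite ?normr1 ?normr0. Qed.

Lemma J_inF phi s t (F : {fset Zd}) :
  \sum_(k <- F) J phi s t (fun=> 1) (cellf 1 k) g = J phi s t (fun=> 1) (inF F) g.
Proof.
have b1 : baire (fun _ : 'rV[R]_d => 1 : R) by exact: baire_cst.
have n1 : forall x : 'rV[R]_d, `|1 : R| <= 1 by move=> x; rewrite normr1.
have E c : (fun y => 1 * cellf 1 c y) = @cellf R d 1 c by apply/funext => y; rewrite mul1r.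
rewrite /J -sint_sum; last first.
  move=> k; have := @outer_nice phi t (fun=> 1) (fun=> 1) k b1 b1 n1.
  by congr nice; apply/funext => x; congr (_ * sint _ _ _); apply/funext => y; rewrite mul1r.
apply: eq_sint => x; rewrite -mulr_sumr; congr (_ * _); rewrite -sint_sum; last first.
  by move=> k; have [L hL] := supp_cell1 k; apply: inner_nice hL; exact: baire_cellf.
by apply: eq_sint => y; rewrite -mulr_suml inF_sum.
Qed.

Lemma J_inF_trM phi s t (F : {fset Zd}) u :
  \sum_(k <- F) J (trM u phi) s t (fun=> 1) (cellf 1 k) g =
  J phi s t (fun=> 1) (fun y => inF F (y + u)) g.
Proof.
under eq_bigr do rewrite J_trM.
have b1 : baire (fun _ : 'rV[R]_d => 1 : R) by exact: baire_cst.
rewrite /J -sint_sum; last first.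
  move=> k; have [L hL] := supp_cell1 k.
  have := nice_tr u (@outer_nice (trM u phi) t (fun=> 1) (fun=> 1) k b1 b1 (fun x => _)).
  move=> /(_ (fun x => ltac:(by rewrite normr1))).
  congr nice; apply/funext => x; congr (_ * _).
  rewrite sint_trM; last by apply: (@inner_nice _ L) => //; [apply: piece_baire|move=> y; rewrite mul1r => /hL].
  by apply: eq_sint => y; rewrite mul1r; congr (_ * g _); rewrite opprD addrACA subrr addr0.
apply: eq_sint => x; rewrite -mulr_sumr; congr (_ * _); rewrite -sint_sum; last first.
  by move=> k; apply: inner_nice'; apply: baire_tr; exact: baire_cellf.
by apply: eq_sint => y; rewrite -mulr_suml inF_sum.
Qed.

End kernels.

(** * Real balls against lattice balls *)

Section balls.
Context (R : realType) (d : nat).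
Local Notation Zd := 'rV[int]_d.
Implicit Types (x y u : 'rV[R]_d) (k j : Zd) (n c : nat) (phi : M R d).

Definition ballf n x : R := (sqnorm x < n%:R ^+ 2)%R%:R.

Lemma sqnorm_cont : continuous (@sqnorm R d).
Proof.
rewrite /sqnorm; elim: (index_enum 'I_d) => [|i t IH].
  by under eq_fun do rewrite big_nil; exact: contC.
under eq_fun do rewrite big_cons.
by apply: contD => //; apply: contM; exact: coord_cont.
Qed.

Lemma baire_ballf n : baire (ballf n).
Proof. by apply: baire_lt; exact: sqnorm_cont. Qed.

Lemma ballf_le1 n x : `|ballf n x| <= 1.
Proof. by rewrite /ballf; case: (_ < _); rewrite ?normr1 ?normr0. Qed.

Lemma ballf_box n x : ballf n x != 0 -> box n%:R x.
Proof.
rewrite /ballf pnatr_eq0 eqb0 negbK => h.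
by have := @eball_box R d n%:R x h; rewrite ger0_norm.
Qed.

Lemma sqnorm_toR k : sqnorm (toR R k) = (sqZ k)%:~R.
Proof. by rewrite /sqnorm /sqZ rmorph_sum /=; apply: eq_bigr => i _; rewrite mxE rmorphXn. Qed.

Lemma sqnorm_le x y : (forall i, `|x ord0 i| <= `|y ord0 i|) -> sqnorm x <= sqnorm y.
Proof.
move=> xy; apply: ler_sum => i _.
by rewrite -[x ord0 i ^+ 2]real_normK ?num_real // -[y ord0 i ^+ 2]real_normK ?num_real // lerXn2r ?nnegrE.
Qed.

Lemma mem_ballZ_R n k : (k \in ballZ d n) = (sqnorm (toR R k) < n%:R ^+ 2).
Proof.
rewrite mem_ballZ sqnorm_toR (_ : n%:R ^+ 2 = (n%:Z ^+ 2)%:~R :> R) ?ltr_int //.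
by rewrite rmorphXn.
Qed.

(* move to the corner of [k + [-c,c]^d] that is farthest from the origin *)
Lemma ball_inside n c k x : (forall j, j \in Box d c -> k + j \in ballZ d n) ->
  (forall i, `|x ord0 i - (k ord0 i)%:~R| <= c%:R) -> sqnorm x < n%:R ^+ 2.
Proof.
move=> kc xk.
pose j : Zd := \row_i (if (0 <= k ord0 i)%R then c%:Z else - c%:Z).
have jc : j \in Box d c by apply/BoxP => i; rewrite mxE; case: ifP => _; lia.
have := kc j jc; rewrite mem_ballZ_R; apply: le_lt_trans; apply: sqnorm_le => i.
have := xk i; rewrite !mxE intrD; case: ifPn => k0; rewrite ler_norml => /andP[h1 h2].
  have k0' : 0 <= (k ord0 i)%:~R :> R by rewrite ler0z.
  have c0 : 0 <= c%:R :> R by [].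
  rewrite -pmulrn [leRHS]ger0_norm ?addr_ge0 // ler_norml; lra.
have k0' : (k ord0 i)%:~R <= 0 :> R by rewrite lerz0 ltW // ltNge.
have c0 : 0 <= c%:R :> R by [].
by rewrite intrN -pmulrn [leRHS]ler0_norm ?ler_norml; lra.
Qed.

(* round towards the origin *)
Lemma ball_outside n x : sqnorm x < n%:R ^+ 2 ->
  exists2 j : Zd, j \in ballZ d n & forall i, `|(j ord0 i)%:~R - x ord0 i| <= 1.
Proof.
move=> xn; pose j : Zd := \row_i (if 0 <= x ord0 i then Num.floor (x ord0 i) else - Num.floor (- x ord0 i)).
have jx i : `|(j ord0 i)%:~R - x ord0 i| <= 1 /\ `|(j ord0 i)%:~R| <= `|x ord0 i|.
  rewrite mxE; case: ifPn => x0.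
    have := floor_le_tmp (x ord0 i); have := floorD1_gt (x ord0 i); rewrite intrD => h1 h2.
    have f0 : 0 <= (Num.floor (x ord0 i))%:~R :> R by rewrite ler0z floor_ge0.
    by split; [rewrite ler_norml; apply/andP; split; lra | rewrite !ger0_norm].
  move: x0; rewrite -ltNge => x0; have x0' : 0 <= - x ord0 i by lra.
  have := floor_le_tmp (- x ord0 i); have := floorD1_gt (- x ord0 i); rewrite intrD => h1 h2.
  have f0 : 0 <= (Num.floor (- x ord0 i))%:~R :> R by rewrite ler0z floor_ge0.
  by rewrite intrN; split; [rewrite ler_norml; apply/andP; split; lra | rewrite normrN ger0_norm // ltr0_norm].
exists j => [|i]; last by case: (jx i).
rewrite mem_ballZ_R; apply: le_lt_trans xn; apply: sqnorm_le => i.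
by rewrite mxE; case: (jx i).
Qed.

Lemma not_bdry n c k : k \notin bdry d c n ->
  (forall j, j \in Box d c -> k + j \in ballZ d n) \/ (forall j, j \in Box d c -> k + j \notin ballZ d n).
Proof.
move=> kb; have [[j0 j0c j0B]|nj] := pselect (exists2 j, j \in Box d c & k + j \notin ballZ d n).
  right => j jc; apply/negP => jB; case/negP: kb; apply/bdryP.
  by split; [exists j | exists j0].
by left => j jc; apply/negPn/negP => jB; apply: nj; exists j.
Qed.

Lemma Box0 c : (0 : Zd) \in Box d c.
Proof. by apply/BoxP => i; rewrite mxE. Qed.

Lemma idx1_near y i : `|y ord0 i - (idx 1 y ord0 i)%:~R| <= 1.
Proof. by have := corner_dist y i (ltn0Sn 0); rewrite mxE divr1 invr1. Qed.

Lemma near_Box k j (e : R) c : (forall i, `|(j ord0 i)%:~R - (k ord0 i)%:~R| <= e) -> e <= c%:R ->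
  j - k \in Box d c.
Proof.
move=> h ec; apply/BoxP => i; have := h i; rewrite -intrB !mxE => h1.
rewrite -lez_nat abszE -(@ler_int R) intr_norm; apply: le_trans h1 ec.
Qed.

Variables (g : 'rV[R]_d -> R) (r : nat) (K : R).
Hypotheses (cg : continuous g) (gr : supp_in r%:R g) (gK : forall x, `|g x| <= K) (K0 : 0 <= K).

Lemma baire1 : baire (fun _ : 'rV[R]_d => 1 : R).
Proof. exact: baire_cst. Qed.

Lemma norm1_le (x : 'rV[R]_d) : `|1 : R| <= 1.
Proof. by rewrite normr1. Qed.

Lemma sum_Y_tau s t phi (F : {fset Zd}) :
  \sum_(k <- F) Y g s t (tau k phi) = J phi s t (fun=> 1) (@inF R d F) g.
Proof.
rewrite -(@J_inF R d g r K) //; apply: eq_bigr => k _; exact: (Y_tau cg gr gK K0).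
Qed.

(** The layer has width [r + 2]: the index of the cell of [y] is within 1 of [y], [y] is within [r]
    of [x], and rounding [x] towards the origin moves it by at most 1. Outside the layer all weights
    are 1 or both products vanish. A general [b] covers the restricted and the unrestricted second
    factor. *)
Lemma N_compare s t phi n (b : 'rV[R]_d -> R) : baire b -> (forall x, `|b x| <= 1) ->
  (forall x, ballf n x = 1 -> b x = 1) ->
  `|J phi s t (ballf n) b g - \sum_(k <- ballZ d n) Y g s t (tau k phi)| <=
    2%:R * K * \sum_(k <- bdry d (r + 2) n) V r.+2 (tau k phi) ^+ 2.
Proof.
move=> bb b1 hb; rewrite sum_Y_tau.
apply: (@J_compare R d g r K cg gr gK K0 phi s t _ _ _ _ (n + r + 1)) => //.
- exact: baire_ballf.
- exact: ballf_le1.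
- exact: baire1.
- exact: norm1_le.
- exact: baire_inF.
- exact: inF_le1.
- move=> x y; rewrite !mulf_eq0 !negb_or => /and3P[/ballf_box xn _ /gr xy] i.
  have := xn i; have := xy i; rewrite !mxE !natrD => h1 h2.
  have := ler_normB (x ord0 i) (x ord0 i - y ord0 i).
  by rewrite opprB addrCA subrr addr0; lra.
- move=> x y; rewrite mul1r mulf_eq0 negb_or => /andP[+ _] i.
  rewrite /inF pnatr_eq0 eqb0 negbK => /(fsubsetP (@ballZ_Box d n)) /BoxP /(_ i) h.
  have := idx1_near y i; have : `|(idx 1 y ord0 i)%:~R| <= n%:R :> R.
    by rewrite -intr_norm -[leRHS]/((n%:Z)%:~R) ler_int -abszE lez_nat.
  have := ler_normD (y ord0 i - (idx 1 y ord0 i)%:~R) ((idx 1 y ord0 i)%:~R).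
  rewrite subrK !natrD; have : 0 <= r%:R :> R by [].
  lra.
move=> x y /not_bdry; have [->|gxy] := eqVneq (g (x - y)) 0; first by rewrite !mulr0.
have xy i : `|x ord0 i - y ord0 i| <= r%:R by have := gr gxy i; rewrite !mxE.
have xk i : `|x ord0 i - (idx 1 y ord0 i)%:~R| <= r%:R + 1.
  have := ler_normD (x ord0 i - y ord0 i) (y ord0 i - (idx 1 y ord0 i)%:~R).
  by rewrite addrA subrK; have := xy i; have := idx1_near y i; lra.
move=> [hin|hout].
  have bx : ballf n x = 1.
    rewrite /ballf (ball_inside hin) // => i; apply: le_trans (xk i) _.
    by rewrite natrD; lra.
  have by1 : ballf n y = 1.
    rewrite /ballf (ball_inside hin) // => i; apply: le_trans (idx1_near y i) _.
    by rewrite natrD; have : 0 <= r%:R :> R by []; lra.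
  have yF : @inF R d (ballZ d n) y = 1 by rewrite /inF -[idx 1 y]addr0 hin ?Box0.
  by rewrite bx (hb _ by1) yF !mul1r.
have -> : @inF R d (ballZ d n) y = 0.
  by have := hout 0 (Box0 _); rewrite addr0 /inF => /negbTE ->.
rewrite mul0r mulr0.
suff -> : ballf n x = 0 by rewrite mul0r.
apply/eqP/negPn/negP; rewrite /ballf pnatr_eq0 eqb0 negbK => /ball_outside [j jB jx].
have : idx 1 y + (j - idx 1 y) \notin ballZ d n.
  apply: hout; apply: (@near_Box _ _ (r%:R + 2%:R)) => [i|]; last by rewrite natrD.
  have := ler_normD ((j ord0 i)%:~R - x ord0 i) (x ord0 i - (idx 1 y ord0 i)%:~R).
  by rewrite addrA subrK; have := jx i; have := xk i; lra.
by rewrite addrC subrK jB.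
Qed.

(** Translation by [u] replaces the union of cells by a translate. The unions differ only where the
    cell index crosses the boundary of the ball, and it moves by at most [c] for [u] and 1 for each
    of two roundings. *)
Lemma Y_invariant s t phi u n c : (forall i, `|u ord0 i| <= c%:R) ->
  `|\sum_(k <- ballZ d n) Y g s t (tau k (trM u phi)) - \sum_(k <- ballZ d n) Y g s t (tau k phi)| <=
    2%:R * K * \sum_(k <- bdry d (c + 2) n) V r.+2 (tau k phi) ^+ 2.
Proof.
move=> uc; rewrite (sum_Y_tau s t phi).
rewrite (eq_bigr (fun k => J (trM u phi) s t (fun=> 1) (cellf 1 k) g)); last first.
  by move=> k _; exact: (@Y_tau R d g r K cg gr gK K0 s t (trM u phi) k).
rewrite (@J_inF_trM R d g r K) //.
have nearu y i : `|(idx 1 (y + u) ord0 i)%:~R - (idx 1 y ord0 i)%:~R| <= c%:R + 2%:R :> R.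
  have h1 := idx1_near (y + u) i; have h2 := idx1_near y i; have h3 := uc i.
  rewrite [(y + u) ord0 i]mxE in h1; move: h1 h2 h3.
  by rewrite !ler_norml => /andP[? ?] /andP[? ?] /andP[? ?]; apply/andP; split; lra.
apply: (@J_compare R d g r K cg gr gK K0 phi s t _ _ _ _ (n + c + 2)) => //.
- exact: baire1.
- exact: norm1_le.
- by apply: baire_tr; exact: baire_inF.
- by move=> x; exact: inF_le1.
- exact: baire1.
- exact: norm1_le.
- exact: baire_inF.
- exact: inF_le1.
- move=> x y; rewrite mul1r mulf_eq0 negb_or => /andP[+ _] i.
  rewrite /inF pnatr_eq0 eqb0 negbK => /(fsubsetP (@ballZ_Box d n)) /BoxP /(_ i) h.
  have h1 := idx1_near (y + u) i; have h2 : `|(idx 1 (y + u) ord0 i)%:~R| <= n%:R :> R.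
    by rewrite -intr_norm -[leRHS]/((n%:Z)%:~R) ler_int -abszE lez_nat.
  rewrite [(y + u) ord0 i]mxE in h1; move: h1 h2 (uc i); rewrite !natrD.
  by rewrite !ler_norml => /andP[? ?] /andP[? ?] /andP[? ?]; apply/andP; split; lra.
- move=> x y; rewrite mul1r mulf_eq0 negb_or => /andP[+ _] i.
  rewrite /inF pnatr_eq0 eqb0 negbK => /(fsubsetP (@ballZ_Box d n)) /BoxP /(_ i) h.
  have h1 := idx1_near y i; have h2 : `|(idx 1 y ord0 i)%:~R| <= n%:R :> R.
    by rewrite -intr_norm -[leRHS]/((n%:Z)%:~R) ler_int -abszE lez_nat.
  have c0 : 0 <= c%:R :> R by []; move: h1 h2 c0; rewrite !natrD.
  by rewrite !ler_norml => /andP[? ?] /andP[? ?] ?; apply/andP; split; lra.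
move=> x y /not_bdry h; rewrite !mul1r; congr (_ * _); rewrite /inF.
have jc : idx 1 (y + u) - idx 1 y \in Box d (c + 2).
  by apply: (@near_Box _ _ (c%:R + 2%:R)) => [i|]; [exact: nearu|rewrite natrD].
case: h => h; have h1 := h _ jc; have h0 := h 0 (Box0 _); rewrite addrC subrK in h1; rewrite addr0 in h0.
  by rewrite h1 h0.
by rewrite (negbTE h1) (negbTE h0).
Qed.

End balls.

(** * Volume of balls by counting cells *)

Section lebesgue.
Context (R : realType) (d : nat) (lam : {measure set (BRd R d) -> \bar R}).
Hypothesis Hlam : is_lebesgue lam.

Lemma lam_cell k : lam (cell 1 k) = 1%E.
Proof.
pose b : 'rV[R]_d := \row_i ((k ord0 i)%:~R + 1).
have -> : cell 1 k = [set x : BRd R d | forall i, toR R k ord0 i <= (x : 'rV[R]_d) ord0 i < b ord0 i].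
  apply/seteqP; split => x; rewrite /cell /=.
    by move=> xk i; have := idx_bounds x i (ltn0Sn 0); rewrite xk !mxE !divr1 invr1.
  move=> h; apply/rowP => i; rewrite mxE mul1r; apply: floor_def.
  by have := h i; rewrite !mxE intrD.
rewrite Hlam; last by move=> i; rewrite !mxE lerDl.
by rewrite big1 // => i _; rewrite !mxE addrAC subrr add0r.
Qed.

Lemma L1_cellf k : L1 lam (@cellf R d 1 k).
Proof.
rewrite cellf_indic; apply/integrableP; split.
  by apply/measurable_EFinP; apply: measurable_indic; exact: meas_cell.
rewrite (eq_integral (fun x : BRd R d => (\1_(cell 1 k) x)%:E)); last by move=> t _; rewrite gee0_abs // lee_fin.
by rewrite integral_indic ?setIT ?lam_cell ?ltry //; exact: meas_cell.
Qed.

Lemma Rint_cellf k : Rint lam (@cellf R d 1 k) = 1.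
Proof. by rewrite cellf_indic /Rint integral_indic ?setIT ?lam_cell //; exact: meas_cell. Qed.

Lemma L1_inF F : L1 lam (@inF R d F).
Proof.
rewrite (_ : @inF R d F = fun y => \sum_(k <- F) cellf 1 k y); last by apply/funext => y; exact: inF_sum.
by apply: L1_sum => k; exact: L1_cellf.
Qed.

Lemma Rint_inF F : Rint lam (@inF R d F) = #|` F|%:R.
Proof.
rewrite (_ : @inF R d F = fun y => \sum_(k <- F) cellf 1 k y); last by apply/funext => y; exact: inF_sum.
rewrite Rint_sum; last by move=> k; exact: L1_cellf.
by rewrite -[RHS]mul1r -fsum_const; apply: eq_bigr => k _; exact: Rint_cellf.
Qed.

(** Up to the boundary layer, the ball is the union of the unit cells indexed by the lattice ball.
    The width 2 adds the distance of a point to its cell corner and the error of rounding it. *)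
Lemma lam_ball n : `|fine (lam (eball0 d n%:R)) - #|` ballZ d n|%:R| <= #|` bdry d 2 n|%:R.
Proof.
set F := ballZ d n; set D := bdry d 2 n.
have bE x : ballf n x = \1_(eball0 d n%:R) x :> R.
  rewrite indicE /ballf; congr ((_ : bool)%:R).
  by apply/idP/idP => [h|/set_mem//]; apply/mem_set.
have mB : measurable (eball0 d n%:R : set (BRd R d)).
  have := baire_bmeas (@baire_ballf R d n) measurableT (measurable_set1 (1 : R)).
  rewrite setTI; congr measurable; apply/seteqP; split => x; rewrite /preimage /= /ballf /eball0 /=.
    by case: (_ < _) => // /esym/eqP; rewrite oner_eq0.
  by move=> ->.
have pw x : @inF R d F x - @inF R d D x <= ballf n x <= @inF R d F x + @inF R d D x.
  rewrite /inF; have [xD|xD] := boolP (idx 1 x \in D).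
    by rewrite /ballf; case: (_ \in F); case: (_ < _) => /=; lra.
  have [hin|hout] := not_bdry xD.
    have -> : idx 1 x \in F by rewrite -[idx 1 x]addr0 hin ?Box0.
    rewrite /ballf (ball_inside hin) ?subr0 ?addr0 ?lexx // => i.
    by apply: le_trans (idx1_near x i) _; rewrite ler1n.
  have -> : (idx 1 x \in F) = false by have := hout 0 (Box0 _ _); rewrite addr0 => /negbTE.
  suff -> : ballf n x = 0 by rewrite subr0 addr0 lexx.
  apply/eqP/negPn/negP; rewrite /ballf pnatr_eq0 eqb0 negbK => /ball_outside [j jB jx].
  have : idx 1 x + (j - idx 1 x) \notin F.
    apply: hout; apply: (@near_Box _ _ _ _ (1 + 1)) => [i|]; last by rewrite -natr1.
    have := ler_normD ((j ord0 i)%:~R - x ord0 i) (x ord0 i - (idx 1 x ord0 i)%:~R).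
    by rewrite addrA subrK; have := jx i; have := idx1_near x i; lra.
  by rewrite addrC subrK jB.
have Lb : L1 lam (ballf n).
  have mb : measurable_fun setT (ballf n : BRd R d -> R) by exact: baire_bmeas (@baire_ballf R d n).
  have le x : `|ballf n x| <= @inF R d F x + @inF R d D x.
    by rewrite ger0_norm; [case/andP: (pw x)|rewrite /ballf].
  exact: (le_L1 mb le (L1D (L1_inF F) (L1_inF D))).
have -> : fine (lam (eball0 d n%:R)) = Rint lam (ballf n).
  have bE' : ballf n = (\1_(eball0 d n%:R) : 'rV[R]_d -> R) by apply/funext => x; exact: bE.
  by rewrite bE' /Rint integral_indic ?setIT.
have h1 : Rint lam (ballf n) <= #|` F|%:R + #|` D|%:R.
  rewrite -!Rint_inF -RintD; try exact: L1_inF.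
  apply: le_Rint => //; first by apply: L1D; exact: L1_inF.
  by move=> x; case/andP: (pw x).
have h2 : #|` F|%:R - #|` D|%:R <= Rint lam (ballf n).
  rewrite -!Rint_inF -RintB; try exact: L1_inF.
  apply: le_Rint => //; first by apply: L1B; exact: L1_inF.
  by move=> x; case/andP: (pw x).
by rewrite ler_norml; apply/andP; split; lra.
Qed.

End lebesgue.

(** * Square integrability of the local variation *)

(** Monotonicity straight from the supremum over simple functions below. It is applied to the
    integrand of [loc_sq_integrable], a supremum over uncountably many partitions whose
    measurability is not established. *)
Lemma ge0_le_integral_all (R : realType) dT (T : measurableType dT) (m : {measure set T -> \bar R})
  (f g : T -> \bar R) : (forall x, 0 <= f x)%E -> (forall x, f x <= g x)%E ->
  (\int[m]_x f x <= \int[m]_x g x)%E.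
Proof.
move=> f0 fg; have g0 x : (0 <= g x)%E by exact: le_trans (f0 x) (fg x).
rewrite !ge0_integralTE //; apply: le_ereal_sup => _ [h hf <-]; exists h => // x.
exact: le_trans (hf x) (fg x).
Qed.

Section total_variation.
Context (R : realType) (d : nat).
Local Notation Zd := 'rV[int]_d.
Implicit Types (phi : M R d) (s t : bool) (r : nat).

Lemma totvar_cells (nu : set (BRd R d) -> R) N (F : {fset Zd}) (A : set (BRd R d)) :
  measurable A -> (forall k, k \in F -> cell N k `<=` A) ->
  ((\sum_(k <- F) `|nu (cell N k)|)%:E <= totvar nu A)%E.
Proof.
move=> mA FA; set l := enum_fset F; set m := size l.
have ul : uniq l by exact: fset_uniq.
(* The index equals [m] exactly when the cell is not in [F]; this last class, the rest of [A],
   completes the cells to a partition. *)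
pose G (i : 'I_m.+1) : set (BRd R d) := A `&` [set x | index (idx N x) l = i].
have Glt (i : 'I_m.+1) : (i < m)%N -> G i = cell N (nth 0 l i).
  move=> im; apply/seteqP; split => x; rewrite /G /cell /=.
    by move=> [_ xi]; rewrite -xi nth_index // -index_mem xi.
  move=> xi; split; last by rewrite xi index_uniq.
  by apply: (FA (nth 0 l i)) => //; exact: mem_nth.
apply: (@le_trans _ _ (\sum_(i < m.+1) `|nu (G i)|)%:E); last first.
  apply: ereal_sup_ubound; exists m.+1, G; split => //.
  - move=> i; have [im|im] := ltnP i m; first by rewrite Glt //; exact: meas_cell.
    rewrite (_ : G i = A `\` \bigcup_(k in [set` F]) cell N k).
      apply: measurableD => //; apply: fin_bigcup_measurable; first exact: finite_fset.
      by move=> k _; exact: meas_cell.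
    have iE : nat_of_ord i = m by have := ltn_ord i; lia.
    apply/seteqP; split => x; rewrite /G /=.
      move=> [xA xi]; split => // -[k /= kF xk]; move: xi; rewrite xk iE => h.
      by have := index_mem k l; rewrite h ltnn -[k \in l]/(k \in F) kF.
    move=> [xA nx]; split => //; rewrite iE; apply/eqP; rewrite eqn_leq index_size /= leqNgt index_mem.
    by apply/negP => h; apply: nx; exists (idx N x).
  - move=> i j _ _ [x [[_ /= xi] [_ /= xj]]]; apply/val_inj; by rewrite /= -xi -xj.
  - apply/seteqP; split => x; first by move=> [i _ []].
    move=> xA; have h : (index (idx N x) l < m.+1)%N by rewrite ltnS index_size.
    by exists (Ordinal h).
rewrite lee_fin big_ord_recr /= (big_nth 0) big_mkord; apply: ler_wpDr => //.
rewrite le_eqVlt; apply/orP; left; apply/eqP; apply: eq_bigr => i _.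
by rewrite Glt //=.
Qed.

Lemma cell_box N r k : (0 < N)%N -> k \in Box d (N * r) -> cell N k `<=` (box (r%:R + 1) : set 'rV[R]_d).
Proof.
move=> N0 kB x xk; apply: (supp_cellf N0 kB); by rewrite /cellf xk eqxx oner_eq0.
Qed.

(** Riemann sums of a function bounded by 1 are at most the variation over the cells used, all
    contained in the cube enlarged by 1. *)
Lemma sint_le_totvar r phi s g : continuous g -> supp_in r%:R g -> (forall x, `|g x| <= 1) ->
  (`|sint phi s g|%:E <= totvar (sset phi s) (box (r%:R + 1)))%E.
Proof.
move=> cg gr g1.
have lim := @riemann R d phi s g r 1 gr g1 (fun x => @corner_cvg R d g x cg).
case E : (totvar _ _) => [c||]; last 2 [by rewrite leey] .
- rewrite lee_fin; apply: (cvgr_to_le (cvg_norm lim)); apply: nearW => n.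
  rewrite -lee_fin -E; apply: le_trans (totvar_cells (N := n.+1) (F := Box d (n.+1 * r)) _ _ _); last 2 first.
  + exact: meas_box.
  + by move=> k kB; exact: cell_box.
  rewrite lee_fin; apply: le_trans (ler_norm_sum _ _ _) _; apply: ler_sum => k _.
  by rewrite normrM sint_cell -[X in _ <= X]mul1r ler_wpM2r.
have := @totvar_cells (sset phi s) 1 fset0 _ (@meas_box R d (r%:R + 1)).
by rewrite E big_seq_fset0 => /(_ (fun k (h : k \in fset0) => match notF h with end)).
Qed.

Lemma totvar_ge0 phi s r : (0 <= totvar (sset phi s) (box (r%:R + 1)))%E.
Proof.
have := @totvar_cells (sset phi s) 1 fset0 _ (@meas_box R d (r%:R + 1)).
by rewrite big_seq_fset0; apply => k; rewrite inE.
Qed.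

Lemma V_sqr_totvar r phi :
  ((V r phi ^+ 2)%:E <= totvar (cm_re phi) (box (r%:R + 1)%R) * totvar (cm_re phi) (box (r%:R + 1)%R)
    + totvar (cm_im phi) (box (r%:R + 1)%R) * totvar (cm_im phi) (box (r%:R + 1)%R))%E.
Proof.
rewrite -[cm_re phi]/(sset phi false) -[cm_im phi]/(sset phi true).
have h0 := @sint_le_totvar r phi false; have h1 := @sint_le_totvar r phi true.
have p0 := totvar_ge0 phi false r; have p1 := totvar_ge0 phi true r.
move: h0 h1 p0 p1; case: (totvar (sset phi false) _) => [a||] // h0;
  case: (totvar (sset phi true) _) => [b||] // h1 p0 p1; try by rewrite ?mulyy ?addye ?addey ?leey.
rewrite -!EFinM -EFinD lee_fin; rewrite !lee_fin in p0 p1.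
have Vab : V r phi <= Num.max a b.
  apply: V_le => s g cg gr g1; rewrite le_max -!lee_fin; case: s.
    by rewrite h1 ?orbT.
  by rewrite h0.
have V0 := V_ge0 r phi; rewrite expr2.
by move: Vab; rewrite le_max => /orP[h|h]; nra.
Qed.

End total_variation.

Section second_moment.
Context (R : realType) (d : nat).
Context (dO : measure_display) (O : measurableType dO) (P : probability O R) (Phi : O -> M R d).
Hypothesis HPhi : random_measure Phi.
Hypothesis Hsq : loc_sq_integrable P Phi.

Local Notation Q := (law P HPhi).

Lemma meas_V_sqr r : measurable_fun setT (fun phi : VM R d => V r phi ^+ 2).
Proof. by apply: measurable_funX; exact: meas_V. Qed.

Lemma integral_law (f : VM R d -> \bar R) : measurable_fun setT f -> (forall x, 0 <= f x)%E ->
  (\int[Q]_x f x = \int[P]_w f (Phi w))%E.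
Proof.
move=> mf f0.
by have := @ge0_integral_pushforward _ _ _ _ _ _ (meas_Phi HPhi) P _ _ measurableT mf (fun x _ => f0 x).
Qed.

Lemma L1_law (f : VM R d -> R) : L1 Q f -> L1 P (fun w => f (Phi w)).
Proof.
move=> Lf; have mf := L1_meas Lf; apply/integrableP; split.
  by apply/measurable_EFinP; apply: (measurableT_comp mf); exact: meas_Phi.
rewrite -(integral_law (f := fun x => `|(f x)%:E|%E)) //; first by case/integrableP : Lf.
by apply: measurableT_comp => //; exact/measurable_EFinP.
Qed.

Lemma Rint_law (f : VM R d -> R) : L1 Q f -> Rint Q f = Rint P (fun w => f (Phi w)).
Proof.
move=> Lf; have mf := L1_meas Lf; rewrite /Rint; congr fine.
by have := integral_pushforward (meas_Phi HPhi) (proj2 (measurable_EFinP _ _) mf) (L1_law Lf) measurableT.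
Qed.

(** Square integrability enters the proof here; later integrands are dominated by multiples of the
    square of [V]. *)
Lemma L1_V_sqr r : L1 Q (fun phi => V r phi ^+ 2).
Proof.
have m := meas_V_sqr r; apply/integrableP; split; first exact/measurable_EFinP.
rewrite (integral_law (f := fun x => `|(V r x ^+ 2)%:E|%E)) //; last first.
  by apply: measurableT_comp => //; exact/measurable_EFinP.
have := Hsq (@meas_box R d (r%:R + 1)) (@bdd_box R d (r%:R + 1)); apply: le_lt_trans.
apply: ge0_le_integral_all => // w.
rewrite gee0_abs ?lee_fin ?sqr_ge0 //; exact: V_sqr_totvar.
Qed.

End second_moment.

(** * The reduced second moment measure as an expectation *)

Section step.
Context (R : realType) (d : nat).
Local Notation Zd := 'rV[int]_d.
Implicit Types (u : Zd -> R).

Lemma baire_step u N L : (0 < N)%N -> (forall k, k \notin Box d L -> u k = 0) ->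
  baire (fun x : 'rV[R]_d => u (idx N x)).
Proof.
move=> N0 u0; rewrite (_ : (fun x => _) = (fun x => \sum_(k <- Box d L) u k * cellf N k x)).
  by apply: baire_sum => k; apply: baireZ; exact: baire_cellf.
by apply/funext => x; exact: step_sum.
Qed.

Lemma supp_idx u N n : (0 < N)%N -> (forall k, k \notin Box d (N * n) -> u k = 0) ->
  supp_in n.+1%:R (fun x : 'rV[R]_d => u (idx N x)).
Proof.
move=> N0 u0 x ux; rewrite -natr1; apply: (supp_cellf (k := idx N x) N0).
  by apply: contraNT ux => /u0 ->.
by rewrite /cellf eqxx oner_eq0.
Qed.

Lemma coordB (x y : 'rV[R]_d) i : (x - y) ord0 i = x ord0 i - y ord0 i.
Proof. by rewrite !mxE. Qed.

Lemma corner_Box r N k : (0 < N)%N -> k \notin Box d (N * r) -> ~ box r%:R (corner R N k).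
Proof.
move=> N0 /negP kB h; apply: kB; apply/BoxP => i.
have N0' : 0 < N%:R :> R by rewrite ltr0n.
have := h i; rewrite mxE normrM normfV (ger0_norm (ltW N0')) ler_pdivrMr // -intr_norm.
by rewrite -natrM mulnC -[X in _ <= X]/(((N * r)%N%:Z)%:~R) ler_int -abszE lez_nat.
Qed.

End step.

(** * Double Riemann sums *)

Section double_sums.
Context (R : realType) (d : nat).
Local Notation Zd := 'rV[int]_d.
Variables (g b : 'rV[R]_d -> R) (r n : nat) (K B : R).
Hypotheses (cg : continuous g) (gr : supp_in r%:R g) (gK : forall x, `|g x| <= K) (K0 : 0 <= K).
Hypotheses (bn : supp_in n%:R b) (bB : forall x, `|b x| <= B) (B0 : 0 <= B).
Hypothesis bc : forall y, b (corner R m.+1 (idx m.+1 y)) @[m --> \oo] --> b y.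

Let w m (p q : Zd) : R := b (corner R m q) * g (corner R m p - corner R m q).

Lemma wBK m p q : `|w m p q| <= B * K.
Proof. by rewrite normrM ler_pM. Qed.

Lemma w_q m p q : (0 < m)%N -> q \notin Box d (m * n) -> w m p q = 0.
Proof. by move=> m0 qB; rewrite /w (supp_out bn) ?mul0r //; exact: corner_Box. Qed.

Lemma w_p m p q : (0 < m)%N -> p \notin Box d (m * (n + r)) -> w m p q = 0.
Proof.
move=> m0 pB; rewrite /w; have [->|bq] := eqVneq (b (corner R m q)) 0; first by rewrite mul0r.
have [->|gpq] := eqVneq (g (corner R m p - corner R m q)) 0; first by rewrite mulr0.
exfalso; apply: (corner_Box m0 pB) => i.
have := bn bq i; have := gr gpq i; rewrite coordB natrD.
have := ler_normD (corner R m p ord0 i - corner R m q ord0 i) (corner R m q ord0 i).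
by rewrite subrK; lra.
Qed.

Lemma w_cvg x y : w m.+1 (idx m.+1 x) (idx m.+1 y) @[m --> \oo] --> b y * g (x - y).
Proof.
apply: cvgM; first exact: bc.
move/continuousP_ball : cg => cg'; apply/cvgrPdist_lt => e e0; have [t t0 ht] := cg' (x - y) e e0.
have t2 : 0 < t / 2%:R by rewrite divr_gt0.
have [N _ hN] := near_infty_natSinv_lt (PosNum t2).
exists N => // m /= Nm; apply: ht => i.
have := corner_dist x i (ltn0Sn m); have := corner_dist y i (ltn0Sn m).
have h1 : m.+1%:R^-1 < t / 2%:R := hN m Nm.
rewrite !coordB.
move: (corner R m.+1 (idx m.+1 x)) (corner R m.+1 (idx m.+1 y)) => cx cy h2 h3.
rewrite (_ : x ord0 i - y ord0 i - (cx ord0 i - cy ord0 i) = (x ord0 i - cx ord0 i) - (y ord0 i - cy ord0 i)); last by lra.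
apply: le_lt_trans (ler_normB _ _) _; apply: le_lt_trans (lerD h3 h2) _.
by rewrite [X in _ < X](splitr t) ltrD.
Qed.

(** The double Riemann sum of [b y * g (x - y)]. For each [phi] it tends to the iterated integral,
    while its expectation involves only moments of pairs of cells, which the second moment measure
    determines in the complex combination. *)
Definition S m (phi : M R d) s t : R :=
  \sum_(p <- Box d (m * (n + r))) \sum_(q <- Box d (m * (n + r)))
    w m p q * (sint phi s (cellf m p) * sint phi t (cellf m q)).

Lemma w_q' m p q : (0 < m)%N -> q \notin Box d (m * (n + r)) -> w m p q = 0.
Proof.
move=> m0 qB; apply: w_q => //; apply: contra qB; apply: Box_mono.
by rewrite leq_mul2l leq_addr orbT.
Qed.

Lemma S_sint m phi s t : (0 < m)%N ->
  S m phi s t = sint phi s (fun x => sint phi t (fun y => w m (idx m x) (idx m y))).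
Proof.
move=> m0; rewrite (@sint_step R d phi s (fun p => sint phi t (fun y => w m p (idx m y))) m (m * (n + r)) m0).
  apply: eq_bigr => p _.
  rewrite (@sint_step R d phi t (w m p) m (m * (n + r)) m0) ?mulr_suml; last first.
    by move=> q; exact: w_q'.
  by apply: eq_bigr => q _; rewrite -mulrA [sint phi t _ * _]mulrC.
move=> p pB; rewrite (@eq_sint _ _ _ _ _ (fun=> 0)) ?sint0 // => y; exact: w_p.
Qed.

Lemma S_inner_bound m phi t p : (0 < m)%N ->
  `|sint phi t (fun y => w m p (idx m y))| <= B * K * V n.+2 phi.
Proof.
move=> m0; apply: V_baire; last exact: mulr_ge0.
- by apply: (@baire_step R d _ m (m * n)) => // q; exact: w_q.
- by apply: (@supp_idx R d _ m n) => // q; exact: w_q.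
- by move=> y; exact: wBK.
Qed.

Lemma S_outer_supp m phi t p : (0 < m)%N -> p \notin Box d (m * (n + r)) ->
  sint phi t (fun y => w m p (idx m y)) = 0.
Proof.
by move=> m0 pB; rewrite (@eq_sint _ _ _ _ _ (fun=> 0)) ?sint0 // => y; exact: w_p.
Qed.

Lemma S_bound m phi s t : (0 < m)%N -> `|S m phi s t| <= B * K * V (n + r).+2 phi ^+ 2.
Proof.
move=> m0; rewrite S_sint //.
have V0 k : 0 <= V k phi by exact: V_ge0.
apply: (@le_trans _ _ (B * K * V n.+2 phi * V (n + r).+2 phi)).
  apply: V_baire; last by rewrite !mulr_ge0.
  - apply: (@baire_step R d (fun p => sint phi t (fun y => w m p (idx m y))) m (m * (n + r))) => // p.
    exact: S_outer_supp.
  - apply: (@supp_idx R d (fun p => sint phi t (fun y => w m p (idx m y))) m (n + r)) => // p.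
    exact: S_outer_supp.
  - by move=> x; exact: S_inner_bound.
rewrite -!mulrA ler_wpM2l // ler_wpM2l // expr2 ler_wpM2r //; apply: V_mono.
by rewrite !ltnS leq_addr.
Qed.

Lemma S_cvg phi s t :
  S m.+1 phi s t @[m --> \oo] --> sint phi s (fun x => sint phi t (fun y => b y * g (x - y))).
Proof.
under eq_fun do rewrite S_sint //.
have V0 k : 0 <= V k phi by exact: V_ge0.
apply: (@sint_dct _ _ phi s _ _ (B * K * V n.+2 phi) (n + r).+1%:R).
- move=> m; apply: baire_bmeas.
  apply: (@baire_step R d (fun p => sint phi t (fun y => w m.+1 p (idx m.+1 y))) m.+1 (m.+1 * (n + r))) => // p.
  exact: S_outer_supp.
- by move=> m x; exact: S_inner_bound.
- move=> m; apply: (@supp_idx R d (fun p => sint phi t (fun y => w m.+1 p (idx m.+1 y))) m.+1 (n + r)) => // p.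
  exact: S_outer_supp.
move=> x; apply: (@sint_dct _ _ phi t _ _ (B * K) n.+1%:R).
- move=> m; apply: baire_bmeas.
  by apply: (@baire_step R d _ m.+1 (m.+1 * n)) => // q; exact: w_q.
- by move=> m y; exact: wBK.
- by move=> m; apply: (@supp_idx R d _ m.+1 n) => // q; exact: w_q.
by move=> y; exact: w_cvg.
Qed.

Lemma meas_S m s t : (0 < m)%N -> measurable_fun setT (fun phi : VM R d => S m phi s t).
Proof.
move=> m0; apply: measurable_sum => p; apply: measurable_sum => q.
have mc k s' : measurable_fun setT (fun phi : VM R d => sint phi s' (cellf m k)).
  have [l kl] := Box_ex k; apply: (@meas_sint_baire _ _ l.+1); first exact: baire_cellf.
  by rewrite -natr1; apply: supp_cellf => //; apply: Box_mono kl; rewrite leq_pmull.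
by apply: measurable_funM => //; apply: measurable_funM.
Qed.

Section one_measure.
Variable mu : {measure set (BRd R d * BRd R d)%type -> \bar R}.
Hypothesis mu_fin : forall l, (mu (box l `*` box l) < +oo)%E.

Lemma prod_cell m p q : (fun z : (BRd R d * BRd R d)%type => cellf m p z.1 * cellf m q z.2 : R) =
  \1_(cell m p `*` cell m q).
Proof.
apply/funext => z; rewrite !cellf_indic !indicE -natrM mulnb; congr ((_ : bool)%:R).
by apply/andP/idP => [[/set_mem h1 /set_mem h2]|/set_mem [h1 h2]]; [exact/mem_set|split; exact/mem_set].
Qed.

Lemma meas_w m : (0 < m)%N ->
  measurable_fun setT (fun z : (BRd R d * BRd R d)%type => w m (idx m z.1) (idx m z.2)).
Proof.
move=> m0; rewrite (_ : (fun z => _) = (fun z : (BRd R d * BRd R d)%type =>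
  \sum_(p <- Box d (m * (n + r))) \sum_(q <- Box d (m * (n + r))) w m p q * (cellf m p z.1 * cellf m q z.2))).
  apply: measurable_sum => p; apply: measurable_sum => q; apply: measurable_funM => //.
  rewrite prod_cell; apply: measurable_indic; apply: measurableX; exact: meas_cell.
apply/funext => z.
rewrite (@step_sum _ _ (fun p => w m p (idx m z.2)) m (m * (n + r))); last by move=> p; exact: w_p.
apply: eq_bigr => p _; rewrite (@step_sum _ _ (w m p) m (m * (n + r))); last by move=> q; exact: w_q'.
by rewrite mulr_suml; apply: eq_bigr => q _; rewrite -mulrA [cellf m q _ * _]mulrC.
Qed.

Lemma meas_kernel : measurable_fun setT (fun z : (BRd R d * BRd R d)%type => b z.2 * g (z.1 - z.2)).
Proof.
apply: (@measurable_fun_cvg _ _ R setT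
  (fun m (z : (BRd R d * BRd R d)%type) => w m.+1 (idx m.+1 z.1) (idx m.+1 z.2))).
  by move=> m; exact: meas_w.
by move=> z _; exact: w_cvg.
Qed.

Lemma L1_box2 l : L1 mu (\1_(box l `*` box l)).
Proof.
have mB : measurable (box l `*` box l : set (BRd R d * BRd R d)%type).
  by apply: measurableX; exact: meas_box.
apply/integrableP; split; first by apply/measurable_EFinP; exact: measurable_indic.
rewrite (eq_integral (fun x : (BRd R d * BRd R d)%type => (\1_(box l `*` box l) x)%:E)).
  by rewrite integral_indic ?setIT.
by move=> t _; rewrite gee0_abs // lee_fin.
Qed.

Lemma mu_riemann :
  \sum_(p <- Box d (m.+1 * (n + r))) \sum_(q <- Box d (m.+1 * (n + r)))
    w m.+1 p q * fine (mu (cell m.+1 p `*` cell m.+1 q)) @[m --> \oo] -->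
  Rint mu (fun z => b z.2 * g (z.1 - z.2)).
Proof.
have mC m p q : measurable (cell m p `*` cell m q : set (BRd R d * BRd R d)%type).
  by apply: measurableX; exact: meas_cell.
have Lc m p q : (0 < m)%N -> L1 mu (fun z => cellf m p z.1 * cellf m q z.2).
  move=> m0; have [lp hp] := Box_ex p; have [lq hq] := Box_ex q.
  pose l := (lp + lq)%N.
  rewrite prod_cell; apply: (le_L1 _ _ (L1_box2 (l%:R + 1))); first exact: measurable_indic.
  move=> z; rewrite !indicE; case: (boolP (z \in cell m p `*` cell m q)) => [/set_mem [zp zq]|_].
    rewrite normr1 mem_set //; split => /=.
      by apply: (@cell_box _ _ m l p m0 _ z.1 zp); apply: Box_mono hp; rewrite /l; nia.
    by apply: (@cell_box _ _ m l q m0 _ z.2 zq); apply: Box_mono hq; rewrite /l; nia.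
  by rewrite normr0.
have E m : (0 < m)%N -> \sum_(p <- Box d (m * (n + r))) \sum_(q <- Box d (m * (n + r)))
    w m p q * fine (mu (cell m p `*` cell m q)) =
    Rint mu (fun z => w m (idx m z.1) (idx m z.2)).
  move=> m0; rewrite (_ : (fun z => _) = (fun z : (BRd R d * BRd R d)%type =>
    \sum_(p <- Box d (m * (n + r))) \sum_(q <- Box d (m * (n + r))) w m p q * (cellf m p z.1 * cellf m q z.2))).
    rewrite Rint_sum; last by move=> p; apply: L1_sum => q; apply: L1Z; exact: Lc.
    apply: eq_bigr => p _; rewrite Rint_sum; last by move=> q; apply: L1Z; exact: Lc.
    apply: eq_bigr => q _; rewrite RintZ; last exact: Lc.
    by congr (_ * _); rewrite prod_cell /Rint integral_indic ?setIT.
  apply/funext => z.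
  rewrite (@step_sum _ _ (fun p => w m p (idx m z.2)) m (m * (n + r))); last by move=> p; exact: w_p.
  apply: eq_bigr => p _; rewrite (@step_sum _ _ (w m p) m (m * (n + r))); last by move=> q; exact: w_q'.
  by rewrite mulr_suml; apply: eq_bigr => q _; rewrite -mulrA [cellf m q _ * _]mulrC.
under eq_fun do rewrite E //.
apply: (@Rint_dct _ _ _ mu _ _ (fun z => (B * K) * \1_(box (n + r).+1%:R `*` box (n + r).+1%:R) z)).
- by move=> m; exact: meas_w.
- by apply: L1Z; exact: L1_box2.
- move=> m z; have [->|wz] := eqVneq (w m.+1 (idx m.+1 z.1) (idx m.+1 z.2)) 0.
    by rewrite normr0 !mulr_ge0 // indicE.
  rewrite indicE mem_set ?mulr1; first exact: wBK.
  split => /=.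
    apply: (@supp_idx R d (fun p => w m.+1 p (idx m.+1 z.2)) m.+1 (n + r)) => // p; exact: w_p.
  apply: (@supp_idx R d (w m.+1 (idx m.+1 z.1)) m.+1 (n + r)) => // q; exact: w_q'.
by move=> z; exact: w_cvg.
Qed.

End one_measure.

End double_sums.

Section unit_cell.
Context (R : realType) (d : nat).

(** Unit cells are unions of mesh cells, so sampling the indicator of a unit cell at corners is
    exact, and [cell0_corner] holds despite the jump. *)
Lemma idx1_corner N (y : 'rV[R]_d) : (0 < N)%N -> idx 1 (corner R N (idx N y)) = idx 1 y.
Proof.
move=> N0; apply/rowP => i; rewrite !mxE !mul1r.
have N0' : 0 < N%:R :> R by rewrite ltr0n.
apply: floor_def; set a := Num.floor (y ord0 i).
have h1 := floor_le_tmp (y ord0 i); have h2 := floorD1_gt (y ord0 i).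
have h3 := floor_le_tmp (N%:R * y ord0 i).
apply/andP; split.
  rewrite ler_pdivlMr // -[N%:R]/(N%:Z%:~R) -intrM ler_int floor_ge_int_tmp intrM mulrC.
  by rewrite ler_wpM2l // ltW.
by rewrite ltr_pdivrMr //; apply: le_lt_trans h3 _; rewrite mulrC ltr_pM2r.
Qed.

Lemma supp_cell0 : supp_in 1%:R (@cellf R d 1 0).
Proof. by have := @supp_cellf R d 1 0 0 isT (Box0 _ _); rewrite add0r. Qed.

Lemma cell0_corner (y : 'rV[R]_d) :
  cellf 1 0 (corner R m.+1 (idx m.+1 y)) @[m --> \oo] --> (cellf 1 0 y : R).
Proof. by apply: cvg_near_cst; apply: nearW => m; rewrite /cellf idx1_corner. Qed.

End unit_cell.

Lemma cvg_eq_lim (R : realType) (u v : nat -> R) (a b : R) :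
  (forall n, u n = v n) -> u @ \oo --> a -> v @ \oo --> b -> a = b.
Proof. by move=> /funext ->; exact: cvg_unique. Qed.

(** * The expectation of the cell functional *)

Section moments.
Context (R : realType) (d : nat).
Local Notation Zd := 'rV[int]_d.
Context (dO : measure_display) (O : measurableType dO) (P : probability O R) (Phi : O -> M R d).
Hypothesis HPhi : random_measure Phi.
Hypothesis Hsq : loc_sq_integrable P Phi.
Local Notation Q := (law P HPhi).
Variables (g : 'rV[R]_d -> R) (r : nat) (K : R).
Hypotheses (cg : continuous g) (gr : supp_in r%:R g) (gK : forall x, `|g x| <= K) (K0 : 0 <= K).

Local Notation C0 := (@cellf R d 1 0).
Let SY m phi s t := @S R d g C0 r 1 m phi s t.

Lemma SY_cvg phi s t : SY m.+1 phi s t @[m --> \oo] --> Y g s t phi.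
Proof.
have := @S_cvg R d g C0 r 1 K 1 cg gr gK K0 (@supp_cell0 R d) (@cellf_le1 R d 1 0) ler01 (@cell0_corner R d) phi s t.
rewrite (_ : sint phi s _ = Y g s t phi) //.
by rewrite /Y /J; apply: eq_sint => x; rewrite mul1r.
Qed.

Lemma SY_bound m phi s t : (0 < m)%N -> `|SY m phi s t| <= K * V (1 + r).+2 phi ^+ 2.
Proof.
move=> m0; have := @S_bound R d g C0 r 1 K 1 gr gK K0 (@supp_cell0 R d) (@cellf_le1 R d 1 0) ler01 m phi s t m0.
by rewrite mul1r.
Qed.

Lemma meas_Y s t : measurable_fun setT (fun phi : VM R d => Y g s t phi).
Proof.
apply: (@measurable_fun_cvg _ _ R setT (fun m (phi : VM R d) => SY m.+1 phi s t)).
  by move=> m; exact: meas_S.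
by move=> phi _; exact: SY_cvg.
Qed.

Lemma L1_Y s t : L1 Q (fun phi => Y g s t phi).
Proof.
apply: (le_L1 (meas_Y s t) _ (L1Z K (L1_V_sqr HPhi Hsq r.+2))) => phi.
exact: Y_bound.
Qed.

Lemma Rint_SY_cvg s t : Rint Q (fun phi => SY m.+1 phi s t) @[m --> \oo] --> Rint Q (fun phi => Y g s t phi).
Proof.
apply: (Rint_dct _ (L1Z K (L1_V_sqr HPhi Hsq (1 + r).+2))).
- by move=> m; exact: meas_S.
- by move=> m phi; exact: SY_bound.
- by move=> phi; exact: SY_cvg.
Qed.

Definition mom s t m (p q : Zd) : R := Rint Q (fun phi => sint phi s (cellf m p) * sint phi t (cellf m q)).

Lemma L1_mom s t m p q : (0 < m)%N -> L1 Q (fun phi => sint phi s (cellf m p) * sint phi t (cellf m q)).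
Proof.
move=> m0; have [lp hp] := Box_ex p; have [lq hq] := Box_ex q; pose l := (lp + lq)%N.
have sp k : k \in Box d l -> supp_in l.+1%:R (@cellf R d m k).
  by move=> kl; rewrite -natr1; apply: supp_cellf => //; apply: Box_mono kl; rewrite leq_pmull.
have sp1 : supp_in l.+1%:R (@cellf R d m p) by apply/sp/(Box_mono _ hp)/leq_addr.
have sp2 : supp_in l.+1%:R (@cellf R d m q) by apply/sp/(Box_mono _ hq)/leq_addl.
apply: (le_L1 _ _ (L1_V_sqr HPhi Hsq l.+2)).
  by apply: measurable_funM; [apply: (meas_sint_baire s _ sp1)|apply: (meas_sint_baire t _ sp2)]; exact: baire_cellf.
move=> phi; rewrite normrM expr2; apply: ler_pM => //.
  have := V_baire phi s (@baire_cellf R d m p) sp1 (@cellf_le1 R d m p) ler01; by rewrite mul1r.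
have := V_baire phi t (@baire_cellf R d m q) sp2 (@cellf_le1 R d m q) ler01; by rewrite mul1r.
Qed.

Let w m (p q : Zd) : R := C0 (corner R m q) * g (corner R m p - corner R m q).

Lemma Rint_SY m s t : (0 < m)%N -> Rint Q (fun phi => SY m phi s t) =
  \sum_(p <- Box d (m * (1 + r))) \sum_(q <- Box d (m * (1 + r))) w m p q * mom s t m p q.
Proof.
move=> m0; rewrite /SY /S Rint_sum.
  apply: eq_bigr => p _; rewrite Rint_sum.
    by apply: eq_bigr => q _; rewrite RintZ //; exact: L1_mom.
  by move=> q; apply: L1Z; exact: L1_mom.
by move=> p; apply: L1_sum => q; apply: L1Z; exact: L1_mom.
Qed.

Variables (mu2 : M2 R d) (Hmu2 : is_second_moment P Phi mu2).

Lemma mu2_mom m p q : (0 < m)%N ->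
  cm_re mu2 (cell m p `*` cell m q) = mom false false m p q + mom true true m p q /\
  cm_im mu2 (cell m p `*` cell m q) = mom true false m p q - mom false true m p q.
Proof.
move=> m0; have mc k := @meas_cell R d m k; have bc k := @bdd_cell R d m k m0.
have Lm s t := @L1_mom s t m p q m0.
have := Hmu2 (mc p) (bc p) (mc q) (bc q); rewrite /cint => -[-> ->].
rewrite /mom; split.
  rewrite -RintD // Rint_law; last exact: L1D.
  by apply: eq_Rint => x /=; rewrite !sint_cell /= mulrN opprK.
rewrite -RintB // Rint_law; last exact: L1B.
by apply: eq_Rint => x /=; rewrite !sint_cell /= mulrN addrC.
Qed.

Definition m2p s := if s then cm3 mu2 else cm1 mu2.
Definition m2n s := if s then cm4 mu2 else cm2 mu2.
Definition sint2 s (F : 'rV[R]_d * 'rV[R]_d -> R) : R := Rint (m2p s) F - Rint (m2n s) F.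

Lemma m2_fin l : [/\ (cm1 mu2 (box l `*` box l) < +oo)%E, (cm2 mu2 (box l `*` box l) < +oo)%E,
  (cm3 mu2 (box l `*` box l) < +oo)%E & (cm4 mu2 (box l `*` box l) < +oo)%E].
Proof.
have mB : measurable (box l `*` box l : set (BRd R d * BRd R d)%type).
  by apply: measurableX; exact: meas_box.
have bB : bdd2 (box l `*` box l : set ('rV[R]_d * 'rV[R]_d)).
  by exists (d%:R * `|l| + 1) => -[x y] [/= xl yl]; split; exact: box_eball.
by have [? [? [? ?]]] := @cm_locfin _ _ _ _ mu2 _ mB bB; split.
Qed.

Lemma m2p_fin s l : (m2p s (box l `*` box l) < +oo)%E.
Proof. by have [] := m2_fin l; case: s. Qed.

Lemma m2n_fin s l : (m2n s (box l `*` box l) < +oo)%E.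
Proof. by have [] := m2_fin l; case: s. Qed.

Lemma sint2_riemann s : \sum_(p <- Box d (m.+1 * (1 + r))) \sum_(q <- Box d (m.+1 * (1 + r)))
    w m.+1 p q * (if s then cm_im mu2 else cm_re mu2) (cell m.+1 p `*` cell m.+1 q) @[m --> \oo] -->
  sint2 s (fun z => C0 z.2 * g (z.1 - z.2)).
Proof.
have h (m : {measure set (BRd R d * BRd R d)%type -> \bar R}) (mf : forall l : R, (m (box l `*` box l) < +oo)%E) :=
  @mu_riemann R d g C0 r 1 K 1 cg gr gK K0 (@supp_cell0 R d) (@cellf_le1 R d 1 0) ler01 (@cell0_corner R d) m mf.
apply: cvg_trans; last exact: (cvgB (h _ (m2p_fin s)) (h _ (m2n_fin s))).
apply: near_eq_cvg; apply: nearW => m /=.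
rewrite !fctE -sumrB; apply: eq_bigr => p _; rewrite -sumrB; apply: eq_bigr => q _.
by rewrite -mulrBr; case: s.
Qed.

(** The same Riemann sums converge to the integral against [mu2] and to the combination of
    expectations of [Y]. *)
Lemma sint2_Y :
  sint2 false (fun z => C0 z.2 * g (z.1 - z.2)) = Rint Q (Y g false false) + Rint Q (Y g true true) /\
  sint2 true (fun z => C0 z.2 * g (z.1 - z.2)) = Rint Q (Y g true false) - Rint Q (Y g false true).
Proof.
split.
  have h := cvgD (@Rint_SY_cvg false false) (@Rint_SY_cvg true true).
  apply: (cvg_eq_lim _ (@sint2_riemann false) (h _)) => m; rewrite !fctE.
  rewrite !Rint_SY // -big_split /=; apply: eq_bigr => p _.
  rewrite -big_split /=; apply: eq_bigr => q _; rewrite -mulrDr.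
  congr (_ * _); exact: (proj1 (mu2_mom p q (ltn0Sn m))).
have h := cvgB (@Rint_SY_cvg true false) (@Rint_SY_cvg false true).
apply: (cvg_eq_lim _ (@sint2_riemann true) (h _)) => m; rewrite !fctE.
rewrite !Rint_SY // -sumrB; apply: eq_bigr => p _.
rewrite -sumrB; apply: eq_bigr => q _; rewrite -mulrBr.
congr (_ * _); exact: (proj2 (mu2_mom p q (ltn0Sn m))).
Qed.

Variable lam : {measure set (BRd R d) -> \bar R}.
Hypothesis Hlam : is_lebesgue lam.
Variable mured : M R d.
Hypothesis Hred : is_reduced_second_moment lam mu2 mured.

Lemma L1_lam_supp (b : 'rV[R]_d -> R) n B : bmeas b -> supp_in n%:R b -> (forall x, `|b x| <= B) ->
  L1 lam b.
Proof.
move=> mb bn bB; apply: (le_L1 mb _ (L1Z B (L1_inF Hlam (Box d n.+1)))) => x.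
have [b0|/bn xn] := eqVneq (b x) 0.
  by rewrite b0 normr0 mulr_ge0 ?(le_trans _ (bB 0)) // /inF.
by rewrite /inF (@idx_Box R d 0 (lexx 0)) // mulr1.
Qed.

(** For [f (x, y) = b y * g (x - y)] the value [f (u + v, u)] is [b u * g v], so the defining
    integral of the reduced measure factorizes. *)
Lemma sint2_Cc s (b : 'rV[R]_d -> R) n B : continuous b -> supp_in n%:R b -> (forall x, `|b x| <= B) ->
  sint2 s (fun z => b z.2 * g (z.1 - z.2)) = Rint lam b * sint mured s g.
Proof.
move=> cb bn bB.
have ng : nice g by exact: nice_Cc gr.
have Lb : L1 lam b by apply: (L1_lam_supp _ bn bB); exact: cont_bmeas.
pose f (z : 'rV[R]_d * 'rV[R]_d) : R[i] := Complex (b z.2 * g (z.1 - z.2)) 0.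
have Cf : Cc2 f.
  split; rewrite /f /=.
    move=> z; apply: cvgM.
      by apply: (@continuous_comp _ _ _ (fun z : 'rV[R]_d * 'rV[R]_d => z.2) b); [exact: cvg_snd|exact: cb].
    apply: (@continuous_comp _ _ _ (fun z : 'rV[R]_d * 'rV[R]_d => z.1 - z.2) g); last exact: cg.
    by apply: cvgB; [exact: cvg_fst|exact: cvg_snd].
  split; first exact: cst_continuous.
  exists (d%:R * `|(n + r)%:R| + 1) => -[x y] /= xy.
  have [by0|by0] := eqVneq (b y) 0; first by rewrite by0 mul0r.
  have [g0|g0] := eqVneq (g (x - y)) 0; first by rewrite g0 mulr0.
  exfalso; apply: xy; split => /=; apply: box_eball => i; have h1 := bn _ by0 i; have h2 := gr g0 i; rewrite natrD.
    rewrite coordB in h2; have := ler_normD (x ord0 i - y ord0 i) (y ord0 i); rewrite subrK; lra.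
  have : 0 <= r%:R :> R by []; lra.
have L : cm_int mu2 f = Complex (sint2 false (fun z => b z.2 * g (z.1 - z.2))) (sint2 true (fun z => b z.2 * g (z.1 - z.2))).
  rewrite /cm_int /cint /sint2 /f /= /Rint !integral0 -complexiE; simpc.
  by congr Complex; rewrite ?addr0 ?add0r ?subr0.
have := Hred Cf; rewrite L.
have Ein u : cm_int mured (fun v : BRd R d => f (u + v, u)) = Complex (b u * sint mured false g) (b u * sint mured true g).
  rewrite cm_intE /f /= !sint0 subr0 add0r.
  have E s' : sint mured s' (fun x => b u * g (u + x - u)) = b u * sint mured s' g.
    by rewrite -sintZ //; apply: eq_sint => x; rewrite addrAC subrr add0r.
  by rewrite !E.
rewrite (_ : (fun u : BRd R d => cm_int mured (fun v : BRd R d => f (u + v, u))) =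
  (fun u => Complex (b u * sint mured false g) (b u * sint mured true g))); last by apply/funext => u; exact: Ein.
rewrite /cint /=.
move=> -[h0 h1].
have RZ c : Rint lam (fun u => b u * c) = Rint lam b * c.
  by rewrite -[RHS]mulrC -RintZ //; apply: eq_Rint => x; rewrite mulrC.
by case: s; rewrite ?h0 ?h1 RZ.
Qed.

(** The indicator of the unit cell is reached from continuous functions, whose Lebesgue integrals
    tend to the volume 1 of the cell. *)
Lemma sint2_mured s : sint2 s (fun z => C0 z.2 * g (z.1 - z.2)) = sint mured s g.
Proof.
have [h [ch hS [B hB] hg]] := baire_supp (@baire_cellf R d 1 0) (@supp_cell0 R d).
have B0 : 0 <= B by exact: le_trans (hB 0%N 0).
have Rc : Rint lam (h j) @[j --> \oo] --> (1 : R).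
  rewrite -(Rint_cellf Hlam 0).
  apply: (Rint_dct _ (L1Z B (L1_inF Hlam (Box d 3)))).
  - by move=> j; exact: cont_bmeas.
  - move=> j x; have [b0|/(hS j) xn] := eqVneq (h j x) 0.
      by rewrite b0 normr0 mulr_ge0 // /inF.
    by rewrite /inF (@idx_Box R d 0 (lexx 0)) // mulr1.
  - exact: hg.
have l1 : sint2 s (fun z => h j z.2 * g (z.1 - z.2)) @[j --> \oo] --> sint mured s g.
  rewrite (_ : (fun j => _) = (fun j => Rint lam (h j) * sint mured s g)); last first.
    by apply/funext => j; exact: (sint2_Cc s (ch j) (hS j) (hB j)).
  rewrite -[X in _ --> X]mul1r; apply: cvgM => //; exact: cvg_cst.
apply/esym; apply: (cvg_eq_lim (fun=> erefl) l1).
have bc j y : h j (corner R m.+1 (idx m.+1 y)) @[m --> \oo] --> h j y.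
  by apply: corner_cvg; exact: ch.
have cv (m : {measure set (BRd R d * BRd R d)%type -> \bar R}) : (forall l : R, (m (box l `*` box l) < +oo)%E) ->
    Rint m (fun z => h j z.2 * g (z.1 - z.2)) @[j --> \oo] --> Rint m (fun z => C0 z.2 * g (z.1 - z.2)).
  move=> mf; apply: (Rint_dct _ (L1Z (B * K) (L1_box2 mf (2 + r)%:R))).
  - by move=> j; exact: (meas_kernel cg gr (hS j) (bc j)).
  - move=> j z; have [b0|nz] := eqVneq (h j z.2 * g (z.1 - z.2)) 0.
      by rewrite b0 normr0 !mulr_ge0 // indicE.
    rewrite indicE mem_set ?mulr1; first by rewrite normrM ler_pM.
    move: nz; rewrite mulf_eq0 negb_or => /andP[/hS h1 /gr h2].
    split => i /=; have := h1 i; have := h2 i; rewrite coordB natrD => h3 h4.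
      by have := ler_normD (z.1 ord0 i - z.2 ord0 i) (z.2 ord0 i); rewrite subrK; lra.
    have : 0 <= r%:R :> R by []; lra.
  - move=> z; apply: cvgM; [exact: hg|exact: cvg_cst].
apply: cvgB; apply: cv; [exact: m2p_fin|exact: m2n_fin].
Qed.

Theorem EY_mured :
  Rint Q (Y g false false) + Rint Q (Y g true true) = sint mured false g /\
  Rint Q (Y g true false) - Rint Q (Y g false true) = sint mured true g.
Proof.
have [E1 E2] := sint2_Y.
by split; [exact: etrans (esym E1) (sint2_mured false)|exact: etrans (esym E2) (sint2_mured true)].
Qed.

End moments.

(** * Almost sure convergence for one test function *)

Section zero_one.
Context (R : realType) dT (T : measurableType dT).

Lemma meas_eventually (A : nat -> set T) : (forall n, measurable (A n)) ->
  measurable [set x | \forall n \near \oo, A n x].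
Proof.
move=> mA; rewrite (_ : [set x | _] = \bigcup_N \bigcap_n A (N + n)%N).
  by apply: bigcupT_measurable => N; exact: bigcapT_measurable.
apply/seteqP; split => x /=.
  by move=> [N _ hN]; exists N => // n _; apply: hN; rewrite /= leq_addr.
move=> [N _ hN]; exists N => // n /= Nn; rewrite -(subnKC Nn); exact: hN.
Qed.

Lemma invS_le (e : R) : 0 < e -> exists m : nat, m.+1%:R^-1 <= e.
Proof.
move=> e0; have [m _ hm] := near_infty_natSinv_lt (PosNum e0); exists m.
by apply: ltW; apply: (hm m) => /=.
Qed.

Lemma ex_nat_ge (x : R) : exists n : nat, x <= n%:R.
Proof. by have [n _ hn] := @nbhs_infty_ger R x; exists n; exact: (hn n (leqnn n)). Qed.

Context (Q : probability T R).

Lemma ae_false : ~ {ae Q, forall x : T, False}.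
Proof.
move=> [N [mN N0 sub]]; have : Q setT = 0%E.
  by apply: (@subset_measure0 _ _ _ Q setT N) => // x _; apply: sub.
by rewrite probability_setT => /eqP; rewrite onee_eq0.
Qed.

Lemma ae_prob1 (A : set T) : measurable A -> Q A = 1%E -> {ae Q, forall x, A x}.
Proof.
move=> mA A1; exists (~` A); split => //; first exact: measurableC.
by rewrite probability_setC // A1 subee.
Qed.

Lemma ae_prob0 (A : set T) : measurable A -> Q A = 0%E -> {ae Q, forall x, ~ A x}.
Proof. by move=> mA A0; exists A; split => // x /= /contrapT. Qed.

(** The distribution function of [l] takes only the values 0 and 1, and [c] is the point where it
    jumps. The sets [A q] stand for [l <= q] up to a null set; they are the ones that can be made
    strictly invariant. *)
Lemma zero_one_const (A : R -> set T) (l : T -> R) :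
  (forall q, measurable (A q)) -> (forall q, Q (A q) = 0%E \/ Q (A q) = 1%E) ->
  {ae Q, forall x, forall q, A q x <-> l x <= q} -> exists c : R, {ae Q, forall x, l x = c}.
Proof.
move=> mA zo Al.
have le1 q : Q (A q) = 1%E -> {ae Q, forall x, l x <= q}.
  by move=> /(ae_prob1 (mA q)); apply: filterS2 Al => x h /h.
have gt0 q : Q (A q) = 0%E -> {ae Q, forall x, q < l x}.
  move=> /(ae_prob0 (mA q)); apply: filterS2 Al => x h nA.
  by rewrite ltNge; apply/negP => /h.
pose E := [set q | Q (A q) = 1%E].
have E0 : exists n : nat, E n%:R.
  apply: contrapT => nE; apply: ae_false.
  have : {ae Q, forall x, forall n : nat, n%:R < l x}.
    apply: ae_foralln => n; apply: gt0; case: (zo n%:R) => // h; exfalso; apply: nE; by exists n.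
  apply: filterS => x h; have [n hn] := ex_nat_ge (l x); have := h n; lra.
have [n0 En0] := E0.
have [n1 hn1] : exists n : nat, Q (A (- n%:R)) = 0%E.
  apply: contrapT => nE; apply: ae_false.
  have : {ae Q, forall x, forall n : nat, l x <= - n%:R}.
    apply: ae_foralln => n; apply: le1; case: (zo (- n%:R)) => // h; exfalso; apply: nE; by exists n.
  apply: filterS => x h; have [n hn] := ex_nat_ge (1 - l x); have := h n; lra.
have lbE : lbound E (- n1%:R).
  move=> q Eq; rewrite leNgt; apply/negP => qn; apply: ae_false.
  by apply: filterS2 (le1 _ Eq) (gt0 _ hn1) => x h1 h2; have := lt_trans qn h2; rewrite ltNge h1.
have iE : has_inf E by split; [exists n0%:R | exists (- n1%:R)].
exists (inf E); move: {hn1}lbE => lbE.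
have h1 : {ae Q, forall x, forall m : nat, l x <= inf E + m.+1%:R^-1}.
  apply: ae_foralln => m.
  have m0 : 0 < m.+1%:R^-1 :> R by rewrite invr_gt0.
  have [q Eq qm] := inf_adherent m0 iE.
  by apply: filterS (le1 _ Eq) => x h; exact: ltW (le_lt_trans h qm).
have h2 : {ae Q, forall x, forall m : nat, inf E - m.+1%:R^-1 < l x}.
  apply: ae_foralln => m; apply: gt0; case: (zo (inf E - m.+1%:R^-1)) => // h.
  by have := ge_inf (proj2 iE) h; rewrite lerBrDr gerDl leNgt invr_gt0 ltr0Sn.
apply: filterS2 h1 h2 => x h1 h2; apply/eqP; rewrite eq_le; apply/andP; split.
  by apply/ler_addgt0Pr => e /invS_le[m hm]; apply: le_trans (h1 m) _; rewrite lerD2l.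
apply/ler_addgt0Pr => e /invS_le[m hm]; have := h2 m; rewrite ltrBlDr => h.
by apply: le_trans (ltW h) _; rewrite lerD2l.
Qed.

End zero_one.

Lemma bdd_box_nat (R : realType) d (u : 'rV[R]_d) : exists n : nat, forall i, `|u ord0 i| <= n%:R.
Proof.
have [n hn] := ex_nat_ge (\sum_i `|u ord0 i|); exists n => i.
by apply: le_trans hn; rewrite (bigD1 i) //= lerDl sumr_ge0.
Qed.

(** * Constancy of the limits, and the ergodic theorem for one test function *)

Section constancy.
Context (R : realType) (d : nat).
Context (dO : measure_display) (O : measurableType dO) (P : probability O R) (Phi : O -> M R d).
Hypothesis HPhi : random_measure Phi.
Hypothesis Hstat : stationary P Phi.
Hypothesis Herg : ergodic P Phi.
Hypothesis Hsq : loc_sq_integrable P Phi.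
Local Notation Q := (law P HPhi).
Local Notation tau := (@tau R d).

Lemma ptau a (B : set (VM R d)) : measurable B -> Q (tau a @^-1` B) = Q B.
Proof. exact: law_trM. Qed.

(** Measures with negligible boundary sums of every width and radius. Quantifying over all radii
    makes the set stable under every real translation, since [V r] of a translate is at most [V] of
    a larger radius. *)
Definition goodset : set (VM R d) := [set phi | forall c r m : nat,
  \forall n \near \oo, \sum_(k <- bdry d c n) V r (tau k phi) ^+ 2 <= m.+1%:R^-1 * (n ^ d)%:R].

Lemma goodset_ae : {ae Q, forall phi, goodset phi}.
Proof.
apply: ae_foralln => c; apply: ae_foralln => r.
have := @bdry_sums R _ (VM R d) Q d tau (@tauD R d) (@mtau R d) ptau _ c (L1_V_sqr HPhi Hsq r).
apply: filterS => phi h m.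
have m0 : 0 < m.+1%:R^-1 :> R by rewrite invr_gt0.
have := h _ m0; apply: filterS => n; apply: le_trans.
by apply: ler_sum => k _; exact: ler_norm.
Qed.

Lemma meas_sum_V D r : measurable_fun setT (fun phi : VM R d => \sum_(k <- D) V r (tau k phi) ^+ 2).
Proof.
by apply: measurable_sum => k; apply: (measurableT_comp (@meas_V_sqr R d r)); exact: mtau.
Qed.

Lemma meas_goodset : measurable goodset.
Proof.
rewrite (_ : goodset = \bigcap_c \bigcap_r \bigcap_m [set phi |
  \forall n \near \oo, \sum_(k <- bdry d c n) V r (tau k phi) ^+ 2 <= m.+1%:R^-1 * (n ^ d)%:R]).
  apply: bigcapT_measurable => c; apply: bigcapT_measurable => r; apply: bigcapT_measurable => m.
  apply: meas_eventually => n; rewrite -[X in measurable X]setTI.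
  by apply: measurable_fun_le => //; exact: meas_sum_V.
apply/seteqP; split => phi; first by move=> h c _ r _ m _; exact: h.
by move=> h c r m; exact: h.
Qed.

Lemma goodset_trM u phi : goodset phi -> goodset (trM u phi).
Proof.
move=> h c r m; have [n0 hn0] := bdd_box_nat u.
apply: filterS (h c (r + n0)%N m) => n; apply: le_trans; apply: ler_sum => k _.
rewrite lerXn2r ?nnegrE ?V_ge0 // tau_trM; exact: V_trM.
Qed.

Variables (g : 'rV[R]_d -> R) (r : nat) (K : R) (s t : bool).
Hypotheses (cg : continuous g) (gr : supp_in r%:R g) (gK : forall x, `|g x| <= K) (K0 : 0 <= K).
Local Notation Y := (Y g s t).

(** Upper limit at most [q], written with countably many conditions to be measurable, and inside
    [goodset] to be invariant at every point. *)
Definition lowset (phi : nat -> nat) (q : R) : set (VM R d) := goodset `&`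
  [set x | forall m : nat, \forall j \near \oo, avg tau (phi j) Y x <= q + m.+1%:R^-1].

Lemma meas_lowset phi q : measurable (lowset phi q).
Proof.
apply: measurableI; first exact: meas_goodset.
rewrite (_ : [set x | _] = \bigcap_m [set x : VM R d |
  \forall j \near \oo, avg tau (phi j) Y x <= q + m.+1%:R^-1]).
  apply: bigcapT_measurable => m; apply: meas_eventually => n; rewrite -[X in measurable X]setTI.
  apply: measurable_fun_le => //; apply: meas_avg; [exact: mtau|exact: (meas_Y cg gr gK K0)].
apply/seteqP; split => x; first by move=> h m _; exact: h.
by move=> h m; exact: h.
Qed.

Lemma avg_trM u x : goodset x -> forall m : nat,
  \forall n \near \oo, avg tau n Y (trM u x) <= avg tau n Y x + m.+1%:R^-1.
Proof.
move=> gx m; have [c hc] := bdd_box_nat u.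
have D0 : 0 < (d.+1 ^ d)%:R :> R by rewrite ltr0n expn_gt0.
(* The divisor collects the factor [2 * K] of [Y_invariant] and the comparison of [n ^ d] with the
   cardinality of the ball; [K + 1] keeps it positive. *)
have e0 : 0 < m.+1%:R^-1 / (2%:R * (K + 1) * (d.+1 ^ d)%:R).
  by rewrite divr_gt0 ?invr_gt0 ?mulr_gt0 // ltr_wpDl.
have [m' hm'] := invS_le e0.
near=> n; have n0 : (0 < n)%N by near: n; exists 1%N.
have hn : \sum_(k <- bdry d (c + 2) n) V r.+2 (tau k x) ^+ 2 <= m'.+1%:R^-1 * (n ^ d)%:R by near: n; exact: gx.
have cn := @card_ballZ_gt0 R d n n0.
have := Y_invariant cg gr gK K0 s t x n hc; rewrite ler_norml => /andP[_].
rewrite lerBlDr => /le_trans h.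
rewrite /avg -ler_pdivlMl ?invr_gt0 // invrK mulrDr mulrA mulfV ?gt_eqF // mul1r addrC.
apply: h; rewrite lerD2r.
apply: (@le_trans _ _ (2%:R * (K + 1) * (m'.+1%:R^-1 * (n ^ d)%:R))).
  apply: ler_pM => //; first exact: mulr_ge0; last by rewrite ler_wpM2l // lerDl.
  by rewrite sumr_ge0 // => k _; rewrite sqr_ge0.
have c2 := @card_ballZ_ge R d n n0.
apply: (@le_trans _ _ (2%:R * (K + 1) * (m'.+1%:R^-1 * ((d.+1 ^ d)%:R * #|` ballZ d n|%:R)))).
  by rewrite ler_wpM2l ?mulr_ge0 ?addr_ge0 // ler_wpM2l ?invr_ge0.
rewrite !mulrA [X in _ <= X]mulrC ler_wpM2r //.
rewrite [X in X <= _](_ : _ = m'.+1%:R^-1 * (2%:R * (K + 1) * (d.+1 ^ d)%:R)); last by ring.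
by rewrite -ler_pdivlMr // ?mulr_gt0 // ltr_wpDl.
Unshelve. all: by end_near. Qed.

Lemma lowset_trM phi q u x : (forall j, (j < phi j)%N) -> lowset phi q x -> lowset phi q (trM u x).
Proof.
move=> hphi [gx h]; split; first exact: goodset_trM.
(* The index [2 * m + 1] gives half of [m.+1%:R^-1], once for the average and once for the
   translation. *)
move=> m; have [N _ hN] := avg_trM u gx (2 * m + 1)%N.
have h2 : \forall j \near \oo, avg tau (phi j) Y (trM u x) <= avg tau (phi j) Y x + (2 * m + 1).+1%:R^-1.
  by exists N => // j /= Nj; apply: hN => /=; exact: leq_trans (ltnW (hphi j)).
apply: filterS2 (h (2 * m + 1)%N) h2 => j h3 h4; apply: le_trans h4 _.
apply: le_trans (_ : q + (2 * m + 1).+1%:R^-1 + (2 * m + 1).+1%:R^-1 <= _); first by rewrite lerD2r.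
rewrite -addrA lerD2l (_ : (2 * m + 1).+1%:R = m.+1%:R * 2%:R :> R).
  by rewrite invfM -splitr.
by rewrite -natrM; congr (_%:R); lia.
Qed.

Lemma lowset_inv phi q u x : (forall j, (j < phi j)%N) -> lowset phi q (trM u x) <-> lowset phi q x.
Proof.
move=> hphi; split; last exact: lowset_trM.
by move=> /(@lowset_trM phi q (- u) _ hphi); rewrite -trM_add addNr trM0.
Qed.

Lemma avg_const (phi : nat -> nat) : (forall j, (j < phi j)%N) ->
  {ae Q, forall x, cvgn (fun j => avg tau (phi j) Y x)} ->
  exists c : R, {ae Q, forall x, avg tau (phi j) Y x @[j --> \oo] --> c}.
Proof.
move=> hphi hc.
pose l x := limn (fun j => avg tau (phi j) Y x).
have [//||c hl] := @zero_one_const R _ (VM R d) Q (lowset phi) l (meas_lowset phi).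
- by move=> q; apply: law_ergodic => //; [exact: meas_lowset|move=> u x; exact: lowset_inv].
- apply: filterS2 goodset_ae hc => x gx cx q; split.
    move=> [_ h]; apply/ler_addgt0Pr => e /invS_le[m hm].
    apply: (@le_trans _ _ (q + m.+1%:R^-1)); last by rewrite lerD2l.
    by apply: (limr_le cx); exact: h.
  move=> lq; split => // m; apply: cvgr_le cx _ _.
  by apply: (le_lt_trans lq); rewrite ltrDl invr_gt0.
- by exists c; apply: filterS2 hl hc => x <-.
Qed.

Theorem avg_ae : {ae Q, forall x, avg tau n Y x @[n --> \oo] --> Rint Q Y}.
Proof.
have LY : L1 Q Y by exact: (L1_Y HPhi Hsq cg gr gK K0).
apply: (@pointwise_of_mean R _ (VM R d) Q d tau (@tauD R d) (@mtau R d) ptau _ _ LY) => e e0.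
exact: (@mean_const R _ (VM R d) Q d tau (@tauD R d) (@mtau R d) ptau _ LY avg_const).
Qed.

End constancy.

(** * Linearity in the test function *)

Section kernel_linear.
Context (R : realType) (d : nat).
Variables (g1 g2 : 'rV[R]_d -> R) (r : nat) (K : R).
Hypotheses (cg1 : continuous g1) (gr1 : supp_in r%:R g1) (gK1 : forall x, `|g1 x| <= K).
Hypotheses (cg2 : continuous g2) (gr2 : supp_in r%:R g2) (gK2 : forall x, `|g2 x| <= K).
Hypothesis K0 : 0 <= K.
Local Notation g := (fun x => g1 x - g2 x).

Lemma suppB : supp_in r%:R g.
Proof.
move=> x h; have [g10|/gr1//] := eqVneq (g1 x) 0; have [g20|/gr2//] := eqVneq (g2 x) 0.
by move: h; rewrite /= g10 g20 subrr eqxx.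
Qed.

Lemma normB_le x : `|g x| <= K + K.
Proof. by apply: le_trans (ler_normB _ _) _; exact: lerD. Qed.

Lemma J_B phi s t a b n : baire a -> baire b -> (forall x, `|b x| <= 1) ->
  (forall x y, a x * b y != 0 -> box r%:R (x - y) -> box n%:R y) ->
  J phi s t a b g = J phi s t a b g1 - J phi s t a b g2.
Proof.
move=> ba bb b1 Hn.
have KK : 0 <= K + K by exact: addr_ge0.
have H (f : 'rV[R]_d -> R) : supp_in r%:R f -> forall x y, a x * (b y * f (x - y)) != 0 -> box n%:R y.
  move=> fr x y; rewrite mulrA mulf_eq0 negb_or => /andP[ab /fr]; exact: Hn ab.
rewrite (J_sum (contB cg1 cg2) suppB normB_le KK _ _ _ ba bb b1 (H _ suppB)).
rewrite (J_sum cg1 gr1 gK1 K0 _ _ _ ba bb b1 (H _ gr1)) (J_sum cg2 gr2 gK2 K0 _ _ _ ba bb b1 (H _ gr2)).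
rewrite -sumrB; apply: eq_bigr => k _; rewrite /J -sintB.
- apply: eq_sint => x; rewrite -mulrBr; congr (_ * _); rewrite -sintB.
  + by apply: eq_sint => y; rewrite mulrBr.
  + by have [L bL] := piece_supp b k; apply: (inner_nice cg1 gK1 x _ bL); exact: piece_baire.
  + by have [L bL] := piece_supp b k; apply: (inner_nice cg2 gK2 x _ bL); exact: piece_baire.
- exact: (outer_nice cg1 gr1 gK1 K0).
- exact: (outer_nice cg2 gr2 gK2 K0).
Qed.

Lemma J_bound phi s t a b n : baire a -> (forall x, `|a x| <= 1) -> baire b -> (forall x, `|b x| <= 1) ->
  (forall x y, a x * b y != 0 -> box r%:R (x - y) -> box n%:R y) ->
  `|J phi s t a b g1| <= K * \sum_(k <- Box d n.+1) V r.+2 (tau k phi) ^+ 2.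
Proof.
move=> ba a1 bb b1 Hn; rewrite (J_sum cg1 gr1 gK1 K0 phi s t (n := n)) //; last first.
  move=> x y; rewrite mulrA mulf_eq0 negb_or => /andP[ab /gr1]; exact: Hn ab.
apply: le_trans (ler_norm_sum _ _ _) _; rewrite mulr_sumr; apply: ler_sum => k _.
exact: (piece_bound cg1 gr1 gK1 K0).
Qed.

Lemma Y_B s t phi : Y g s t phi = Y g1 s t phi - Y g2 s t phi.
Proof.
apply: (@J_B phi s t _ _ 1) => [|||x y].
- exact: baire_cst.
- exact: baire_cellf.
- exact: cellf_le1.
- by rewrite mul1r => /supp_cell0.
Qed.

End kernel_linear.

(** * Normalization by Lebesgue measure *)

Section limits.
Context (R : realType) (d : nat).

Lemma cvg_small_trans (u v : nat -> R) (l : R) :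
  (forall e, 0 < e -> \forall n \near \oo, `|u n - v n| <= e) -> v @ \oo --> l -> u @ \oo --> l.
Proof.
move=> h vl; have h0 : (u \- v) @ \oo --> (0 : R).
  apply/cvgr0Pnorm_le => e e0; exact: h.
rewrite (_ : u = (u \- v) \+ v); last by apply/funext => n /=; rewrite subrK.
by rewrite -[l]add0r; exact: cvgD.
Qed.

Lemma near_ballZ_ratio (a : nat -> R) : (forall e, 0 < e -> \forall n \near \oo, `|a n| <= e * (n ^ d)%:R) ->
  forall e, 0 < e -> \forall n \near \oo, `|a n / #|` ballZ d n|%:R| <= e.
Proof.
move=> ha e e0; have D0 : 0 < (d.+1 ^ d)%:R :> R by rewrite ltr0n expn_gt0.
near=> n; have n0 : (0 < n)%N by near: n; exists 1%N.
have cn := @card_ballZ_gt0 R d n n0.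
rewrite normrM normfV (ger0_norm (ltW cn)) ler_pdivrMr //.
have : `|a n| <= e / (d.+1 ^ d)%:R * (n ^ d)%:R by near: n; apply: ha; rewrite divr_gt0.
move/le_trans; apply; rewrite -mulrA ler_pM2l // ler_pdivrMl //; exact: card_ballZ_ge.
Unshelve. all: by end_near. Qed.

Variable lam : {measure set (BRd R d) -> \bar R}.
Hypothesis Hlam : is_lebesgue lam.
Local Notation Lam n := (fine (lam (eball0 d n%:R))).

Lemma Lam_ratio : Lam n / #|` ballZ d n|%:R @[n --> \oo] --> (1 : R).
Proof.
apply: (@cvg_small_trans _ (fun=> 1)); last exact: cvg_cst.
move=> e e0; have : forall e, 0 < e -> \forall n \near \oo, `|Lam n - #|` ballZ d n|%:R| <= e * (n ^ d)%:R.
  move=> e' e'0; apply: filterS (@bdry_small R d 2 _ e'0) => n; apply: le_trans; exact: lam_ball.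
move=> /near_ballZ_ratio /(_ e e0) h; near=> n.
have n0 : (0 < n)%N by near: n; exists 1%N.
have : `|(Lam n - #|` ballZ d n|%:R) / #|` ballZ d n|%:R| <= e by near: n.
by rewrite mulrBl divff // gt_eqF // card_ballZ_gt0.
Unshelve. all: by end_near. Qed.

Lemma Lam_ge : exists2 D : R, 0 < D & \forall n \near \oo, 0 < Lam n /\ (n ^ d)%:R <= D * Lam n.
Proof.
have D0 : 0 < (d.+1 ^ d)%:R :> R by rewrite ltr0n expn_gt0.
(* The factor 2 absorbs the ratio of the lattice count to the volume, which is eventually below
   2. *)
exists ((d.+1 ^ d)%:R * 2%:R); first by rewrite mulr_gt0.
have h : \forall n \near \oo, 2%:R^-1 < Lam n / #|` ballZ d n|%:R.
  by apply: (cvgr_gt _ Lam_ratio); rewrite invf_lt1 // ltr1n.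
near=> n; have n0 : (0 < n)%N by near: n; exists 1%N.
have cn := @card_ballZ_gt0 R d n n0.
have : 2%:R^-1 < Lam n / #|` ballZ d n|%:R by near: n.
rewrite ltr_pdivlMr // => h1; split; first by apply: lt_trans h1; rewrite mulr_gt0 ?invr_gt0.
apply: le_trans (@card_ballZ_ge R d n n0) _; rewrite -mulrA ler_pM2l //.
by rewrite -ler_pdivrMl // ltW.
Unshelve. all: by end_near. Qed.

Lemma ratio_Lam (a : nat -> R) (l : R) : a n / #|` ballZ d n|%:R @[n --> \oo] --> l ->
  a n / Lam n @[n --> \oo] --> l.
Proof.
move=> al; apply: (@cvg_small_trans _ (fun n => a n / #|` ballZ d n|%:R / (Lam n / #|` ballZ d n|%:R))).
  move=> e e0; near=> n; have n0 : (0 < n)%N by near: n; exists 1%N.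
  have cn := @card_ballZ_gt0 R d n n0.
  by rewrite invfM invrK [_^-1 * _]mulrC mulrA divfK ?gt_eqF // subrr normr0 ltW.
rewrite -[l]divr1; apply: cvgM => //; apply: cvgV => //; exact: Lam_ratio.
Unshelve. all: by end_near. Qed.

End limits.

(** * Uniformity in the test function *)

Section dense_family.
Context (R : realType) (d : nat).
Local Notation Zd := 'rV[int]_d.

Definition Cr (r : nat) (g : 'rV[R]_d -> R) := continuous g /\ supp_in r%:R g.

(** Values are listed in the enumeration order of the cells, so these functions are coded by lists
    of rationals and hence countable. Cells outside the box have an index past the end of a list of
    matching length and get the default value 0. *)
Definition step (r N : nat) (s : seq rat) (y : 'rV[R]_d) : R :=
  ratr (nth 0 s (index (idx N.+1 y) (enum_fset (Box d (N.+1 * r))))).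

Lemma ratr_approx (x e : R) : 0 < e -> exists q : rat, `|x - ratr q| <= e.
Proof.
move=> e0; have [q /andP[q1 q2]] : exists q : rat, ratr q \in `]x - e, x + e[.
  by apply: rat_in_itvoo; lra.
exists q; move: q1 q2; rewrite !bnd_simp => q1 q2; rewrite ler_norml; apply/andP; split; lra.
Qed.

Lemma step_approx r g e : Cr r g -> 0 < e ->
  exists N s, forall y, `|g y - step r N s y| <= e.
Proof.
move=> [cg gr] e0; have e2 : 0 < e / 2%:R by rewrite divr_gt0.
have [t t0 ht] := unif_cont cg gr e2; have [N hN] := invS_le t0.
have /choice[q hq] (k : Zd) : exists q : rat, `|g (corner R N.+1 k) - ratr q| <= e / 2%:R by exact: ratr_approx.
exists N, (map q (enum_fset (Box d (N.+1 * r)))) => y; rewrite /step; set k := idx N.+1 y.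
have [kB|kB] := boolP (k \in Box d (N.+1 * r)).
  rewrite (nth_map 0) ?index_mem // nth_index //.
  have h1 : `|g y - g (corner R N.+1 k)| <= e / 2%:R.
    by apply: ht => i; apply: le_trans (corner_dist y i (ltn0Sn N)) hN.
  apply: le_trans (ler_distD (g (corner R N.+1 k)) _ _) _.
  by rewrite [leRHS]splitr lerD.
rewrite nth_default ?size_map; last by rewrite leqNgt index_mem.
rewrite rmorph0 subr0; suff -> : g y = 0 by rewrite normr0 ltW.
apply: contraNeq kB => /gr yr; apply/BoxP => i.
have := yr i; rewrite ler_norml => /andP[h1 h2].
rewrite -lez_nat abszE ler_norml !mxE floor_ge_int_tmp intrN -(@ler_int R).
have E : ((N.+1 * r)%N%:Z)%:~R = N.+1%:R * r%:R :> R by rewrite -natrM.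
rewrite E -mulrN ler_wpM2l //=; apply: le_trans (floor_le_tmp _) _.
by rewrite ler_wpM2l.
Qed.

(* [D r i] is some continuous function within [1/(m+1)] of a rational step function, if there
   is one, where [i] encodes the step function and [m]. *)
Lemma ex_dense : exists D : nat -> nat -> 'rV[R]_d -> R, (forall r i, Cr r (D r i)) /\
  forall r g (e : R), Cr r g -> 0 < e -> exists i, forall x, `|g x - D r i x| <= e.
Proof.
have key (r i : nat) : exists f : 'rV[R]_d -> R, Cr r f /\
    forall p g, (choice.unpickle i : option (nat * seq rat * nat)) = Some p -> Cr r g ->
      (forall y, `|g y - step r p.1.1 p.1.2 y| <= p.2.+1%:R^-1) ->
      (forall y, `|f y - step r p.1.1 p.1.2 y| <= p.2.+1%:R^-1).
  case: (choice.unpickle i : option (nat * seq rat * nat)) => [p|].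
    have [[f [Cf hf]]|nf] := pselect (exists f, Cr r f /\
        forall y, `|f y - step r p.1.1 p.1.2 y| <= p.2.+1%:R^-1).
      by exists f; split => // _ g [<-].
    exists (fun=> 0); split; first by split; [exact: contC|move=> x; rewrite eqxx].
    by move=> _ g [<-] Cg hg; case: nf; exists g.
  by exists (fun=> 0); split => //; split; [exact: contC|move=> x; rewrite eqxx].
have /choice[D hD] (p : nat * nat) := key p.1 p.2.
exists (fun r i => D (r, i)); split => [r i|r g e Cg e0]; first by have [] := hD (r, i).
have e2 : 0 < e / 2%:R by rewrite divr_gt0.
have [m hm] := invS_le e2.
have m0 : 0 < m.+1%:R^-1 :> R by rewrite invr_gt0.
have [N [s hs]] := step_approx Cg m0.
exists (choice.pickle (N, s, m)) => x.
have [_ /(_ (N, s, m) g)] := hD (r, choice.pickle (N, s, m)); rewrite choice.pickleK => /(_ erefl Cg hs x) /= h.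
apply: le_trans (ler_distD (step r N s x) _ _) _; rewrite [leRHS]splitr lerD //.
  exact: le_trans (hs x) hm.
by rewrite distrC; exact: le_trans hm.
Qed.

End dense_family.

Lemma ae_forall_bool (R : realType) dT (T : measurableType dT) (Q : probability T R) (p : T -> bool -> Prop) :
  (forall b, {ae Q, forall x, p x b}) -> {ae Q, forall x, forall b, p x b}.
Proof. by move=> h; apply: filterS2 (h true) (h false) => x pt pf []. Qed.

Lemma dist_div_le (R : realType) (x y L e : R) : 0 < L -> `|x - y| <= e * L -> `|y / L - x / L| <= e.
Proof. by move=> L0 h; rewrite -mulrBl normrM normfV (ger0_norm (ltW L0)) ler_pdivrMr // distrC. Qed.

Lemma dist_le3 (R : realType) (a b c d e x y : R) :
  `|a - b| <= y -> `|b - c| <= e - (x + y) -> `|c - d| <= x -> `|a - d| <= e.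
Proof.
move=> h1 h2 h3; have := ler_distD b a d; have := ler_distD c b d; lra.
Qed.

Lemma addS_le_mul n r : (0 < n)%N -> ((n + r).+1 <= n * (r + 2))%N.
Proof. nia. Qed.

(** * Almost sure convergence for all test functions at once *)

Section uniform_limit.
Context (R : realType) (d : nat).
Context (dO : measure_display) (O : measurableType dO) (P : probability O R) (Phi : O -> M R d).
Hypothesis HPhi : random_measure Phi.
Hypothesis Hstat : stationary P Phi.
Hypothesis Herg : ergodic P Phi.
Hypothesis Hsq : loc_sq_integrable P Phi.
Variable lam : {measure set (BRd R d) -> \bar R}.
Hypothesis Hlam : is_lebesgue lam.
Local Notation Q := (law P HPhi).
Local Notation tau := (@tau R d).
Local Notation Lam n := (fine (lam (eball0 d n%:R))).

(** The flag distinguishes the two limits: with [true] the second factor is restricted to the ball,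
    with [false] it is not. *)
Definition outer_ball (e : bool) n : 'rV[R]_d -> R := if e then ballf n else fun=> 1.

Lemma baire_outer e n : baire (outer_ball e n).
Proof. by case: e; [exact: baire_ballf|exact: baire_cst]. Qed.

Lemma outer_le1 e n x : `|outer_ball e n x| <= 1.
Proof. by case: e; [exact: ballf_le1|rewrite normr1]. Qed.

Lemma outer_inside e n x : ballf n x = 1 -> outer_ball e n x = 1.
Proof. by case: e. Qed.

Lemma outer_box e n r x y : ballf n x * outer_ball e n y != 0 -> box r%:R (x - y) -> box (n + r)%:R y.
Proof.
rewrite mulf_eq0 negb_or => /andP[/ballf_box h1 _] h2 i; have := h1 i; have := h2 i.
rewrite coordB natrD => h3 h4; have := ler_normB (x ord0 i) (x ord0 i - y ord0 i).
by rewrite opprB addrCA subrr addr0; lra.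
Qed.

(** Finiteness of the maximal function of the squared variation. It bounds, uniformly in [n], the
    effect on [J] of replacing a test function by a member of the countable family. *)
Definition maxbdd (phi : VM R d) : Prop := forall r, exists C, forall n, (0 < n)%N ->
  \sum_(k <- Box d n) V r (tau k phi) ^+ 2 <= C * (n ^ d)%:R.

Lemma maxbdd_ae : {ae Q, forall phi, maxbdd phi}.
Proof.
apply: ae_foralln => r; apply: ae_small => e e0.
pose g (phi : VM R d) := V r phi ^+ 2.
have Lg : L1 Q g by exact: L1_V_sqr.
have g0 x : 0 <= g x by exact: sqr_ge0.
pose E := 10%:R ^+ d * Rint Q g.
have E0 : 0 <= E by rewrite mulr_ge0 ?exprn_ge0 // Rint_ge0.
have t0 : 0 < (E + 1) / e by rewrite divr_gt0 // ltr_wpDl.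
exists (maxset tau g ((E + 1) / e)); split.
- by apply: meas_maxset => //; [exact: mtau|exact: L1_meas Lg].
- apply: le_trans (@maximal_ineq R _ (VM R d) Q d tau (@tauD R d) (@mtau R d) (ptau HPhi Hstat) _ _ Lg g0 t0) _.
  by rewrite lee_fin invf_div -/E mulrAC ler_pdivrMr ?ltr_wpDl // ler_pM2l // lerDl ler01.
- move=> x nx; apply: contrapT => nm; apply: nx; exists ((E + 1) / e) => n n0.
  rewrite leNgt; apply/negP => h; apply: nm; exists n; split => //; exact: ltW.
Qed.

Lemma J_limit (g : 'rV[R]_d -> R) (r : nat) s t e : Cr r g ->
  {ae Q, forall phi, J phi s t (ballf n) (outer_ball e n) g / Lam n @[n --> \oo] --> Rint Q (Y g s t)}.
Proof.
move=> [cg gr]; have [K K0 gK] := cont_supp_bdd cg gr.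
apply: filterS2 (goodset_ae HPhi Hstat Hsq) (avg_ae HPhi Hstat Herg Hsq s t cg gr gK K0) => phi gphi al.
apply: (ratio_Lam Hlam); apply: (cvg_small_trans _ al).
have K1 : 0 < 2%:R * (K + 1) by rewrite mulr_gt0 // ltr_wpDl.
have : forall e', 0 < e' -> \forall n \near \oo,
    `|J phi s t (ballf n) (outer_ball e n) g - \sum_(k <- ballZ d n) Y g s t (tau k phi)| <= e' * (n ^ d)%:R.
  move=> e' e'0; have e1 : 0 < e' / (2%:R * (K + 1)) by rewrite divr_gt0.
  have [m hm] := invS_le e1.
  apply: filterS (gphi (r + 2)%N r.+2 m) => n hn.
  apply: le_trans (N_compare cg gr gK K0 s t phi (baire_outer e n) (outer_le1 e n) (@outer_inside e n)) _.
  apply: (@le_trans _ _ (2%:R * (K + 1) * (m.+1%:R^-1 * (n ^ d)%:R))).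
    apply: ler_pM => //; first exact: mulr_ge0; last by rewrite ler_wpM2l // lerDl.
    by rewrite sumr_ge0 // => k _; rewrite sqr_ge0.
  by rewrite mulrA ler_wpM2r // -ler_pdivlMl // mulrC.
move=> /near_ballZ_ratio h e' /h; apply: filterS => n; rewrite mulrBl.
by rewrite /avg [_^-1 * _]mulrC.
Qed.

Theorem J_limit_all : {ae Q, forall phi : VM R d, forall r g, Cr r g -> forall s t e,
  J phi s t (ballf n) (outer_ball e n) g / Lam n @[n --> \oo] --> Rint Q (Y g s t)}.
Proof.
have [D [CD hD]] := @ex_dense R d.
have lim : {ae Q, forall phi : VM R d, forall r i (s t e : bool),
    J phi s t (ballf n) (outer_ball e n) (D r i) / Lam n @[n --> \oo] --> Rint Q (Y (D r i) s t)}.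
  apply: ae_foralln => r; apply: ae_foralln => i.
  by do 3!apply: ae_forall_bool => ?; exact: J_limit.
have mb := maxbdd_ae; apply: filterS2 mb lim => phi mphi lphi r g [cg gr] s t e.
have [K K0 gK] := cont_supp_bdd cg gr.
have [C hC] := mphi r.+2.
have [L L0 hL] := Lam_ge Hlam.
have LV := L1_V_sqr HPhi Hsq r.+2.
pose EV := Rint Q (fun phi => V r.+2 phi ^+ 2).
have EV0 : 0 <= EV by apply: Rint_ge0 => x; exact: sqr_ge0.
have C0 : 0 <= C.
  have := hC 1%N isT; rewrite exp1n mulr1; apply: le_trans.
  by rewrite sumr_ge0 // => k _; rewrite sqr_ge0.
(* A change of [g] by [eps] changes [J] by at most [eps] times a sum over [Box d (n * (r + 2))],
   which [C] bounds; [L] passes from [n ^ d] to the volume of the ball. *)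
pose A := C * ((r + 2) ^ d)%:R * L.
have A0 : 0 <= A by rewrite !mulr_ge0 // ltW.
apply/cvgrPdist_le => e1 e10.
(* [A] accounts for the change of [J] and [EV] for that of the expectation; the 1 leaves a positive
   gap for the convergence of the approximating function. *)
have e2 : 0 < e1 / (A + EV + 1) by rewrite divr_gt0 // ltr_wpDl // addr_ge0.
have [i hi] := hD r g _ (conj cg gr) e2; set eps := e1 / _ in e2 hi.
have [ci ri] := CD r i; have [Ki Ki0 gKi] := cont_supp_bdd ci ri.
pose K' := Num.max K Ki.
have K'0 : 0 <= K' by rewrite le_max K0.
have gK' x : `|g x| <= K' by rewrite le_max gK.
have gKi' x : `|D r i x| <= K' by rewrite le_max gKi orbT.
have cB := contB cg ci; have sB := suppB gr ri.
have EY : `|Rint Q (Y g s t) - Rint Q (Y (D r i) s t)| <= eps * EV.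
  rewrite -RintB; [|exact: (L1_Y HPhi Hsq cg gr gK K0)|exact: (L1_Y HPhi Hsq ci ri gKi Ki0)].
  rewrite (eq_Rint _ (g := fun x : VM R d => Y (fun x => g x - D r i x) s t x)); last first.
    by move=> x; rewrite (Y_B cg gr gK' ci ri gKi' K'0).
  have LY := L1_Y HPhi Hsq cB sB hi (ltW e2) s t.
  apply: le_trans (normr_Rint LY) _; rewrite -RintZ //; apply: le_Rint.
  - exact: L1_norm.
  - exact: L1Z.
  - by move=> x; exact: (Y_bound cB sB hi (ltW e2)).
have EA : eps * (A + EV) < e1.
  by rewrite /eps mulrAC ltr_pdivrMr ?ltr_wpDl ?addr_ge0 // ltr_pM2l // ltrDl.
have gap : 0 < e1 - eps * (A + EV) by rewrite subr_gt0.
have /cvgrPdist_le /(_ _ gap) near1 := lphi r i s t e.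
near=> n; have n0 : (0 < n)%N by near: n; exists 1%N.
have [Ln Lnd] : 0 < Lam n /\ (n ^ d)%:R <= L * Lam n by near: n.
have h1 : `|Rint Q (Y (D r i) s t) - J phi s t (ballf n) (outer_ball e n) (D r i) / Lam n| <= e1 - eps * (A + EV) by near: n.
have JD : `|J phi s t (ballf n) (outer_ball e n) g - J phi s t (ballf n) (outer_ball e n) (D r i)| <= eps * A * Lam n.
  rewrite -(J_B cg gr gK' ci ri gKi' K'0 phi s t (n := n + r) (@baire_ballf R d n) (baire_outer e n) (outer_le1 e n)); last first.
    by move=> x y; exact: outer_box.
  apply: le_trans (J_bound cB sB hi (ltW e2) phi s t (n := n + r) (@baire_ballf R d n) (@ballf_le1 R d n) (baire_outer e n) (outer_le1 e n) _) _.
    by move=> x y; exact: outer_box.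
  rewrite -mulrA ler_pM2l //.
  apply: (@le_trans _ _ (\sum_(k <- Box d (n * (r + 2))) V r.+2 (tau k phi) ^+ 2)).
    apply: fsum_le_sub => [|k]; last exact: sqr_ge0.
    by apply/fsubsetP => k; apply: Box_mono; exact: addS_le_mul.
  apply: le_trans (hC _ _) _; first by rewrite muln_gt0 n0 addn2.
  rewrite expnMn natrM [_%:R * _]mulrC /A -!mulrA ler_wpM2l // ler_wpM2l //.
apply: dist_le3 EY _ (dist_div_le Ln JD); rewrite -mulrDr; exact: h1.
Unshelve. all: by end_near. Qed.

End uniform_limit.

(** * Complex test functions *)

Section complex_kernel.
Context (R : realType) (d : nat).
Variables (phi : M R d) (a b : 'rV[R]_d -> R) (n : nat).
Hypotheses (ba : baire a) (bb : baire b) (b1 : forall x, `|b x| <= 1).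
Variables (f : 'rV[R]_d -> R[i]) (r : nat).
Local Notation g := (fun x => complex.Re (f x)).
Local Notation h := (fun x => complex.Im (f x)).
Hypotheses (Cg : Cr r g) (Ch : Cr r h).
Hypothesis ab : forall x y, a x * b y != 0 -> box r%:R (x - y) -> box n%:R y.

(** The common form of both convolutions: the reflection in [tildeF] turns [x + y] into [x - y], and
    its two conjugations are the ones visible here. *)
Definition correl : R[i] := cm_int phi (fun x => Complex (a x) 0 *
  (cm_int phi (fun y => Complex (b y) 0 * (f (x - y))^*))^*).

Let box_of (k : 'rV[R]_d -> R) : supp_in r%:R k -> forall x y, a x * (b y * k (x - y)) != 0 -> box n%:R y.
Proof. by move=> kr x y; rewrite mulrA mulf_eq0 negb_or => /andP[abn /kr]; exact: ab. Qed.

(** Both copies of [phi] are expanded into real and imaginary parts; the conjugated inner copy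
    produces the differences of mixed terms. *)
Lemma correl_J :
  complex.Re correl = (J phi false false a b g + J phi true true a b g) -
                      (J phi true false a b h - J phi false true a b h) /\
  complex.Im correl = (J phi false false a b h + J phi true true a b h) +
                      (J phi true false a b g - J phi false true a b g).
Proof.
have [[cg gr] [ch hr]] := (Cg, Ch).
have [K K0 gK] := cont_supp_bdd cg gr; have [L L0 hL] := cont_supp_bdd ch hr.
have ng x : nice (fun y => b y * g (x - y)) by exact: (inner_nice' cg gr gK).
have nh x : nice (fun y => b y * h (x - y)) by exact: (inner_nice' ch hr hL).
have og t := outer_nice_box cg gr gK K0 phi t ba bb b1 (box_of gr).
have oh t := outer_nice_box ch hr hL L0 phi t ba bb b1 (box_of hr).
pose Ig t x := sint phi t (fun y => b y * g (x - y)).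
pose Ih t x := sint phi t (fun y => b y * h (x - y)).
have inner x : (cm_int phi (fun y => Complex (b y) 0 * (f (x - y))^*))^* =
    Complex (Ig false x + Ih true x) (Ih false x - Ig true x).
  rewrite (_ : cm_int _ _ = Complex (Ig false x + Ih true x) (- Ih false x + Ig true x)).
    by rewrite /Ig /Ih /=; congr Complex; ring.
  rewrite cm_intE; congr Complex; congr (_ + _).
  - by apply: eq_sint => y; case: (f (x - y)) => u v /=; ring.
  - apply/eqP; rewrite eqr_oppLR; apply/eqP; rewrite -sintN //.
    by apply: eq_sint => y; case: (f (x - y)) => u v /=; ring.
  - by rewrite -sintN //; apply: eq_sint => y; case: (f (x - y)) => u v /=; ring.
  - by apply: eq_sint => y; case: (f (x - y)) => u v /=; ring.
rewrite /correl (_ : (fun x => _) = fun x => Complex (a x * (Ig false x + Ih true x)) (a x * (Ih false x - Ig true x))).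
  rewrite cm_intE /=.
  have D t : sint phi t (fun x => a x * (Ig false x + Ih true x)) = J phi t false a b g + J phi t true a b h.
    by rewrite /J -sintD; [apply: eq_sint => x; rewrite mulrDr|exact: og|exact: oh].
  have B t : sint phi t (fun x => a x * (Ih false x - Ig true x)) = J phi t false a b h - J phi t true a b g.
    by rewrite /J -sintB; [apply: eq_sint => x; rewrite mulrBr|exact: oh|exact: og].
  have re (x y z u : R) : x + y - (z - u) = x + u - (z - y) by ring.
  have im (x y z u : R) : x - y + (z + u) = x + u + (z - y) by ring.
  by rewrite !D !B; split; [exact: re|exact: im].
by apply/funext => x; rewrite inner /=; congr Complex; ring.
Qed.

End complex_kernel.

Lemma Re_Im_div (R : realType) (z : R[i]) (L : R) :
  complex.Re (z / Complex L 0) = complex.Re z / L /\ complex.Im (z / Complex L 0) = complex.Im z / L.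
Proof.
have -> : (Complex L 0)^-1 = Complex L^-1 0 :> R[i] by exact: (esym (fmorphV (real_complex R) L)).
by case: z => u v /=; rewrite !mulr0 subr0 add0r.
Qed.

Lemma indic_ball (R : realType) d n (x : 'rV[R]_d) : \1_(eball0 d n%:R) x = Complex (ballf n x) 0 :> R[i].
Proof.
rewrite indicE /ballf; have [h|h] := boolP (_ < _).
  by rewrite mem_set.
by rewrite memNset //; exact/negP.
Qed.

Lemma conv_restr2 (R : realType) d (phi : M R d) n f :
  convF (restrF n%:R (cm_int phi)) (tildeF (restrF n%:R (cm_int phi))) f =
  correl phi (ballf n) (outer_ball true n) f.
Proof.
rewrite /convF /tildeF /restrF /correl; congr cm_int; apply/funext => x.
rewrite indic_ball; congr (_ * (cm_int _ _)^*); apply/funext => y.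
by rewrite indic_ball.
Qed.

Lemma conv_restr1 (R : realType) d (phi : M R d) n f :
  convF (restrF n%:R (cm_int phi)) (tildeF (cm_int phi)) f =
  correl phi (ballf n) (outer_ball false n) f.
Proof.
rewrite /convF /tildeF /restrF /correl; congr cm_int; apply/funext => x.
rewrite indic_ball; congr (_ * (cm_int _ _)^*); apply/funext => y.
by rewrite [Complex _ _](_ : _ = 1) ?mul1r.
Qed.

Lemma eq_cvgC (R : realType) (u v : nat -> R[i]) l : u =1 v -> cvgC v l -> cvgC u l.
Proof. by move=> /funext ->. Qed.

Theorem theorem6p2 (R : realType) (d : nat)
  (dO : measure_display) (O : measurableType dO) (P : probability O R)
  (lam : {measure set (BRd R d) -> \bar R}) (Hlam : is_lebesgue lam)
  (Phi : O -> M R d)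
  (HPhi : random_measure Phi) (Hstat : stationary P Phi)
  (Herg : ergodic P Phi) (Hsq : loc_sq_integrable P Phi)
  (mu2 : M2 R d) (Hmu2 : is_second_moment P Phi mu2)
  (mured : M R d) (Hred : is_reduced_second_moment lam mu2 mured) :
  {ae P, forall w : O,
    forall f : 'rV[R]_d -> R[i], Cc f ->
      cvgC (fun n : nat =>
              convF (restrF n%:R (cm_int (Phi w)))
                    (tildeF (restrF n%:R (cm_int (Phi w)))) f
              / Complex (fine (lam (eball0 d n%:R))) 0)
           (cm_int mured f)
      /\
      cvgC (fun n : nat =>
              convF (restrF n%:R (cm_int (Phi w)))
                    (tildeF (cm_int (Phi w))) f
              / Complex (fine (lam (eball0 d n%:R))) 0)
           (cm_int mured f)}.
Proof.
(* The exceptional null set is fixed before [f] is chosen. *)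
have := ae_law (J_limit_all HPhi Hstat Herg Hsq Hlam); apply: filterS => w Hw f Cf.
set phi := Phi w in Hw *.
(* A single radius serves both parts of [f], as [correl_J] requires. *)
have [cg [r1 gr1]] := Cc_Re Cf; have [ch [r2 hr2]] := Cc_Im Cf; pose r := (r1 + r2)%N.
have Cg : Cr r (fun x => complex.Re (f x)).
  by split=> //; apply: supp_in_mono gr1; rewrite ler_nat leq_addr.
have Ch : Cr r (fun x => complex.Im (f x)).
  by split=> //; apply: supp_in_mono hr2; rewrite ler_nat leq_addl.
have [_ gr] := Cg; have [_ hr] := Ch.
have [K K0 gK] := cont_supp_bdd cg gr; have [L L0 hL] := cont_supp_bdd ch hr.
have [g0 g1] := EY_mured HPhi Hsq cg gr gK K0 Hmu2 Hlam Hred.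
have [h0 h1] := EY_mured HPhi Hsq ch hr hL L0 Hmu2 Hlam Hred.
have lim e : cvgC (fun n => correl phi (ballf n) (outer_ball e n) f / Complex (fine (lam (eball0 d n%:R))) 0)
    (cm_int mured f).
  have lg s t := Hw r _ Cg s t e; have lh s t := Hw r _ Ch s t e.
  have JE n := correl_J phi (@baire_ballf R d n) (baire_outer R d e n) (@outer_le1 R d e n) Cg Ch (@outer_box R d e n r).
  pose j s t (k : 'rV[R]_d -> R) n := J phi s t (ballf n) (outer_ball e n) k / fine (lam (eball0 d n%:R)).
  pose g x := complex.Re (f x); pose h x := complex.Im (f x).
  (* The integrals against [mured] become the combinations of expectations of [Y] that match the
     terms of [correl_J]. *)
  rewrite cm_intE -g0 -g1 -h0 -h1; split.
    rewrite (_ : (fun n => complex.Re _) =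
      fun n => (j false false g n + j true true g n) - (j true false h n - j false true h n)).
      exact: (cvgB (cvgD (lg false false) (lg true true)) (cvgB (lh true false) (lh false true))).
    by apply/funext => n; rewrite (proj1 (Re_Im_div _ _)) (proj1 (JE _)) mulrBl mulrDl [in X in _ - X]mulrBl.
  rewrite (_ : (fun n => complex.Im _) =
    fun n => (j false false h n + j true true h n) + (j true false g n - j false true g n)).
    exact: (cvgD (cvgD (lh false false) (lh true true)) (cvgB (lg true false) (lg false true))).
  by apply/funext => n; rewrite (proj2 (Re_Im_div _ _)) (proj2 (JE _)) mulrDl [in X in _ + X]mulrBl [in X in X + _]mulrDl.
by split; [apply: eq_cvgC (lim true) => n; rewrite conv_restr2
          |apply: eq_cvgC (lim false) => n; rewrite conv_restr1].
Qed.
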